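(* Let $\gamma\in(1/3,1/2)$ and $\kappa\in(1/3,\gamma)$. Assume the rough driver hypothesis (H) below holds for $\gamma$, let $a_0\in\mathbb R^d$, and let $\sigma:\mathbb R^d\to\mathbb R^{n,d}$ be of class $C^3$, bounded and with bounded derivatives up to order $3$. Then there exists a unique $\tilde y\in\tilde{\mathcal Q}^\kappa([0,T];\mathbb R^d)$ with $\tilde y_0=0$ such that, for all $0\le s\le t\le T$, $$(\tilde\delta\tilde y)_{ts}=\mathcal J_{ts}\big(\tilde d x\,\sigma(y)\big),\qquad\text{where } y_v=a_0+\int_0^\infty \hat\phi(\eta)\,\tilde y_v(\eta)\,d\eta,$$ the integral being the convolutional rough integral of the controlled path $\sigma(y)$ described in the context.
   Context: Fix $T>0$ and a measurable $\hat\phi:(0,\infty)\to\mathbb R$. For a finite-dimensional space $V$ of vectors or matrices (Euclidean norm), $\mathcal L_1(V)$ is the space of measurable $g:[0,\infty)\to V$ with $\mathcal N[g;\mathcal L_1]=\int_0^\infty|\hat\phi(\xi)|(1+\xi)\|g(\xi)\|\,d\xi<\infty$. For an interval $I=[\ell_1,\ell_2]\subset[0,T]$ and $k\ge1$, $\tilde{\mathcal C}_k(I;V)$ is the set of continuous maps from $\{(t_1,\dots,t_k)\in I^k: t_1\ge\dots\ge t_k\}$ to $\mathcal L_1(V)$, written $(t_1,\dots,t_k)\mapsto A_{t_1\dots t_k}(\xi)$. Put $a_{ts}(\xi)=e^{-\xi(t-s)}-1$ and define $(\tilde\delta f)_{ts}(\xi)=f_t(\xi)-e^{-\xi(t-s)}f_s(\xi)$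 for $f\in\tilde{\mathcal C}_1$, $(\tilde\delta B)_{tus}(\xi)=B_{ts}(\xi)-B_{tu}(\xi)-e^{-\xi(t-u)}B_{us}(\xi)$ for $B\in\tilde{\mathcal C}_2$ ($t\ge u\ge s$). Norms: $\mathcal N[B;\tilde{\mathcal C}_2^\mu(I)]=\sup_{s<t}\mathcal N[B_{ts};\mathcal L_1]/|t-s|^\mu$; for $h\in\tilde{\mathcal C}_3$, $\mathcal N[h;\tilde{\mathcal C}_3^\mu(I)]=\inf\sum_i\sup_{s<u<t}\mathcal N[h^i_{tus};\mathcal L_1]|t-u|^{-\rho_i}|u-s|^{-(\mu-\rho_i)}$, the infimum over decompositions $h=\sum_ih^i$ and $\rho_i\in(0,\mu)$; for $f\in\tilde{\mathcal C}_1$, $\mathcal N[f;\tilde{\mathcal C}_1^\mu(I)]=\mathcal N[\tilde\delta f;\tilde{\mathcal C}_2^\mu(I)]$; $\tilde{\mathcal C}_k^\mu$ denotes elements of finite norm. For ordinary paths $z:I\to W$ and two-parameter $r$: $\delta z_{ts}=z_t-z_s$, $\mathcal N[z;\mathcal C_1^0]=\sup_s\|z_s\|$, $\mathcal N[z;\mathcal C_1^\mu]=\sup_{s\ne t}\|z_t-z_s\|/|t-s|^\mu$, $\mathcal N[r;\mathcal C_2^\mu]=\sup_{s\ne t}\|r_{ts}\|/|t-s|^\mu$. For matrices, $A\cdot B=\mathrm{Tr}(AB^* )$, and for $u,v\in\mathbb R^{1,n}$, $(u\otimes v)_{ij}=u_iv_j$. Convolutional sewing map: for $\mu>1$ and each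 $\tilde h\in\tilde{\mathcal C}_3^\mu(I;V)$ of the form $\tilde h=\tilde\delta B$ with $B\in\tilde{\mathcal C}_2(I;V)$, there is a unique $\tilde\Lambda\tilde h\in\tilde{\mathcal C}^\mu_2(I;V)$ with $\tilde\delta(\tilde\Lambda\tilde h)=\tilde h$. Hypothesis (H): $\tilde x^1\in\tilde{\mathcal C}_2^\gamma([0,T];\mathbb R^{1,n})$, $\tilde x^2\in\tilde{\mathcal C}_2^{2\gamma}([0,T];\mathbb R^{n,n})$, $\tilde x^3\in\tilde{\mathcal C}_3^{3\gamma}([0,T];\mathbb R^{n,n})$ are given with $\tilde\delta\tilde x^1=0$ and $(\tilde\delta\tilde x^2)_{tus}=\tilde x^1_{tu}\otimes x^1_{us}+\tilde x^3_{tus}$, where $x^1_{ts}=\int_0^\infty\tilde x^1_{ts}(\xi)\hat\phi(\xi)d\xi$. (For a smooth path $x$: $\tilde x^1_{ts}(\xi)=\int_s^te^{-\xi(t-v)}dx_v$, $\tilde x^2_{ts}(\xi)=\int_s^te^{-\xi(t-v)}dx_v\otimes x^1_{vs}$, $\tilde x^3_{tus}(\xi)=\int_u^te^{-\xi(t-v)}dx_v\otimes(x^1_{vs}-x^1_{vu}-x^1_{us})$.) Controlled paths: $\mathcal Q^\kappa(I;\mathbb R^k)$ is the set of $y:I\to\mathbb R^k$ with $(\delta y)_{ts}=(x^1_{ts}\zeta_s)^*+r_{ts}$, $\zeta\in\mathcal C_1^\kappa(I;\mathbb R^{n,k})$, $r\in\mathcal C_2^{2\kappa}(I;\mathbb R^k)$.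 $\tilde{\mathcal Q}^\kappa(I;\mathbb R^k)$ is the set of $\tilde y\in\tilde{\mathcal C}_1(I;\mathbb R^k)$ with $(\tilde\delta\tilde y)_{ts}(\xi)=(\tilde x^1_{ts}(\xi)\zeta_s)^*+\tilde r_{ts}(\xi)$, $\zeta\in\mathcal C_1^\kappa(I;\mathbb R^{n,k})$, $\tilde r\in\tilde{\mathcal C}_2^{2\kappa}(I;\mathbb R^k)$. Integral: for $z\in\mathcal Q^\kappa(I;\mathbb R^n)$ with decomposition $(\zeta,r)$, $\mathcal J_{ts}(\tilde dx\,z)=\tilde x^1_{ts}z_s+\tilde x^2_{ts}\cdot\zeta_s^*+(\tilde\Lambda h)_{ts}$, with $h_{tus}=\tilde x^1_{tu}r_{us}+\tilde x^2_{tu}\cdot(\zeta_u-\zeta_s)^*-\tilde x^3_{tus}\cdot\zeta_s^*$; for $\mathbb R^{n,l}$-valued $z$ whose columns $z^{(j)}$ are controlled, $\mathcal J(\tilde dx\,z)$ is $\mathbb R^l$-valued with $j$-th coordinate $\mathcal J(\tilde dx\,z^{(j)})$. Controlled structure of $\sigma(y)$: if $(\tilde\delta\tilde y)=(\tilde x^1\zeta)^*+\tilde r$, then $(\delta y)_{ts}=(x^1_{ts}\zeta_s)^*+r^y_{ts}$ with $r^y_{ts}=\int_0^\infty\hat\phi(\xi)[\tilde r_{ts}(\xi)+a_{ts}(\xi)\tilde y_s(\xi)]d\xi$, and the $j$-th column $\sigma^{(j)}(y)$ is decomposed with $\zeta^{(j)}_s=\zeta_s(D\sigma^{(j)}(y_s))^*$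 and remainder $\sigma^{(j)}(y_t)-\sigma^{(j)}(y_s)-(x^1_{ts}\zeta^{(j)}_s)^*$.
   Formalization: The solution is required to have the decomposition ζ = σ(y), used both for membership in the controlled class and in the integral; with an arbitrary ζ uniqueness fails for degenerate drivers (e.g. zero first-order part and a nonzero second-order part). *)

(* Defs.v *)
From HB Require Import structures.
From mathcomp Require Import all_boot all_order all_algebra.
From mathcomp Require Import all_classical all_reals all_analysis.
From Stdlib Require Import ClassicalEpsilon.

Set Implicit Arguments.
Unset Strict Implicit.
Unset Printing Implicit Defensive.

Import Order.TTheory GRing.Theory Num.Theory.
Import numFieldNormedType.Exports.

Local Open Scope classical_set_scope.
Local Open Scope ring_scope.

Section Defs.
Variable R : realType.

Definition frob (p q : nat) (A : 'M[R]_(p, q)) : R :=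
  Num.sqrt (\sum_i \sum_j A i j ^+ 2).

Definition halfline : set R := `[0%R, +oo[%classic.

Definition NL1 (phi : R -> R) (p q : nat) (g : R -> 'M[R]_(p, q)) : \bar R :=
  (\int[@lebesgue_measure R]_(x in halfline)
     ((`|phi x| * (1 + x) * frob (g x))%:E))%E.

Definition inL1 (phi : R -> R) (p q : nat) (g : R -> 'M[R]_(p, q)) : Prop :=
  (forall i j, measurable_fun halfline (fun x => g x i j)) /\
  (NL1 phi g < +oo)%E.

Definition Rint0 (f : R -> R) : R :=
  Rintegral (@lebesgue_measure R) halfline f.

Definition phint (phi : R -> R) (p q : nat) (g : R -> 'M[R]_(p, q)) : 'M[R]_(p, q) :=
  \matrix_(i, j) Rint0 (fun xi => phi xi * g xi i j).

(* elements of tilde C_1, tilde C_2, tilde C_3 are curried functions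
   f t xi,  B t s xi,  h t u s xi, only relevant on the simplex
   T >= t >= u >= s >= 0 and for xi >= 0 *)

Definition tC1 (phi : R -> R) (T : R) (p q : nat) (f : R -> R -> 'M[R]_(p, q)) : Prop :=
  (forall t, 0 <= t <= T -> inL1 phi (f t)) /\
  (forall t, 0 <= t <= T -> forall e : R, 0 < e -> exists2 dl : R, 0 < dl &
     forall t', 0 <= t' <= T -> `|t' - t| < dl ->
       (NL1 phi (fun xi => (f t' xi - f t xi)%R) < e%:E)%E).

Definition tC2 (phi : R -> R) (T : R) (p q : nat) (B : R -> R -> R -> 'M[R]_(p, q)) : Prop :=
  (forall t s, 0 <= s <= t -> t <= T -> inL1 phi (B t s)) /\
  (forall t s, 0 <= s <= t -> t <= T -> forall e : R, 0 < e -> exists2 dl : R, 0 < dl &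
     forall t' s', 0 <= s' <= t' -> t' <= T -> `|t' - t| < dl -> `|s' - s| < dl ->
       (NL1 phi (fun xi => (B t' s' xi - B t s xi)%R) < e%:E)%E).

Definition tC3 (phi : R -> R) (T : R) (p q : nat)
    (h : R -> R -> R -> R -> 'M[R]_(p, q)) : Prop :=
  (forall t u s, 0 <= s <= u -> u <= t <= T -> inL1 phi (h t u s)) /\
  (forall t u s, 0 <= s <= u -> u <= t <= T -> forall e : R, 0 < e ->
     exists2 dl : R, 0 < dl &
     forall t' u' s', 0 <= s' <= u' -> u' <= t' <= T ->
       `|t' - t| < dl -> `|u' - u| < dl -> `|s' - s| < dl ->
       (NL1 phi (fun xi => (h t' u' s' xi - h t u s xi)%R) < e%:E)%E).

Definition dtil1 (p q : nat) (f : R -> R -> 'M[R]_(p, q)) : R -> R -> R -> 'M[R]_(p, q) :=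
  fun t s xi => f t xi - expR (- xi * (t - s)) *: f s xi.

Definition dtil2 (p q : nat) (B : R -> R -> R -> 'M[R]_(p, q))
  : R -> R -> R -> R -> 'M[R]_(p, q) :=
  fun t u s xi => B t s xi - B t u xi - expR (- xi * (t - u)) *: B u s xi.

Definition tC2mu (phi : R -> R) (T mu : R) (p q : nat)
    (B : R -> R -> R -> 'M[R]_(p, q)) : Prop :=
  tC2 phi T B /\
  exists C : R, forall t s, 0 <= s -> s < t -> t <= T ->
    (NL1 phi (B t s) <= (C * (t - s) `^ mu)%R%:E)%E.

(* tilde C_3^mu([0,T]) : finite norm, i.e. some finite decomposition
   h = sum_i h^i with rho_i in (0,mu) and each sup finite *)
Definition tC3mu (phi : R -> R) (T mu : R) (p q : nat)
    (h : R -> R -> R -> R -> 'M[R]_(p, q)) : Prop :=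
  tC3 phi T h /\
  exists (m : nat) (hs : 'I_m -> R -> R -> R -> R -> 'M[R]_(p, q)) (rho : 'I_m -> R) (C : R),
    (forall i, tC3 phi T (hs i) /\ 0 < rho i < mu /\
       forall t u s, 0 <= s -> s < u -> u < t -> t <= T ->
         (NL1 phi (hs i t u s) <= (C * (t - u) `^ rho i * (u - s) `^ (mu - rho i))%R%:E)%E) /\
    (forall t u s xi, 0 <= s <= u -> u <= t <= T -> 0 <= xi ->
       h t u s xi = \sum_(i < m) hs i t u s xi).

Definition holder (T kappa : R) (p q : nat) (z : R -> 'M[R]_(p, q)) : Prop :=
  exists C : R, forall s t, 0 <= s <= T -> 0 <= t <= T ->
    frob (z t - z s) <= C * `|t - s| `^ kappa.

Definition x1 (phi : R -> R) (n : nat) (xt1 : R -> R -> R -> 'M[R]_(1, n)) : R -> R -> 'M[R]_(1, n) :=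
  fun t s => phint phi (xt1 t s).

Definition roughH (phi : R -> R) (T gamma : R) (n : nat)
    (xt1 : R -> R -> R -> 'M[R]_(1, n)) (xt2 : R -> R -> R -> 'M[R]_(n, n))
    (xt3 : R -> R -> R -> R -> 'M[R]_(n, n)) : Prop :=
  [/\ tC2mu phi T gamma xt1, tC2mu phi T (2 * gamma) xt2, tC3mu phi T (3 * gamma) xt3,
      (forall t u s xi, 0 <= s <= u -> u <= t <= T -> 0 <= xi -> dtil2 xt1 t u s xi = 0) &
      (forall t u s xi, 0 <= s <= u -> u <= t <= T -> 0 <= xi ->
         dtil2 xt2 t u s xi = (xt1 t u xi)^T *m x1 phi xt1 u s + xt3 t u s xi)].

(* convolutional sewing map on [0,T]: the (unique) R in tilde C_2^mu, mu > 1,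
   with dtil R = h (chosen by Hilbert's epsilon) *)
Definition Lambda (phi : R -> R) (T : R) (p q : nat)
    (h : R -> R -> R -> R -> 'M[R]_(p, q)) : R -> R -> R -> 'M[R]_(p, q) :=
  epsilon (inhabits (fun _ _ _ => 0))
    (fun B => exists mu : R, 1 < mu /\ tC2mu phi T mu B /\
       forall t u s xi, 0 <= s <= u -> u <= t <= T -> 0 <= xi ->
         dtil2 B t u s xi = h t u s xi).

Definition partial (d : nat) (k : 'I_d) (g : 'cV[R]_d -> R) : 'cV[R]_d -> R :=
  fun y => derive g y (delta_mx k 0).

Fixpoint iter_partial (d : nat) (ks : seq 'I_d) (g : 'cV[R]_d -> R) : 'cV[R]_d -> R :=
  if ks is k :: ks' then partial k (iter_partial ks' g) else g.

Definition C3b (d : nat) (g : 'cV[R]_d -> R) : Prop :=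
  (forall ks : seq 'I_d, (size ks < 3)%N -> forall k y,
      derivable (iter_partial ks g) y (delta_mx k 0)) /\
  (forall ks : seq 'I_d, (size ks <= 3)%N ->
      continuous (iter_partial ks g) /\
      exists M : R, forall y, `|iter_partial ks g y| <= M).

Definition jac_col (n d : nat) (sigma : 'cV[R]_d -> 'M[R]_(n, d)) (j : 'I_d)
    (y : 'cV[R]_d) : 'M[R]_(n, d) :=
  \matrix_(i, k) partial k (fun z => sigma z i j) y.

(* Gubinelli derivative of sigma^(j)(y) when y has derivative zeta:
   zeta^(j)_s = zeta_s (D sigma^(j)(y_s))^* *)
Definition zetaj (n d : nat) (sigma : 'cV[R]_d -> 'M[R]_(n, d)) (j : 'I_d)
    (zeta : R -> 'M[R]_(n, d)) (y : R -> 'cV[R]_d) : R -> 'M[R]_(n, n) :=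
  fun s => zeta s *m (jac_col sigma j (y s))^T.

(* Rough convolutional integral J_{ts}(dx sigma(y)) (R^d-valued), where y has
   Gubinelli derivative zeta *)
Definition Jsig (phi : R -> R) (T : R) (n d : nat)
    (xt1 : R -> R -> R -> 'M[R]_(1, n)) (xt2 : R -> R -> R -> 'M[R]_(n, n))
    (xt3 : R -> R -> R -> R -> 'M[R]_(n, n))
    (sigma : 'cV[R]_d -> 'M[R]_(n, d)) (zeta : R -> 'M[R]_(n, d))
    (y : R -> 'cV[R]_d) : R -> R -> R -> 'cV[R]_d :=
  fun t s xi => \col_(j < d)
    (let z := fun v => col j (sigma (y v)) in
     let zj := zetaj sigma j zeta y in
     let r := fun t' s' => z t' - z s' - (x1 phi xt1 t' s' *m zj s')^T in
     let h := fun t' u' s' xi' =>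
        xt1 t' u' xi' *m r u' s'
        + (\tr (xt2 t' u' xi' *m (zj u' - zj s')))%:M
        - (\tr (xt3 t' u' s' xi' *m zj s'))%:M in
     (xt1 t s xi *m z s + (\tr (xt2 t s xi *m zj s))%:M
      + Lambda phi T h t s xi) 0 0).

(* ytil is a solution in tilde Q^kappa([0,T];R^d) with ytil_0 = 0, where the
   controlled decomposition used is zeta = sigma(y) *)
Definition is_solution (phi : R -> R) (T kappa : R) (n d : nat)
    (xt1 : R -> R -> R -> 'M[R]_(1, n)) (xt2 : R -> R -> R -> 'M[R]_(n, n))
    (xt3 : R -> R -> R -> R -> 'M[R]_(n, n))
    (sigma : 'cV[R]_d -> 'M[R]_(n, d)) (a0 : 'cV[R]_d)
    (ytil : R -> R -> 'cV[R]_d) : Prop :=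
  let y := fun v => a0 + phint phi (ytil v) in
  let zeta := fun v => sigma (y v) in
  [/\ tC1 phi T ytil,
      holder T kappa zeta,
      tC2mu phi T (2 * kappa)
        (fun t s xi => dtil1 ytil t s xi - (xt1 t s xi *m zeta s)^T),
      (forall xi, 0 <= xi -> ytil 0 xi = 0) &
      (forall t s xi, 0 <= s <= t -> t <= T -> 0 <= xi ->
         dtil1 ytil t s xi = Jsig phi T xt1 xt2 xt3 sigma zeta y t s xi)].

End Defs.

(* Main.v *)
From HB Require Import structures.
From mathcomp Require Import all_boot all_order all_algebra.
From mathcomp Require Import all_classical all_reals all_analysis measurable_realfun.
From mathcomp Require Import ring lra zify.
From Stdlib Require ClassicalEpsilon.
Require Import Defs.

(* Davie's approach.  On the space of L1(V)-valued states, set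
     mu_ts(Y) = e^{-xi(t-s)} Y + x1_ts sigma(y) + x2_ts . sigma(y) Dsigma(y)^*,  y = a0 + int phi Y,
   which is an almost flow: the defect mu_tu mu_us - mu_ts is Lipschitz of size (t-s)^{3 kappa}
   with 3 kappa > 1, and mu_ts itself has Lipschitz constant 1 + O((t-s)^kappa).  Euler schemes along
   dyadic grids then converge to a path Y with Y_t = mu_ts(Y_s) + O((t-s)^{3 kappa}), and such
   paths are determined by Y_0 up to a null set.  The sewing map is the case of an affine mu, so the
   same argument shows that Lambda is defined on the germs at hand, that solutions of the equation
   are exactly the paths of this kind, and the equation itself, read at s = 0, removes the null
   sets. *)

Set Implicit Arguments.
Unset Strict Implicit.
Unset Printing Implicit Defensive.

Import Order.TTheory GRing.Theory Num.Theory.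
Import numFieldNormedType.Exports.

Local Open Scope classical_set_scope.
Local Open Scope ring_scope.

(** * Powers, discrete sewing and Gronwall estimates *)

(** The comparison of two paths [Y] and [Z] shapes the hypotheses: not only must the errors
    [Y_j - mu(Y_i)] be small, the errors of [Y] and [Z] must be close when [Y] and [Z] are. This
    asks for bounds on second differences of [mu], hence of [sigma] and of its Taylor remainder, and
    here the third derivatives enter.

    The semigroup is not continuous in operator norm on L1. What saves the expansion of [y] is the
    factor 1 + xi of the weight: the integral of phi (e^{-xi h} - 1) Y is at most h N(Y), and h <= c
    h^{2 kappa} because 2 kappa <= 1, so the semigroup acts on [y] at the same order as x2. This
    term is proportional to N(Y), which is why the defect has linear growth in the state instead of
    a uniform bound.

    Each comparison of paths gives up a part of the exponent: th > 1 is written a + b with b > 1,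
    stability is run at exponent b and the spare factor D^a tends to 0 with the mesh. The exponent
    attached to [Lambda] by the choice operator is known only to exceed 1, so paths must be
    comparable at any exponent in (1, 3 kappa]. *)

Section Powers.
Variable R : realType.
Implicit Types a b t th x y : R.

(** One factor is split off each power, a^th = a a^(th-1), and a^(th-1) is bounded by (2/3
    (a+b))^(th-1). The gain (2/3)^(th-1) < 1 for an almost balanced cut drives the discrete
    sewing. *)
Lemma powR_split a b th : 1 < th -> 0 <= a -> 0 <= b ->
  a <= 2 / 3 * (a + b) -> b <= 2 / 3 * (a + b) ->
  a `^ th + b `^ th <= (2 / 3) `^ (th - 1) * (a + b) `^ th.
Proof.
move=> th1 a0 b0 ha hb; have th0 : 0 < th by lra.
rewrite -(mulr_powRB1 a0 th0) -(mulr_powRB1 b0 th0).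
have s0 : 0 <= a + b by rewrite addr_ge0.
rewrite -(mulr_powRB1 s0 th0).
have q0 : 0 <= 2 / 3 * (a + b) by nra.
rewrite mulrCA -powRM ?divr_ge0 //.
set q := 2 / 3 * (a + b) in ha hb q0 *; rewrite mulrDl.
have th10 : 0 <= th - 1 by lra.
by rewrite lerD // ler_wpM2l // ge0_ler_powR.
Qed.

Lemma powR_small (e C th : R) : 0 < e -> 0 <= C -> 0 < th ->
  exists2 t, 0 < t & forall s, 0 <= s -> s <= t -> C * s `^ th <= e.
Proof.
move=> e0 C0 th0; exists ((e / (C + 1)) `^ th^-1).
  by rewrite powR_gt0 // divr_gt0 //; lra.
move=> s s0 st; have Cp : 0 < C + 1 by lra.
have : s `^ th <= e / (C + 1).
  have -> : e / (C + 1) = ((e / (C + 1)) `^ th^-1) `^ th.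
    by rewrite -powRrM mulVf ?gt_eqF // powRr1 // divr_ge0 // ltW.
  by rewrite ge0_ler_powR ?nnegrE ?powR_ge0 // ltW.
rewrite ler_pdivlMr // mulrC => h.
by have := powR_ge0 s th; nra.
Qed.

Lemma ler_powRl (x y a : R) : 0 <= a -> 0 <= x -> x <= y -> x `^ a <= y `^ a.
Proof. by move=> a0 x0 xy; rewrite ge0_ler_powR ?nnegrE // (le_trans x0). Qed.

Lemma ler_powRr (T x a b : R) : 0 <= x -> x <= T -> 0 < a -> a <= b ->
  x `^ b <= T `^ (b - a) * x `^ a.
Proof.
move=> x0 xT a0 ab; have [->|xn0] := eqVneq x 0.
  by rewrite powR0 ?gt_eqF ?mulr_ge0 ?powR_ge0 //; lra.
rewrite -{1}(subrK a b) (@powRD _ x); last by rewrite xn0 implybT.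
rewrite ler_wpM2r ?powR_ge0 // ge0_ler_powR ?nnegrE ?subr_ge0 //.
exact: le_trans xT.
Qed.

(** The worst case is k = 3, cut as 1 + 2; this is the origin of the ratio 2/3. *)
Let half_split k : (1 < k)%N -> exists p q : nat,
  [/\ k = (p + q)%N, (0 < p)%N & (0 < q)%N] /\ (3 * p <= 2 * k)%N /\ (3 * q <= 2 * k)%N.
Proof.
move=> k1; exists k./2, (k - k./2)%N.
have h := odd_double_half k.
have ho : (odd k <= 1)%N by case: (odd k).
by move: h ho; set o := nat_of_bool _; set p := k./2 => h ho; split; [split|split]; lia.
Qed.

(** Closing of the induction: the amplification 1 + (1-lam)/2 times the gain lam is at most
    (1+lam)/2, and K = 2/(1-lam) is exactly the constant for which (1+lam)/2 K + 1 = K. *)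
Let dsew_arith (lam b w1 w2 P Q W : R) : 0 <= lam -> lam < 1 -> 0 <= b ->
  0 <= Q -> 0 <= W -> P + Q <= lam * W ->
  w1 <= 2 / (1 - lam) * b * P -> w2 <= 2 / (1 - lam) * b * Q ->
  w2 + (1 + (1 - lam) / 2) * w1 + b * W <= 2 / (1 - lam) * b * W.
Proof.
move=> lam0 lam1 b0 Q0 W0 hs h1 h2.
have lam1' : 0 < 1 - lam by lra.
set K := 2 / (1 - lam) in h1 h2 *.
have KE : K * (1 - lam) = 2 by rewrite /K mulfVK // gt_eqF.
have K0 : 0 <= K by rewrite divr_ge0 // ltW.
have Kb : 0 <= K * b by rewrite mulr_ge0.
have {}h1 : (1 + (1 - lam) / 2) * w1 <= (1 + (1 - lam) / 2) * (K * b * P).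
  by rewrite ler_wpM2l //; clear -lam1; lra.
have {}h2 : w2 <= (1 + (1 - lam) / 2) * (K * b * Q).
  apply: (le_trans h2); rewrite ler_peMl ?(mulr_ge0 Kb Q0) //.
  by clear -lam1; lra.
have h3 : (1 + (1 - lam) / 2) * (K * b) * (P + Q) <=
          (1 + (1 - lam) / 2) * (K * b) * (lam * W).
  by rewrite ler_wpM2l // mulr_ge0 //; clear -lam1; lra.
have h4 : (1 + (1 - lam) / 2) * lam <= (1 + lam) / 2 by clear -lam1 lam0; nra.
have h5 : (1 + (1 - lam) / 2) * lam * (K * b * W) <= (1 + lam) / 2 * (K * b * W).
  by rewrite ler_wpM2r ?(mulr_ge0 Kb W0).
have h6 : (1 + lam) / 2 * (K * b * W) + b * W = K * b * W.
  have -> : b * W = K * (1 - lam) / 2 * (b * W) by rewrite KE divff ?mul1r.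
  by field.
by clear -h1 h2 h3 h5 h6; lra.
Qed.

(** Strong induction on the length of the window, cut near its middle. An amplification slightly
    above one of the left half is affordable because the two halves together have lost the factor
    [lam]. The bound does not see the number of points, only [b] times the length to the power
    [th]. *)
Lemma discrete_sewing (th b : R) (w : nat -> nat -> R) (i0 i1 : nat) :
  let lam := (2 / 3) `^ (th - 1) in
  1 < th -> 0 <= b ->
  (forall i, (i0 <= i)%N -> (i < i1)%N -> w i i.+1 <= b) ->
  (forall i k j, (i0 <= i)%N -> (i < k)%N -> (k < j)%N -> (j <= i1)%N ->
     w i j <= w k j + (1 + (1 - lam) / 2) * w i k + b * (j - i)%:R `^ th) ->
  forall i j, (i0 <= i)%N -> (i < j)%N -> (j <= i1)%N ->
    w i j <= 2 / (1 - lam) * b * (j - i)%:R `^ th.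
Proof.
move=> lam th1 b0 hb hw.
have lam0 : 0 <= lam by rewrite powR_ge0.
have lam1 : lam < 1.
  have -> : 1 = 1 `^ (th - 1) :> R by rewrite powR1.
  by rewrite /lam gt0_ltr_powR ?nnegrE //; lra.
have K1 : 1 <= 2 / (1 - lam).
  by rewrite ler_pdivlMr ?subr_gt0 // mul1r; clear -lam0; lra.
set K := 2 / (1 - lam).
have key k : forall i, (i0 <= i)%N -> (0 < k)%N -> (i + k <= i1)%N ->
    w i (i + k)%N <= K * b * k%:R `^ th.
  elim/ltn_ind: k => k IH i i0i k0 ki1.
  have [k1|k1] := leqP k 1.
    have -> : k = 1%N by lia.
    rewrite addn1 powR1 mulr1; apply: (le_trans (hb _ i0i _)); first by lia.
    by rewrite ler_peMl.
  have [p [q [[kE p0 q0] [hp3 hq3]]]] := half_split k1.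
  have pk : (p < k)%N by lia.
  have qk : (q < k)%N by lia.
  have ikE : (i + k = i + p + q)%N by lia.
  have hp := IH p pk i i0i p0 (leq_trans (leq_add (leqnn i) (ltnW pk)) ki1).
  have hq := IH q qk (i + p)%N (leq_trans i0i (leq_addr _ _)) q0.
  rewrite -ikE in hq; have {}hq := hq ki1.
  have ip : (i < i + p)%N by lia.
  have ipk : (i + p < i + k)%N by lia.
  have := hw i (i + p)%N (i + k)%N i0i ip ipk ki1; rewrite addKn => h.
  apply: (le_trans h).
  have hs : p%:R `^ th + q%:R `^ th <= lam * k%:R `^ th :> R.
    have E : (p%:R + q%:R = k%:R :> R) by rewrite -natrD -kE.
    rewrite -E /lam; apply: powR_split => //; rewrite E.
      by move: hp3; rewrite -(ler_nat R) !natrM; clear; lra.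
    by move: hq3; rewrite -(ler_nat R) !natrM; clear; lra.
  by apply: (@dsew_arith lam b _ _ _ _ _ lam0 lam1 b0 _ _ hs hp hq); rewrite powR_ge0.
move=> i j i0i ij ji1.
have h := key (j - i)%N i i0i; rewrite subn_gt0 (subnKC (ltnW ij)) in h.
exact: h.
Qed.

(** Gronwall in discrete form: a growth factor [c] per window of [m] steps gives [c ^+ k] after [k]
    windows. *)
Lemma window_growth (u : nat -> R) (c : R) (m n : nat) :
  (forall i, 0 <= u i) -> 1 <= c ->
  (forall i j, (i <= j)%N -> (j <= i + m)%N -> (j <= n)%N -> u j <= c * u i) ->
  forall k i, (i <= k * m)%N -> (i <= n)%N -> u i <= c ^+ k * u 0%N.
Proof.
move=> u0 c1 hu; elim=> [|k IH] i ik iN.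
  by rewrite expr0 mul1r; have -> : i = 0%N by lia.
have h := hu (i - m)%N i ltac:(lia) ltac:(lia) iN.
apply: (le_trans h); rewrite exprS -mulrA ler_wpM2l //; first by lra.
by apply: IH; lia.
Qed.

(** Serves to bound a maximum by half of itself plus data, without an a priori bound. *)
Lemma window_max (u : nat -> R) (i0 m : nat) :
  exists2 i, (i0 <= i <= i0 + m)%N &
    forall j, (i0 <= j <= i0 + m)%N -> u j <= u i.
Proof.
elim: m => [|m [i hi ih]].
  exists i0; first by lia.
  by move=> j hj; have -> : j = i0 by lia.
have [h|h] := lerP (u (i0 + m.+1)%N) (u i).
  exists i; first by lia.
  move=> j hj; have [->//|jn] := eqVneq j (i0 + m.+1)%N.
  by apply: ih; lia.
exists (i0 + m.+1)%N; first by lia.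
move=> j hj; have [->//|jn] := eqVneq j (i0 + m.+1)%N.
by apply: (le_trans (ih _ _)); [lia|exact: ltW].
Qed.

End Powers.

(** * Almost flows on seminormed groups *)

(** No separation and no scaling: the elements will be functions that are not identified almost
    everywhere, and only the group structure is used. *)
Record seminorm (R : realType) (E : zmodType) (N : E -> R) : Prop := {
  sn_ge0 : forall x, 0 <= N x ;
  sn_add : forall x y, N (x + y) <= N x + N y ;
  sn_opp : forall x, N (- x) = N x ;
  sn_0 : N 0 = 0 }.

(** Completeness with a rate, for sequences with geometric increments only; [l] is determined up to
    [N]-null elements. The constant [K] leaves room for a completeness proof made coordinate by
    coordinate. *)
Definition geometrically_complete (R : realType) (E : zmodType) (N : E -> R) :=
  exists2 K : R, 0 <= K & forall (u : nat -> E) (c q : R), 0 <= q -> q < 1 ->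
    (forall k, N (u k.+1 - u k) <= c * q ^+ k) ->
    exists l, forall k, N (u k - l) <= K * (c / (1 - q)) * q ^+ k.

(** [af_four] controls second differences: it transports the distance between the local errors of
    two paths. [af_defect] grows linearly in the state and [af_defect_lip] is its Lipschitz form.
    Identities are required only up to null elements. *)
Record almost_flow (R : realType) (E : zmodType) (N : E -> R) (T g th C : R)
    (mu : R -> R -> E -> E) : Prop := {
  af_T : 0 < T ; af_g : 0 < g ; af_th : 1 < th ; af_C : 0 <= C ;
  af_id : forall t Y, 0 <= t -> t <= T -> N (mu t t Y - Y) = 0 ;
  af_growth : forall t s Y, 0 <= s -> s <= t -> t <= T ->
    N (mu t s Y) <= N Y + C * (t - s) `^ g ;
  af_four : forall t s Y Y' Z Z', 0 <= s -> s <= t -> t <= T ->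
    N ((mu t s Y - mu t s Y') - (mu t s Z - mu t s Z')) <=
      (1 + C * (t - s) `^ g) * N ((Y - Y') - (Z - Z'))
      + C * (N (Y - Y') + N (Z - Z')) * N (Y - Z) ;
  af_defect : forall t u s Y, 0 <= s -> s <= u -> u <= t -> t <= T ->
    N (mu t u (mu u s Y) - mu t s Y) <= C * (1 + N Y) * (t - s) `^ th ;
  af_defect_lip : forall t u s Y Z, 0 <= s -> s <= u -> u <= t -> t <= T ->
    N ((mu t u (mu u s Y) - mu t s Y) - (mu t u (mu u s Z) - mu t s Z)) <=
      C * (1 + N Y + N Z) * N (Y - Z) * (t - s) `^ th }.

Lemma subACA (V : zmodType) (a b c d : V) : a - b - (c - d) = (a - c) - (b - d).
Proof. by rewrite !opprD !addrA (addrAC a). Qed.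

Section Seminorm.
Variables (R : realType) (E : zmodType) (N : E -> R).
Hypothesis HN : seminorm N.

Lemma sn_sub x y : N (x - y) <= N x + N y.
Proof. by rewrite -(sn_opp HN y) sn_add. Qed.

Lemma sn_sym x y : N (x - y) = N (y - x).
Proof. by rewrite -opprB sn_opp. Qed.

Lemma sn_tri y x z : N (x - z) <= N (x - y) + N (y - z).
Proof. by rewrite -{1}(subrK y x) -addrA sn_add. Qed.

Lemma sn_le_dist x y : N x <= N y + N (x - y).
Proof. by rewrite -{1}(subrK y x) addrC sn_add. Qed.

End Seminorm.

(** The four-point bound against the degenerate pair [(Y, Y)]: the quadratic term carries the factor
    [N (Y - Y)] and vanishes. *)
Lemma mu_lip (R : realType) (E : zmodType) (N : E -> R) (T g th C : R)
  (mu : R -> R -> E -> E) (HN : seminorm N) (Hmu : almost_flow N T g th C mu) (t s : R) Y Z : 0 <= s -> s <= t -> t <= T ->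
  N (mu t s Y - mu t s Z) <= (1 + C * (t - s) `^ g) * N (Y - Z).
Proof.
move=> s0 st tT; have := af_four Hmu Y Z Y Y s0 st tT.
by rewrite !subrr !subr0 (sn_0 HN) mulr0 addr0.
Qed.

Lemma mu_lipT (R : realType) (E : zmodType) (N : E -> R) (T g th C : R)
  (mu : R -> R -> E -> E) (HN : seminorm N) (Hmu : almost_flow N T g th C mu) (t s : R) Y Z : 0 <= s -> s <= t -> t <= T ->
  N (mu t s Y - mu t s Z) <= (1 + C * T `^ g) * N (Y - Z).
Proof.
move=> s0 st tT; apply: (le_trans (mu_lip HN Hmu Y Z s0 st tT)).
have [T0 g0 C0] : [/\ 0 < T, 0 < g & 0 <= C] by case: Hmu.
rewrite ler_wpM2r ?(sn_ge0 HN) // lerD2l ler_wpM2l //.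
by apply: ler_powRl; lra.
Qed.

Lemma lam_lt1 (R : realType) (a : R) : 1 < a -> (2 / 3 : R) `^ (a - 1) < 1.
Proof.
move=> a1; rewrite -[ltRHS](_ : 1 `^ (a - 1) = 1); last by rewrite powR1.
by rewrite gt0_ltr_powR ?nnegrE //; lra.
Qed.

Lemma gridB (R : realType) (D : R) (i j : nat) : (i <= j)%N ->
  j%:R * D - i%:R * D = (j - i)%:R * D.
Proof. by move=> ij; rewrite -mulrBl -natrB. Qed.

Lemma grid_le (R : realType) (D : R) (i j : nat) : 0 <= D -> (i <= j)%N -> i%:R * D <= j%:R * D.
Proof. by move=> D0 ij; rewrite ler_wpM2r // ler_nat. Qed.

(** The quantity sewn is w i j = N(Y_j - mu_ji Y_i), which is zero over one step. Its subadditivity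
    defect contains the size of the scheme, so the maximum [A] of 1 + N(Y) over the window appears
    in the bound; on a short window half of [A] is absorbed. *)
Lemma euler_window (R : realType) (E : zmodType) (N : E -> R) (T g th C : R)
  (mu : R -> R -> E -> E) (HN : seminorm N) (Hmu : almost_flow N T g th C mu) : exists K tau : R, [/\ 0 <= K, 0 < tau &
  forall (D : R) (Y : nat -> E) (i0 i1 : nat), 0 <= D -> (i0 <= i1)%N ->
  (i1 - i0)%:R * D <= tau -> i1%:R * D <= T ->
  (forall i, (i0 <= i)%N -> (i < i1)%N ->
     Y i.+1 = mu (i.+1%:R * D) (i%:R * D) (Y i)) ->
  (forall i j, (i0 <= i)%N -> (i <= j)%N -> (j <= i1)%N ->
     N (Y j - mu (j%:R * D) (i%:R * D) (Y i))
       <= K * (1 + N (Y i0)) * ((j - i)%:R * D) `^ th) /\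
  (forall j, (i0 <= j)%N -> (j <= i1)%N -> 1 + N (Y j) <= 4 * (1 + N (Y i0)))].
Proof.
have [T0 g0 th1 C0] : [/\ 0 < T, 0 < g, 1 < th & 0 <= C] by case: Hmu.
pose lam := (2 / 3 : R) `^ (th - 1).
have lam1 : lam < 1 by exact: lam_lt1.
have lam0 : 0 <= lam by exact: powR_ge0.
set Kd := 2 / (1 - lam).
have Kd0 : 0 <= Kd by rewrite divr_ge0 // subr_ge0 ltW.
have e0 : 0 < (1 - lam) / 2 by clear -lam1; lra.
(* [ta] keeps the Lipschitz constant of [mu] below the amplification allowed by the sewing, and [tb]
   makes the sewn error at most half of [A]. *)
have [ta ta0 hta] := powR_small e0 C0 g0.
have th0 : 0 < th by clear -th1; lra.
have [tb tb0 htb] := @powR_small R (1 / 2) (Kd * C) th ltac:(lra) (mulr_ge0 Kd0 C0) th0.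
exists (4 * Kd * C), (Num.min ta tb); split.
- by rewrite mulr_ge0 // mulr_ge0.
- by rewrite lt_min ta0 tb0.
move=> D Y i0 i1 D0 i01 htau hT hY.
have grid0 i : 0 <= i%:R * D by rewrite mulr_ge0.
have gridT i : (i <= i1)%N -> i%:R * D <= T.
  by move=> ii; apply: le_trans hT; exact: grid_le.
have htau' i j : (i0 <= i)%N -> (j <= i1)%N ->
    ((j - i)%:R * D <= ta) && ((j - i)%:R * D <= tb).
  move=> i0i ji1; rewrite -le_min; apply: le_trans htau.
  by rewrite ler_wpM2r // ler_nat leq_sub.
have [m hm hmax] := window_max (fun i => 1 + N (Y i)) i0 (i1 - i0).
rewrite subnKC // in hm hmax.
have [A AE] : exists A, A = 1 + N (Y m) by eexists.
rewrite -AE in hmax; have A1 : 1 <= A by rewrite AE lerDl sn_ge0.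
have A0 : 0 <= A by apply: le_trans A1.
set b := C * A * D `^ th.
have b0 : 0 <= b by rewrite mulr_ge0 ?powR_ge0 // mulr_ge0.
have cb i : (i%:R `^ th) * b = C * A * (i%:R * D) `^ th.
  by rewrite powRM // /b; ring.
have step i j k : (i0 <= i)%N -> (i < k)%N -> (k < j)%N -> (j <= i1)%N ->
    N (Y j - mu (j%:R * D) (i%:R * D) (Y i)) <=
    N (Y j - mu (j%:R * D) (k%:R * D) (Y k))
    + (1 + (1 - lam) / 2) * N (Y k - mu (k%:R * D) (i%:R * D) (Y i))
    + b * (j - i)%:R `^ th.
  move=> i0i ik kj ji1.
  apply: (le_trans (sn_tri HN (mu (j%:R * D) (k%:R * D) (Y k)) _ _)).
  rewrite -addrA lerD2l.
  apply: (le_trans (sn_tri HN (mu (j%:R * D) (k%:R * D)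
     (mu (k%:R * D) (i%:R * D) (Y i))) _ _)).
  apply: lerD.
    apply: (le_trans (mu_lip HN Hmu _ _ (grid0 k) (grid_le D0 (ltnW kj)) (gridT j ji1))).
    rewrite ler_wpM2r ?(sn_ge0 HN) // lerD2l gridB ?(ltnW kj) //.
    apply: hta; first by rewrite mulr_ge0.
    by case/andP: (htau' k j (leq_trans i0i (ltnW ik)) ji1).
  apply: (le_trans (af_defect Hmu _ (grid0 i) (grid_le D0 (ltnW ik))
     (grid_le D0 (ltnW kj)) (gridT j ji1))).
  rewrite gridB ?(ltnW (ltn_trans ik kj)) //.
  rewrite mulrC [leRHS]mulrC cb mulrC ler_wpM2r ?powR_ge0 // ler_wpM2l //.
  by apply: hmax; rewrite i0i (leq_trans (ltnW (ltn_trans ik kj)) ji1).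
have wb i j : (i0 <= i)%N -> (i <= j)%N -> (j <= i1)%N ->
    N (Y j - mu (j%:R * D) (i%:R * D) (Y i)) <= Kd * C * A * ((j - i)%:R * D) `^ th.
  move=> i0i; rewrite leq_eqVlt => /orP[/eqP <- ii1|ij ji1].
    rewrite (sn_sym HN) (af_id Hmu) ?gridT //.
    by rewrite mulr_ge0 ?powR_ge0 // mulr_ge0 // mulr_ge0.
  have -> : Kd * C * A * ((j - i)%:R * D) `^ th = Kd * b * (j - i)%:R `^ th.
    by rewrite /b powRM //; ring.
  apply: (discrete_sewing (w := fun i j =>
    N (Y j - mu (j%:R * D) (i%:R * D) (Y i))) th1 b0 _ _ i0i ij ji1).
    by move=> k i0k ki1; rewrite hY // subrr (sn_0 HN).
  by move=> a k c h1 h2 h3 h4; apply: step.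
(* At the maximiser [m], the growth bound from [i0] plus the sewn error give A <= (1 + N(Y_i0)) +
   1/2 + A/2; the constant 4 is generous. *)
have Ab : A <= 4 * (1 + N (Y i0)).
  have h0 := sn_ge0 HN (Y i0).
  have [/andP[h1 h2]] := (conj hm I).
  have h := wb _ _ (leqnn i0) h1 h2.
  have [ha hb] := andP (htau' i0 m (leqnn _) h2).
  have hh : Kd * C * A * ((m - i0)%:R * D) `^ th <= 1 / 2 * A.
    rewrite mulrAC ler_wpM2r //; apply: htb => //.
  have h3 := sn_le_dist HN (Y m) (mu (m%:R * D) (i0%:R * D) (Y i0)).
  have h4 := af_growth Hmu (Y i0) (grid0 i0) (grid_le D0 h1) (gridT _ h2).
  rewrite gridB // in h4.
  have h5 := hta _ (grid0 _) ha.
  by clear -AE h hh h0 h3 h4 h5 lam0; lra.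
split; last by move=> j h1 h2; apply: le_trans Ab; apply: hmax; rewrite h1 h2.
move=> i j h1 h2 h3; apply: (le_trans (wb _ _ h1 h2 h3)).
rewrite ler_wpM2r ?powR_ge0 //.
have -> : 4 * Kd * C * (1 + N (Y i0)) = Kd * C * (4 * (1 + N (Y i0))) by ring.
by rewrite ler_wpM2l // mulr_ge0.
Qed.

(** The sewn quantity is the distance between the errors of [Y] and [Z]. The exponent [th'] may be
    smaller than [th], so that part of the power of the mesh can be stored in [eta]. Keeping [+ eta]
    on both sides of the conclusion makes it iterable from window to window. *)
Lemma stability_window (R : realType) (E : zmodType) (N : E -> R) (T g th C : R)
  (mu : R -> R -> E -> E) (HN : seminorm N) (Hmu : almost_flow N T g th C mu)
  (th' A K : R) : 1 < th' -> th' <= th -> 0 <= A -> 0 <= K ->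
  exists2 tau : R, 0 < tau &
  forall (D eta : R) (Y Z : nat -> E) (i0 i1 : nat), 0 <= D -> 0 <= eta ->
  (i0 <= i1)%N -> (i1 - i0)%:R * D <= tau -> i1%:R * D <= T ->
  (forall i, (i <= i1)%N -> N (Y i) <= A) -> (forall i, (i <= i1)%N -> N (Z i) <= A) ->
  (forall i j, (i <= j)%N -> (j <= i1)%N ->
     N (Y j - mu (j%:R * D) (i%:R * D) (Y i)) <= K * ((j - i)%:R * D) `^ th') ->
  (forall i j, (i <= j)%N -> (j <= i1)%N ->
     N (Z j - mu (j%:R * D) (i%:R * D) (Z i)) <= K * ((j - i)%:R * D) `^ th') ->
  (forall i, (i < i1)%N ->
     N ((Y i.+1 - mu (i.+1%:R * D) (i%:R * D) (Y i))
        - (Z i.+1 - mu (i.+1%:R * D) (i%:R * D) (Z i))) <= eta * D `^ th') ->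
  forall j, (i0 <= j)%N -> (j <= i1)%N ->
    N (Y j - Z j) + eta <= 5 * (N (Y i0 - Z i0) + eta).
Proof.
move=> th'1 th'th A0 K0.
have [T0 g0 th1 C0] : [/\ 0 < T, 0 < g, 1 < th & 0 <= C] by case: Hmu.
pose lam := (2 / 3 : R) `^ (th' - 1).
have lam1 : lam < 1 by exact: lam_lt1.
have lam0 : 0 <= lam by exact: powR_ge0.
set Kd := 2 / (1 - lam).
have Kd0 : 0 <= Kd by rewrite divr_ge0 // subr_ge0 ltW.
have e0 : 0 < (1 - lam) / 2 by clear -lam1; lra.
have th'0 : 0 < th' by clear -th'1; lra.
(* The first term comes from the quadratic part of [af_four], where the local errors of [Y] and [Z]
   add up to 2K; the second from [af_defect_lip], with exponent [th] lowered to [th']. *)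
pose M := C * (2 * K) + C * (1 + 2 * A) * T `^ (th - th').
have M0 : 0 <= M.
  rewrite addr_ge0 // mulr_ge0 ?powR_ge0 //; first by rewrite mulr_ge0.
  by rewrite mulr_ge0 // addr_ge0 // mulr_ge0.
have M10 : 0 <= Kd * (M + 1) by rewrite mulr_ge0 // addr_ge0.
have [ta ta0 hta] := powR_small e0 C0 g0.
have [tb tb0 htb] := @powR_small R (1 / 4) (Kd * (M + 1)) th' ltac:(lra) M10 th'0.
exists (Num.min ta tb); first by rewrite lt_min ta0 tb0.
move=> D eta Y Z i0 i1 D0 eta0 i01 htau hT YA ZA hY hZ hW.
have grid0 i : 0 <= i%:R * D by rewrite mulr_ge0.
have gridT i : (i <= i1)%N -> i%:R * D <= T.
  by move=> ii; apply: le_trans hT; exact: grid_le.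
have htau' i j : (i0 <= i)%N -> (j <= i1)%N ->
    ((j - i)%:R * D <= ta) && ((j - i)%:R * D <= tb).
  move=> i0i ji1; rewrite -le_min; apply: le_trans htau.
  by rewrite ler_wpM2r // ler_nat leq_sub.
have [m hm hmax] := window_max (fun i => N (Y i - Z i)) i0 (i1 - i0).
rewrite subnKC // in hm hmax.
have [U UE] : exists U, U = N (Y m - Z m) by eexists.
rewrite -UE in hmax; have U0 : 0 <= U by rewrite UE sn_ge0.
have [b bE] : exists b, b = (eta + M * U) * D `^ th' by eexists.
have b0 : 0 <= b by rewrite bE mulr_ge0 ?powR_ge0 // addr_ge0 // mulr_ge0.
pose w i j := N ((Y j - mu (j%:R * D) (i%:R * D) (Y i))
                  - (Z j - mu (j%:R * D) (i%:R * D) (Z i))).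
have step i k j : (i0 <= i)%N -> (i < k)%N -> (k < j)%N -> (j <= i1)%N ->
    w i j <= w k j + (1 + (1 - lam) / 2) * w i k + b * (j - i)%:R `^ th'.
  move=> i0i ik kj ji1.
  have ij := ltn_trans ik kj; have i0k := leq_trans i0i (ltnW ik).
  have ki1 := leq_trans (ltnW kj) ji1.
  rewrite /w.
  set tj := j%:R * D; set tk := k%:R * D; set ti := i%:R * D.
  (* Three second differences: the errors from k to j, the errors from i to k pushed through
     [mu tj tk], and the flow defects at [Y i] and [Z i]. *)
  have -> : (Y j - mu tj ti (Y i)) - (Z j - mu tj ti (Z i)) =
      ((Y j - mu tj tk (Y k)) - (Z j - mu tj tk (Z k)))
    + (((mu tj tk (Y k) - mu tj tk (mu tk ti (Y i)))
        - (mu tj tk (Z k) - mu tj tk (mu tk ti (Z i))))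
    + ((mu tj tk (mu tk ti (Y i)) - mu tj ti (Y i))
        - (mu tj tk (mu tk ti (Z i)) - mu tj ti (Z i)))).
    move: (Y j) (Z j) (mu tj tk (Y k)) (mu tj tk (Z k)) (mu tj tk (mu tk ti (Y i)))
     (mu tj tk (mu tk ti (Z i))) (mu tj ti (Y i)) (mu tj ti (Z i)) => y z a c e f h l.
    by rewrite (subACA y h) (subACA y a) (subACA a e) (subACA e h) addrA subrKA subrKA.
  apply: (le_trans (sn_add HN _ _)); rewrite -[leRHS]addrA lerD2l.
  apply: (le_trans (sn_add HN _ _)).
  have h1 := af_four Hmu (Y k) (mu tk ti (Y i)) (Z k) (mu tk ti (Z i))
    (grid0 k) (grid_le D0 (ltnW kj)) (gridT j ji1).
  have h2 := af_defect_lip Hmu (Y i) (Z i) (grid0 i) (grid_le D0 (ltnW ik))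
    (grid_le D0 (ltnW kj)) (gridT j ji1).
  rewrite -/ti -/tj -/tk in h1 h2.
  have [xa _] := andP (htau' k j i0k ji1).
  have {}xa := hta _ (grid0 _) xa; rewrite -(gridB _ (ltnW kj)) -/tk -/tj in xa.
  set W := N ((Y k - mu tk ti (Y i)) - (Z k - mu tk ti (Z i))) in h1 *.
  have h3 : (1 + C * (tj - tk) `^ g) * W <= (1 + (1 - lam) / 2) * W.
    by rewrite ler_wpM2r ?(sn_ge0 HN) // lerD2l.
  set x := ((j - i)%:R * D).
  have x0 : 0 <= x by exact: grid0.
  have h4 : ((k - i)%:R * D) `^ th' <= x `^ th'.
    by apply: ler_powRl => //; [exact: ltW|rewrite grid_le // leq_sub // ltnW].
  have h5 : C * (N (Y k - mu tk ti (Y i)) + N (Z k - mu tk ti (Z i))) * N (Y k - Z k)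
      <= C * (2 * K * x `^ th') * U.
    apply: ler_pM; rewrite ?(sn_ge0 HN) ?mulr_ge0 ?addr_ge0 ?(sn_ge0 HN) //.
      rewrite ler_wpM2l //.
      have ha := hY i k (ltnW ik) ki1; have hb := hZ i k (ltnW ik) ki1.
      have hc : K * ((k - i)%:R * D) `^ th' <= K * x `^ th' by rewrite ler_wpM2l.
      rewrite -/tk -/ti in ha hb.
      by clear -ha hb hc; lra.
    by apply: hmax; rewrite i0k ki1.
  have h6 : C * (1 + N (Y i) + N (Z i)) * N (Y i - Z i) * (tj - ti) `^ th
      <= C * (1 + 2 * A) * U * (T `^ (th - th') * x `^ th').
    have hx : tj - ti = x by rewrite /tj /ti gridB // ltnW.
    have xT : x <= T by rewrite -hx; have := gridT _ ji1; have := grid0 i;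
      rewrite -/tj -/ti; clear; lra.
    have ii1 := leq_trans (ltnW ij) ji1.
    apply: ler_pM; rewrite ?powR_ge0 ?mulr_ge0 ?addr_ge0 ?(sn_ge0 HN) //.
      apply: ler_pM; rewrite ?mulr_ge0 ?addr_ge0 ?(sn_ge0 HN) //.
        rewrite ler_wpM2l //; have := YA i ii1; have := ZA i ii1; clear; lra.
      by apply: hmax; rewrite i0i ii1.
    by rewrite hx; apply: ler_powRr.
  have h7 : b * (j - i)%:R `^ th' = (eta + M * U) * x `^ th'.
    by rewrite /x powRM // bE; ring.
  have h8 : 0 <= eta * x `^ th' by rewrite mulr_ge0 ?powR_ge0.
  rewrite h7 /M; move: h1 h2 h3 h5 h6 h8.
  set x1 := N _; set x2 := N _; clear => h1 h2 h3 h5 h6 h8.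
  apply: (le_trans (lerD h1 h2)).
  apply: (le_trans (lerD (lerD h3 h5) h6)).
  by rewrite -subr_ge0; apply: (le_trans h8); rewrite le_eqVlt; apply/orP; left;
    apply/eqP; ring.
have wb j : (i0 <= j)%N -> (j <= i1)%N -> N (Y j - Z j) <=
    (1 + (1 - lam) / 2) * N (Y i0 - Z i0) + 1 / 4 * (eta + U).
  rewrite leq_eqVlt => /orP[/eqP <- _|ij ji1].
    have := sn_ge0 HN (Y i0 - Z i0); move: (N _) => n n0.
    have : 0 <= (1 - lam) / 2 * n by rewrite mulr_ge0 // ltW.
    by clear -n0 U0 eta0; lra.
  have h1 : w i0 j <= Kd * b * (j - i0)%:R `^ th'.
    apply: (discrete_sewing (i1 := i1) (i0 := i0) (w := w)) => //.
    move=> i i0i ii1; apply: (le_trans (hW i ii1)).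
    by rewrite bE ler_wpM2r ?powR_ge0 // lerDl mulr_ge0.
  have [xa xb] := andP (htau' i0 j (leqnn _) ji1).
  have {}xa := hta _ (grid0 _) xa; have {}xb := htb _ (grid0 _) xb.
  have h2 : Kd * b * (j - i0)%:R `^ th' <= 1 / 4 * (eta + U).
    have -> : Kd * b * (j - i0)%:R `^ th' =
        (Kd * ((j - i0)%:R * D) `^ th') * (eta + M * U) by rewrite bE powRM //; ring.
    have eU : 0 <= eta + U by rewrite addr_ge0.
    have h3 : eta + M * U <= (M + 1) * (eta + U).
      have := mulr_ge0 M0 eta0; clear -U0; lra.
    apply: (le_trans (ler_wpM2l _ h3)); first by rewrite mulr_ge0 ?powR_ge0.
    by apply: (le_trans _ (ler_wpM2r eU xb)); rewrite le_eqVlt; apply/orP; left;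
      apply/eqP; ring.
  have h3 := mu_lip HN Hmu (Y i0) (Z i0) (grid0 i0) (grid_le D0 (ltnW ij)) (gridT _ ji1).
  rewrite gridB ?(ltnW ij) // in h3.
  have h4 : (1 + C * ((j - i0)%:R * D) `^ g) * N (Y i0 - Z i0) <=
      (1 + (1 - lam) / 2) * N (Y i0 - Z i0).
    by rewrite ler_wpM2r ?(sn_ge0 HN) // lerD2l.
  have h5 : N (Y j - Z j) <= w i0 j
      + N (mu (j%:R * D) (i0%:R * D) (Y i0) - mu (j%:R * D) (i0%:R * D) (Z i0)).
    rewrite /w; apply: le_trans (sn_add HN _ _).
    rewrite le_eqVlt; apply/orP; left; apply/eqP; congr N.
    by rewrite subACA subrK.
  apply: (le_trans h5); apply: (le_trans (lerD (le_trans h1 h2) (le_trans h3 h4))).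
  by rewrite addrC.
(* The estimate [wb] is used twice: at the maximiser it absorbs U/4 and bounds U by the data, and at
   [j] it gives the claim. *)
move=> j h1 h2.
have hj := wb j h1 h2.
have [/andP[g1 g2]] := (conj hm I).
have hm' := wb m g1 g2; rewrite -UE in hm'.
have n0 := sn_ge0 HN (Y i0 - Z i0).
have hl : (1 - lam) / 2 * N (Y i0 - Z i0) <= 1 / 2 * N (Y i0 - Z i0).
  by rewrite ler_wpM2r //; clear -lam0; lra.
by clear -hj hm' n0 hl eta0; lra.
Qed.

(** * Dyadic grids, Euler schemes, uniqueness and existence of the path of an almost flow *)

Section Dyadic.
Variable R : realType.

Lemma dyadic_small (tau L : R) : 0 < tau -> exists p, forall n, (p <= n)%N -> L / 2 ^+ n <= tau.
Proof.
move=> tau0; exists (Num.bound `|L / tau|) => n pn.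
have h := archi_boundP (normr_ge0 (L / tau)).
have h1 : L / tau <= 2 ^+ n.
  apply: (le_trans (ler_norm _)); apply: (le_trans (ltW h)).
  rewrite -natrX ler_nat; apply: (leq_trans pn); apply: ltnW.
  exact: ltn_expl.
by rewrite ler_pdivrMr ?exprn_gt0 // mulrC -ler_pdivrMr.
Qed.

Lemma dyadic_grid (L : R) n : (2 ^ n)%N%:R * (L / 2 ^+ n) = L.
Proof. by rewrite natrX mulrC divfK // expf_neq0. Qed.

Lemma dyadic_half (L : R) n i : (2 * i)%N%:R * (L / 2 ^+ n.+1) = i%:R * (L / 2 ^+ n).
Proof.
have h : 2 ^+ n != 0 :> R by rewrite expf_neq0.
by rewrite exprS natrM; field.
Qed.

Lemma dyadic_pow (L a : R) n : 0 <= L -> (L / 2 ^+ n) `^ a = L `^ a * ((1 / 2) `^ a) ^+ n.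
Proof.
move=> L0; have h : 0 <= 1 / 2 :> R by lra.
have -> : ((1 / 2) `^ a) ^+ n = ((1 / 2) ^+ n) `^ a :> R.
  by rewrite -powR_mulrn ?powR_ge0 // -powRrM (mulrC a) powRrM powR_mulrn.
by rewrite -powRM ?exprn_ge0 // mul1r exprVn.
Qed.

End Dyadic.

Fixpoint euler (R : realType) (E : zmodType) (mu : R -> R -> E -> E) (D : R) (Y0 : E)
    (i : nat) : E :=
  if i is k.+1 then mu (k.+1%:R * D) (k%:R * D) (euler mu D Y0 k) else Y0.

(** At level [n] the grid is cut into 2^p windows of 2^(n-p) steps; the resulting factor depends on
    [p] only, hence is uniform in the mesh. *)
Lemma dyadic_growth (R : realType) (u : nat -> R) (c : R) p n : (p <= n)%N ->
  (forall i, 0 <= u i) -> 1 <= c ->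
  (forall i j, (i <= j)%N -> (j <= i + 2 ^ (n - p))%N -> (j <= 2 ^ n)%N -> u j <= c * u i) ->
  forall i, (i <= 2 ^ n)%N -> u i <= c ^+ (2 ^ p) * u 0%N.
Proof.
move=> pn u0 c1 hu i hi.
apply: (window_growth (m := (2 ^ (n - p))%N) (n := (2 ^ n)%N) u0 c1 hu) => //.
by rewrite -expnD subnKC.
Qed.

Lemma dyadic_window (R : realType) (L tau : R) p n i j : 0 <= L -> (p <= n)%N ->
  L / 2 ^+ p <= tau -> (i <= j)%N -> (j <= i + 2 ^ (n - p))%N ->
  (j - i)%:R * (L / 2 ^+ n) <= tau.
Proof.
move=> L0 pn ht ij ji; apply: le_trans ht.
rewrite mulrA ler_pdivrMr ?exprn_gt0 //.
rewrite -[in leRHS](subnKC pn) exprD mulrA divfK ?expf_neq0 // mulrC ler_wpM2l //.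
by rewrite -natrX ler_nat leq_subLR.
Qed.

(** Short windows are covered by [euler_window] and the iterated size bound; over a distance larger
    than [tau] the error is bounded by sizes alone, and dividing by tau^th restores the power. *)
Lemma euler_global (R : realType) (E : zmodType) (N : E -> R) (T g th C : R)
  (mu : R -> R -> E -> E) (HN : seminorm N) (Hmu : almost_flow N T g th C mu) (Y0 : E) :
  exists p A K, [/\ 0 <= A, 0 <= K & forall n, (p <= n)%N ->
    let D := T / 2 ^+ n in let e := euler mu D Y0 in
    (forall i, (i <= 2 ^ n)%N -> N (e i) <= A) /\
    (forall i j, (i <= j)%N -> (j <= 2 ^ n)%N ->
       N (e j - mu (j%:R * D) (i%:R * D) (e i)) <= K * ((j - i)%:R * D) `^ th)].
Proof.
have [T0 g0 th1 C0] : [/\ 0 < T, 0 < g, 1 < th & 0 <= C] by case: Hmu.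
have [K [tau [K0 tau0 hK]]] := euler_window HN Hmu.
have [p hp] := dyadic_small T tau0.
pose A := 4 ^+ (2 ^ p) * (1 + N Y0).
have A0 : 0 <= A by rewrite mulr_ge0 ?exprn_ge0 // addr_ge0 // sn_ge0.
have B0 : 0 <= 2 * A + C * T `^ g.
  by rewrite addr_ge0 // mulr_ge0 ?powR_ge0.
exists p, A, (K * (1 + A) + (2 * A + C * T `^ g) / tau `^ th); split => //.
  rewrite addr_ge0 // ?divr_ge0 ?powR_ge0 //.
  by rewrite mulr_ge0 // addr_ge0.
move=> n pn D e.
have D0 : 0 <= D by rewrite divr_ge0 ?exprn_ge0 // ltW.
have TD i : (i <= 2 ^ n)%N -> i%:R * D <= T.
  by move=> hi; rewrite -[leRHS](dyadic_grid T n) grid_le.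
have hA i : (i <= 2 ^ n)%N -> N (e i) <= A.
  move=> hi; have : 1 + N (e i) <= A.
    apply: (@dyadic_growth R (fun i => 1 + N (e i)) 4 p n pn) => //.
    - by move=> k; rewrite addr_ge0 // sn_ge0.
    - by rewrite ler1n.
    - move=> a b ab ba bn.
      have [_] := hK D e a b D0 ab (dyadic_window (ltW T0) pn (hp _ (leqnn p)) ab ba) (TD _ bn)
        (fun i _ _ => erefl).
      by apply.
  by apply: le_trans; rewrite lerDr.
split=> // i j ij jn.
have x0 : 0 <= (j - i)%:R * D by rewrite mulr_ge0.
have i0 : 0 <= i%:R * D by rewrite mulr_ge0.
have iA := hA i (leq_trans ij jn).
have [xt|xt] := lerP ((j - i)%:R * D) tau.
  have [h _] := hK D e i j D0 ij xt (TD _ jn) (fun i _ _ => erefl).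
  apply: (le_trans (h i j (leqnn i) ij (leqnn j))).
  rewrite ler_wpM2r ?powR_ge0 //.
  apply: (@le_trans _ _ (K * (1 + A))); first by rewrite ler_wpM2l // lerD2l.
  by rewrite lerDl divr_ge0 ?powR_ge0.
have h1 := af_growth Hmu (e i) i0 (grid_le D0 ij) (TD _ jn).
have h2 := sn_sub HN (e j) (mu (j%:R * D) (i%:R * D) (e i)).
have jA := hA j jn.
have h3 : C * (j%:R * D - i%:R * D) `^ g <= C * T `^ g.
  rewrite ler_wpM2l // ler_powRl ?(ltW g0) // ?subr_ge0 ?grid_le //.
  by have := TD _ jn; clear -i0; lra.
have h4 : 2 * A + C * T `^ g <= (2 * A + C * T `^ g) / tau `^ th * ((j - i)%:R * D) `^ th.
  rewrite mulrAC ler_pdivlMr ?powR_gt0 // ler_wpM2l // ler_powRl ?(ltW tau0) ?(ltW xt) //.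
  by clear -th1; lra.
have h5 : 0 <= K * (1 + A) * ((j - i)%:R * D) `^ th.
  by rewrite mulr_ge0 ?powR_ge0 // mulr_ge0 // addr_ge0.
apply: (le_trans h2); rewrite mulrDl.
apply: le_trans (lerD h5 h4); rewrite add0r.
by clear -h1 h2 h3 jA iA; lra.
Qed.

(** The terminal time [L] is free because uniqueness at a time t is read on the dyadic subdivision
    of [0,t], which has t as a grid point. *)
Lemma stability_global (R : realType) (E : zmodType) (N : E -> R) (T g th C : R)
  (mu : R -> R -> E -> E) (HN : seminorm N) (Hmu : almost_flow N T g th C mu)
  (th' A K : R) : 1 < th' -> th' <= th -> 0 <= A -> 0 <= K ->
  exists p c, 0 <= c /\ forall n (L eta : R) (Y Z : nat -> E), (p <= n)%N ->
  0 <= L -> L <= T -> 0 <= eta ->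
  let D := L / 2 ^+ n in
  (forall i, (i <= 2 ^ n)%N -> N (Y i) <= A) -> (forall i, (i <= 2 ^ n)%N -> N (Z i) <= A) ->
  (forall i j, (i <= j)%N -> (j <= 2 ^ n)%N ->
     N (Y j - mu (j%:R * D) (i%:R * D) (Y i)) <= K * ((j - i)%:R * D) `^ th') ->
  (forall i j, (i <= j)%N -> (j <= 2 ^ n)%N ->
     N (Z j - mu (j%:R * D) (i%:R * D) (Z i)) <= K * ((j - i)%:R * D) `^ th') ->
  (forall i, (i < 2 ^ n)%N ->
     N ((Y i.+1 - mu (i.+1%:R * D) (i%:R * D) (Y i))
        - (Z i.+1 - mu (i.+1%:R * D) (i%:R * D) (Z i))) <= eta * D `^ th') ->
  forall j, (j <= 2 ^ n)%N -> N (Y j - Z j) <= c * (N (Y 0%N - Z 0%N) + eta).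
Proof.
move=> th'1 th'th A0 K0.
have [tau tau0 hst] := stability_window HN Hmu th'1 th'th A0 K0.
have [p hp] := dyadic_small T tau0.
exists p, (5 ^+ (2 ^ p)); split; first exact: exprn_ge0.
move=> n L eta Y Z pn L0 LT eta0 D YA ZA hY hZ hW j jn.
have D0 : 0 <= D by rewrite divr_ge0 ?exprn_ge0.
have LD i : (i <= 2 ^ n)%N -> i%:R * D <= T.
  by move=> hi; apply: le_trans LT; rewrite -[leRHS](dyadic_grid L n) grid_le.
have : N (Y j - Z j) + eta <= 5 ^+ (2 ^ p) * (N (Y 0%N - Z 0%N) + eta).
  apply: (@dyadic_growth R (fun i => N (Y i - Z i) + eta) 5 p n pn) => //.
  - by move=> k; rewrite addr_ge0 // sn_ge0.
  - by rewrite ler1n.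
  - move=> a b ab ba bn.
    apply: (hst D eta Y Z a b) => //.
    + apply: dyadic_window ab ba => //; apply: le_trans (hp _ (leqnn p)).
      by rewrite ler_wpM2r // invr_ge0 exprn_ge0.
    + exact: LD.
    + by move=> i ib; apply: YA; apply: leq_trans bn.
    + by move=> i ib; apply: ZA; apply: leq_trans bn.
    + by move=> i k ik kb; apply: hY => //; apply: leq_trans bn.
    + by move=> i k ik kb; apply: hZ => //; apply: leq_trans bn.
    + by move=> i ib; apply: hW; apply: leq_trans bn.
by apply: le_trans; rewrite lerDl.
Qed.

(** Two paths with errors O(h^a) differ over one step of the mesh by 2K D^a = (2K D^(a-b)) D^b with
    1 < b < a. Stability at exponent b with eta = 2K D^(a-b) bounds the distance at time t, and D
    tends to 0. *)
Lemma almost_flow_unique (R : realType) (E : zmodType) (N : E -> R) (T g th C : R)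
  (mu : R -> R -> E -> E) (HN : seminorm N) (Hmu : almost_flow N T g th C mu)
  (a K : R) (Y Z : R -> E) : 1 < a -> a <= th ->
  (forall t s, 0 <= s -> s <= t -> t <= T -> N (Y t - mu t s (Y s)) <= K * (t - s) `^ a) ->
  (forall t s, 0 <= s -> s <= t -> t <= T -> N (Z t - mu t s (Z s)) <= K * (t - s) `^ a) ->
  N (Y 0 - Z 0) = 0 ->
  forall t, 0 <= t -> t <= T -> N (Y t - Z t) = 0.
Proof.
move=> a1 ath hY hZ YZ0 t t0 tT.
have [T0 g0 th1 C0] : [/\ 0 < T, 0 < g, 1 < th & 0 <= C] by case: Hmu.
(* A priori bound: [stability_global] needs a common size for both paths, obtained from a single
   step from 0. *)
have aux (X : R -> E) :
    (forall t s, 0 <= s -> s <= t -> t <= T -> N (X t - mu t s (X s)) <= K * (t - s) `^ a) ->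
    forall t, 0 <= t -> t <= T -> N (X t) <= N (X 0) + C * T `^ g + K * T `^ a.
  move=> hX s s0 sT.
  (* The sign of [K] is read off the hypothesis itself at the pair (T, 0). *)
  have K0 : 0 <= K.
    have := le_trans (sn_ge0 HN _) (hX T 0 (lexx 0) (ltW T0) (lexx T)).
    by rewrite subr0 pmulr_lge0 // powR_gt0.
  have h1 := hX s 0 (lexx 0) s0 sT.
  have h2 := af_growth Hmu (X 0) (lexx 0) s0 sT.
  have h3 := sn_le_dist HN (X s) (mu s 0 (X 0)).
  rewrite subr0 in h1 h2.
  have h4 : C * s `^ g <= C * T `^ g by rewrite ler_wpM2l // ler_powRl // ltW.
  have h5 : K * s `^ a <= K * T `^ a.
    by rewrite ler_wpM2l // ler_powRl //; clear -a1; lra.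
  by clear -h1 h2 h3 h4 h5; lra.
pose b := (1 + a) / 2.
have b1 : 1 < b by rewrite /b; clear -a1; lra.
have ba : b < a by rewrite /b; clear -a1; lra.
have K0 : 0 <= K.
  have := le_trans (sn_ge0 HN _) (hY T 0 (lexx 0) (ltW T0) (lexx T)).
  by rewrite subr0 pmulr_lge0 // powR_gt0.
have Ta0 := powR_ge0 T (a - b).
pose A := (N (Y 0) + C * T `^ g + K * T `^ a) + (N (Z 0) + C * T `^ g + K * T `^ a).
have A1 : 0 <= N (Y 0) + C * T `^ g + K * T `^ a.
  by rewrite !addr_ge0 ?(sn_ge0 HN) // mulr_ge0 ?powR_ge0.
have A2 : 0 <= N (Z 0) + C * T `^ g + K * T `^ a.
  by rewrite !addr_ge0 ?(sn_ge0 HN) // mulr_ge0 ?powR_ge0.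
have [p [c [c0 hst]]] := stability_global HN Hmu b1 (le_trans (ltW ba) ath)
  (addr_ge0 A1 A2) (mulr_ge0 K0 Ta0).
apply/eqP; rewrite eq_le (sn_ge0 HN) andbT; apply/ler_addgt0Pr => e e0; rewrite add0r.
have ab0 : 0 < a - b by rewrite subr_gt0.
have [dl dl0 hdl] := powR_small e0 (mulr_ge0 c0 (mulr_ge0 (ler0n R 2) K0)) ab0.
have [q hq] := dyadic_small t dl0.
pose n := maxn p q; pose D := t / 2 ^+ n.
have D0 : 0 <= D by rewrite divr_ge0 ?exprn_ge0.
have Dn : (2 ^ n)%N%:R * D = t by exact: dyadic_grid.
have De : c * (2 * K * D `^ (a - b)) <= e.
  by rewrite mulrA; apply: hdl => //; apply: hq; exact: leq_maxr.
have grid0 i : 0 <= i%:R * D by rewrite mulr_ge0.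
have gridT i : (i <= 2 ^ n)%N -> i%:R * D <= T.
  by move=> hi; apply: le_trans tT; rewrite -Dn grid_le.
have step (X : R -> E) :
    (forall t s, 0 <= s -> s <= t -> t <= T -> N (X t - mu t s (X s)) <= K * (t - s) `^ a) ->
    forall i j : nat, (i <= j)%N -> (j <= 2 ^ n)%N ->
    N (X (j%:R * D) - mu (j%:R * D) (i%:R * D) (X (i%:R * D)))
      <= K * T `^ (a - b) * ((j - i)%:R * D) `^ b.
  move=> hX i j ij jn.
  apply: (le_trans (hX _ _ (grid0 i) (grid_le D0 ij) (gridT j jn))).
  rewrite gridB // -mulrA ler_wpM2l //.
  apply: ler_powRr => //; [|by clear -b1; lra|exact: ltW].
  rewrite -(gridB D ij); have := gridT j jn; have := grid0 i; clear; lra.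
have := hst n t (2 * K * D `^ (a - b)) (fun i => Y (i%:R * D)) (fun i => Z (i%:R * D))
  (leq_maxl _ _) t0 tT.
rewrite /= -/D mul0r YZ0 add0r => /(_ _ _ _ _ _ _ (2 ^ n)%N (leqnn _)).
rewrite Dn => h; apply: le_trans De; apply: h.
- by rewrite mulr_ge0 ?powR_ge0 // mulr_ge0.
- move=> i hi; apply: (le_trans (aux Y hY _ (grid0 i) (gridT i hi))).
  by rewrite lerDl.
- move=> i hi; apply: (le_trans (aux Z hZ _ (grid0 i) (gridT i hi))).
  by rewrite lerDr.
- exact: step.
- exact: step.
- move=> i hi; apply: (le_trans (sn_sub HN _ _)).
  have h1 := hY _ _ (grid0 i) (grid_le D0 (leqnSn i)) (gridT _ hi).
  have h2 := hZ _ _ (grid0 i) (grid_le D0 (leqnSn i)) (gridT _ hi).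
  have -> : 2 * K * D `^ (a - b) * D `^ b = K * D `^ a + K * D `^ a.
    rewrite -mulrA -powRD; last by rewrite subrK gt_eqF //; clear -a1; lra.
    by rewrite subrK; ring.
  rewrite gridB // subSnn mul1r in h1 h2.
  exact: lerD.
Qed.

(** The scheme at level n+1, read at every second point, makes the steps of level n up to one flow
    defect per step. By stability two consecutive levels differ by O(D^a), which is geometric in
    n. *)
Lemma almost_flow_exists (R : realType) (E : zmodType) (N : E -> R) (T g th C : R)
  (mu : R -> R -> E -> E) (HN : seminorm N) (Hmu : almost_flow N T g th C mu)
  (cplt : geometrically_complete N) (Y0 : E) :
  exists (Y : R -> E) (M : R), [/\ 0 <= M, N (Y 0 - Y0) = 0 &
    forall t s, 0 <= s -> s <= t -> t <= T -> N (Y t - mu t s (Y s)) <= M * (t - s) `^ th].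
Proof.
have [T0 g0 th1 C0] : [/\ 0 < T, 0 < g, 1 < th & 0 <= C] by case: Hmu.
have [p1 [A [K [A0 K0 hE]]]] := euler_global HN Hmu Y0.
have [Kc Kc0 cplt'] := cplt.
(* [th] is shared out as a + b with b > 1: stability runs at exponent b and D^a is the rate of
   convergence. *)
pose b := (1 + th) / 2; pose a := th - b.
have b1 : 1 < b by rewrite /b; clear -th1; lra.
have a0 : 0 < a by rewrite /a /b; clear -th1; lra.
have bth : b <= th by rewrite /b; clear -th1; lra.
have Ta0 : 0 <= T `^ a := powR_ge0 T a.
have Tb0 : 0 <= T `^ b := powR_ge0 T b.
have [p2 [c [c0 hst]]] := stability_global HN Hmu b1 bth A0 (mulr_ge0 K0 Ta0).
pose n0 := maxn p1 p2; pose D n := T / 2 ^+ n.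
have D0 n : 0 < D n by rewrite divr_gt0 ?exprn_gt0.
have Dn n : (2 ^ n)%N%:R * D n = T by exact: dyadic_grid.
pose e n := euler mu (D n) Y0.
have eA n i : (n0 <= n)%N -> (i <= 2 ^ n)%N -> N (e n i) <= A.
  by move=> hn hi; have [h _] := hE n (leq_trans (leq_maxl _ _) hn); apply: h.
have eK n i j : (n0 <= n)%N -> (i <= j)%N -> (j <= 2 ^ n)%N ->
    N (e n j - mu (j%:R * D n) (i%:R * D n) (e n i)) <= K * ((j - i)%:R * D n) `^ th.
  by move=> hn ij hj; have [_ h] := hE n (leq_trans (leq_maxl _ _) hn); apply: h.
have grid0 n i : 0 <= i%:R * D n by rewrite mulr_ge0 // ltW.
have gridT n i : (i <= 2 ^ n)%N -> i%:R * D n <= T.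
  by move=> hi; rewrite -[leRHS](Dn n) grid_le // ltW.
have DT n : D n <= T by rewrite -[D n]mul1r (gridT n 1%N) // expn_gt0.
pose B := C * (1 + A).
have B0 : 0 <= B by rewrite mulr_ge0 // addr_ge0.
have defB t u s X : 0 <= s -> s <= u -> u <= t -> t <= T -> N X <= A ->
    N (mu t u (mu u s X) - mu t s X) <= B * (t - s) `^ th.
  move=> s0 su ut tT XA; apply: (le_trans (af_defect Hmu X s0 su ut tT)).
  by rewrite ler_wpM2r ?powR_ge0 // ler_wpM2l // lerD2l.
have Dth n : D n `^ th = D n `^ a * D n `^ b.
  by rewrite -powRD /a ?subrK //; apply/implyP => _; rewrite gt_eqF.
have D2 n i : (2 * i)%N%:R * D n.+1 = i%:R * D n by exact: dyadic_half.
have cauchy n i : (n0 <= n)%N -> (i <= 2 ^ n)%N ->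
    N (e n.+1 (2 * i)%N - e n i) <= c * (B * D n `^ a).
  move=> hn.
  have i2 j : (j <= 2 ^ n)%N -> (2 * j <= 2 ^ n.+1)%N by rewrite expnS leq_mul2l.
  have Bn : 0 <= B * D n `^ a by rewrite mulr_ge0 ?powR_ge0.
  have pw m : (m <= 2 ^ n)%N -> K * (m%:R * D n) `^ th <= K * T `^ a * (m%:R * D n) `^ b.
    move=> hm; rewrite -mulrA ler_wpM2l //; apply: ler_powRr => //; first exact: gridT.
    by clear -b1; lra.
  have := hst n T (B * D n `^ a) (fun i => e n.+1 (2 * i)%N) (e n)
    (leq_trans (leq_maxr _ _) hn) (ltW T0) (lexx T) Bn.
  rewrite -/(D n) /= muln0 subrr (sn_0 HN) add0r; apply.
  - by move=> j hj; apply: eA; [exact: leqW|exact: i2].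
  - by move=> j hj; apply: eA.
  - move=> k j kj hj; have := eK n.+1 _ _ (leqW hn) (leq_mul (leqnn 2) kj) (i2 _ hj).
    rewrite !D2 -mulnBr D2 => h; apply: (le_trans h); apply: pw.
    exact: leq_trans (leq_subr _ _) hj.
  - move=> k j kj hj; apply: (le_trans (eK n _ _ hn kj hj)); apply: pw.
    exact: leq_trans (leq_subr _ _) hj.
  - move=> k hk; have -> : e n k.+1 = mu (k.+1%:R * D n) (k%:R * D n) (e n k) by [].
    (* The coarse scheme has no one-step error, so only the error of the fine one remains: two half
       steps against a full step. *)
    rewrite subrr subr0.
    have -> : (2 * k.+1)%N = (2 * k).+2 by rewrite mulnS.
    have E1 : (2 * k).+2%:R * D n.+1 = k.+1%:R * D n by rewrite -(D2 n k.+1) mulnS.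
    have -> : e n.+1 (2 * k).+2 = mu (k.+1%:R * D n) ((2 * k).+1%:R * D n.+1)
        (mu ((2 * k).+1%:R * D n.+1) (k%:R * D n) (e n.+1 (2 * k)%N)).
      by rewrite -E1 -(D2 n k).
    apply: (le_trans (defB _ _ _ _ _ _ _ _ _)) => //.
    + by rewrite -(D2 n k) grid_le // ltW.
    + by rewrite -E1 grid_le // ltW.
    + exact: gridT.
    + by apply: eA; [exact: leqW|exact/i2/ltnW].
    + by rewrite gridB // subSnn mul1r Dth mulrA.
(* Index of the last grid point not after t. *)
pose ix n t := Num.truncn (t / D n).
have ix_le n t : 0 <= t -> (ix n t)%:R * D n <= t.
  move=> t0; rewrite -ler_pdivlMr // -truncn_ge_nat // divr_ge0 // ltW //.
have ix_gt n t : t < (ix n t)%:R * D n + D n.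
  by rewrite -[X in _ + X]mul1r -mulrDl natr1 -ltr_pdivrMr // truncnS_gt.
have ix_T n t : 0 <= t -> t <= T -> (ix n t <= 2 ^ n)%N.
  move=> t0 tT; rewrite -(ler_nat R) -(ler_pM2r (D0 n)) Dn.
  exact: le_trans (ix_le n t t0) tT.
(* Off the grid the scheme is continued by one application of [mu] from the last grid point, so that
   its error is again a defect. *)
pose Yn n t := mu t ((ix n t)%:R * D n) (e n (ix n t)).
pose Lc := 1 + C * T `^ g.
have Lc0 : 0 <= Lc by rewrite addr_ge0 // mulr_ge0 ?powR_ge0.
pose G := Lc * K * T `^ b + B * T `^ b + Lc * c * B.
have G0 : 0 <= G.
  exact: (addr_ge0 (addr_ge0 (mulr_ge0 (mulr_ge0 Lc0 K0) Tb0) (mulr_ge0 B0 Tb0))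
    (mulr_ge0 (mulr_ge0 Lc0 c0) B0)).
have Yn_step n t : (n0 <= n)%N -> 0 <= t -> t <= T -> N (Yn n.+1 t - Yn n t) <= G * D n `^ a.
  move=> hn t0 tT.
  pose i := ix n t; pose i' := ix n.+1 t; pose ti := i%:R * D n; pose t' := i'%:R * D n.+1.
  have tit : ti <= t by exact: ix_le.
  have t't : t' <= t by exact: ix_le.
  have i2i' : (2 * i <= i')%N.
    rewrite truncn_ge_nat; last by rewrite divr_ge0 // ltW.
    by rewrite ler_pdivlMr // D2.
  have tit' : ti <= t' by rewrite /ti -(D2 n i) grid_le // ltW.
  have i'T : (i' <= 2 ^ n.+1)%N by exact: ix_T.
  have t'ti : t' - ti <= D n by have := ix_gt n t; rewrite -/i -/ti; clear -t't; lra.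
  have tti : t - ti <= D n by have := ix_gt n t; rewrite -/i -/ti; clear; lra.
  have ti0 : 0 <= ti by exact: grid0.
  have t'0 : 0 <= t' by exact: grid0.
  have th0 : 0 <= th by clear -th1; lra.
  have DTb : D n `^ th <= T `^ b * D n `^ a.
    by rewrite Dth mulrC ler_wpM2r ?powR_ge0 // ler_powRl ?DT ?(ltW (D0 n)) //; clear -b1; lra.
  pose X := e n.+1 (2 * i)%N.
  have XA : N X <= A by apply: eA; [exact: leqW|exact: leq_trans i2i' i'T].
  have h1 : N (Yn n.+1 t - mu t t' (mu t' ti X)) <= Lc * K * (T `^ b * D n `^ a).
    apply: (le_trans (mu_lipT HN Hmu _ _ t'0 t't tT)); rewrite -mulrA ler_wpM2l //.
    have := eK n.+1 _ _ (leqW hn) i2i' i'T; rewrite D2 -/t' -/ti -/X => h.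
    apply: (le_trans h); rewrite ler_wpM2l //; apply: le_trans DTb.
    rewrite -gridB // D2 -/t' -/ti; apply: ler_powRl => //.
    by rewrite subr_ge0.
  have h2 : N (mu t t' (mu t' ti X) - mu t ti X) <= B * (T `^ b * D n `^ a).
    apply: (le_trans (defB _ _ _ _ ti0 tit' t't tT XA)); rewrite ler_wpM2l //.
    by apply: le_trans DTb; apply: ler_powRl => //; rewrite subr_ge0.
  have h3 : N (mu t ti X - Yn n t) <= Lc * (c * (B * D n `^ a)).
    apply: (le_trans (mu_lipT HN Hmu _ _ ti0 tit tT)); rewrite ler_wpM2l //.
    by apply: cauchy => //; exact: ix_T.
  apply: (le_trans (sn_tri HN (mu t t' (mu t' ti X)) _ _)).
  apply: (le_trans (lerD h1 (sn_tri HN (mu t ti X) _ _))).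
  apply: (le_trans (lerD (lexx _) (lerD h2 h3))).
  by rewrite le_eqVlt /G; apply/orP; left; apply/eqP; ring.
have q0 : 0 <= (1 / 2) `^ a :> R by exact: powR_ge0.
have q1 : (1 / 2) `^ a < 1 :> R.
  rewrite -[ltRHS](_ : 1 `^ a = 1); last by rewrite powR1.
  by rewrite gt0_ltr_powR ?nnegrE //; lra.
pose q := (1 / 2 : R) `^ a.
(* The time constraints stand under the existential so that [choice] yields a function of every real
   time; outside [0,T] the value is 0. *)
have [G2 G20 lim] : exists2 G2, 0 <= G2 & forall t, exists l, 0 <= t -> t <= T -> forall k,
    N (Yn (n0 + k)%N t - l) <= G2 * D (n0 + k)%N `^ a.
  exists (Kc * (G / (1 - q))); first by rewrite mulr_ge0 // divr_ge0 // subr_ge0 ltW.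
  move=> t; have [/andP[t0 tT]|] := boolP (0 <= t <= T); last first.
    by move=> /negP h; exists 0 => t0 tT; case: h; rewrite t0 tT.
  have hD k : D (n0 + k)%N `^ a = D n0 `^ a * q ^+ k.
    by rewrite {1}/D exprD invfM mulrA -/(D n0) (dyadic_pow _ _ (ltW (D0 n0))).
  have [|l hl] := cplt' (fun k => Yn (n0 + k)%N t) (G * D n0 `^ a) q q0 q1.
    by move=> k; rewrite addnS -mulrA -hD; apply: Yn_step => //; exact: leq_addr.
  by exists l => _ _ k; rewrite hD (le_trans (hl k)) // le_eqVlt; apply/orP; left;
    apply/eqP; ring.
have [Y hY] := choice lim.
have small (x d : R) : 0 < x -> 0 < d -> exists k, (1 + Lc) * G2 * D (n0 + k)%N `^ a <= x
    /\ D (n0 + k)%N <= d.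
  move=> x0 d0.
  have LG : 0 <= (1 + Lc) * G2 by rewrite mulr_ge0 // addr_ge0.
  have [dl dl0 hdl] := powR_small x0 LG a0.
  have [k hk] := dyadic_small T dl0; have [k' hk'] := dyadic_small T d0.
  exists (k + k')%N; split.
    apply: hdl; first exact: ltW.
    by apply: hk; rewrite addnCA leq_addr.
  by apply: hk'; rewrite addnA leq_addl.
exists Y, ((Lc * K + 2 * B) * 2 `^ th); split.
- rewrite mulr_ge0 ?powR_ge0 // addr_ge0 // mulr_ge0 //.
- apply/eqP; rewrite eq_le (sn_ge0 HN) andbT; apply/ler_addgt0Pr => x x0; rewrite add0r.
  have [k [hk _]] := small x 1 x0 ltr01.
  apply: (le_trans (sn_tri HN (Yn (n0 + k)%N 0) _ _)).
  have -> : N (Yn (n0 + k)%N 0 - Y0) = 0.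
    have i0 : ix (n0 + k)%N 0 = 0%N by rewrite /ix mul0r truncn0.
    by rewrite /Yn i0 mul0r /= (af_id Hmu) // ltW.
  rewrite addr0 (sn_sym HN); apply: (le_trans (hY 0 (lexx 0) (ltW T0) k)).
  apply: le_trans hk; rewrite -mulrA mulrDl mul1r lerDl mulr_ge0 // mulr_ge0 ?powR_ge0 //.
move=> t s s0; rewrite le_eqVlt => /orP[/eqP <- sT|st tT].
  rewrite (sn_sym HN) (af_id Hmu) // mulr_ge0 ?powR_ge0 // mulr_ge0 ?powR_ge0 //.
  by rewrite addr_ge0 // mulr_ge0.
apply/ler_addgt0Pr => x x0.
have ts0 : 0 < t - s by rewrite subr_gt0.
(* The mesh is taken finer than t - s: then the grid point [si] below s satisfies t - si <= 2 (t -
   s), whence the factor 2^th. *)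
have [k [hk hd]] := small x (t - s) x0 ts0.
have t0 := le_trans s0 (ltW st); have sT := le_trans (ltW st) tT.
set n := (n0 + k)%N in hk hd.
have hn : (n0 <= n)%N by exact: leq_addr.
pose i := ix n s; pose j := ix n t; pose si := i%:R * D n; pose tj := j%:R * D n.
have sis : si <= s by exact: ix_le.
have tjt : tj <= t by exact: ix_le.
have ij : (i <= j)%N.
  rewrite truncn_ge_nat; last by rewrite divr_ge0 // ltW.
  by rewrite ler_pdivlMr // -/si (le_trans sis) // ltW.
have sitj : si <= tj by rewrite grid_le // ltW.
have si0 : 0 <= si by exact: grid0.
have tj0 : 0 <= tj by exact: grid0.
have jT : (j <= 2 ^ n)%N by exact: ix_T.
have iA : N (e n i) <= A by apply: eA => //; exact: leq_trans ij jT.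
have tsi : t - si <= 2 * (t - s).
  by have := ix_gt n s; rewrite -/i -/si; clear -hd; lra.
have th0 : 0 <= th by clear -th1; lra.
have W : (t - si) `^ th <= 2 `^ th * (t - s) `^ th.
  rewrite -powRM //; last exact: ltW.
  by apply: ler_powRl => //; rewrite subr_ge0 (le_trans sis) // ltW.
have h1 : N (Yn n t - mu t tj (mu tj si (e n i))) <= Lc * K * (t - si) `^ th.
  apply: (le_trans (mu_lipT HN Hmu _ _ tj0 tjt tT)); rewrite -mulrA ler_wpM2l //.
  apply: (le_trans (eK n i j hn ij jT)); rewrite ler_wpM2l // -gridB // -/tj -/si.
  by apply: ler_powRl; rewrite ?lerD2r // subr_ge0.
have h2 := defB t tj si (e n i) si0 sitj tjt tT iA.
have h3 := defB t s si (e n i) si0 sis (ltW st) tT iA.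
have h4 := mu_lipT HN Hmu (Yn n s) (Y s) s0 (ltW st) tT.
have h5 := hY t t0 tT k; have h6 := hY s s0 sT k.
rewrite -/n (sn_sym HN) in h5; rewrite -/n in h6.
rewrite (sn_sym HN) in h3.
have h7 : Lc * N (Yn n s - Y s) <= Lc * (G2 * D n `^ a) by rewrite ler_wpM2l.
(* The chain passes through [Yn n t], the jump from si to tj to t, the jump from si to t, and the
   jump from s to t applied to [Yn n s]; its ends tend to 0 with the mesh and its middle gives the
   constant. *)
apply: (le_trans (sn_tri HN (Yn n t) _ _)).
apply: (le_trans (lerD h5 (sn_tri HN (mu t tj (mu tj si (e n i))) _ _))).
apply: (le_trans (lerD (lexx _) (lerD h1 (sn_tri HN (mu t si (e n i)) _ _)))).
apply: (le_trans (lerD (lexx _) (lerD (lexx _) (lerD h2 (sn_tri HN (mu t s (Yn n s)) _ _))))).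
apply: (le_trans (lerD (lexx _) (lerD (lexx _) (lerD (lexx _) (lerD h3 (le_trans h4 h7)))))).
have -> : (Lc * K + 2 * B) * 2 `^ th * (t - s) `^ th + x =
    x + (Lc * K + 2 * B) * (2 `^ th * (t - s) `^ th) by ring.
have W' : (Lc * K + 2 * B) * (t - si) `^ th <= (Lc * K + 2 * B) * (2 `^ th * (t - s) `^ th).
  by rewrite ler_wpM2l // addr_ge0 // mulr_ge0.
apply: le_trans (lerD hk W').
by rewrite le_eqVlt; apply/orP; left; apply/eqP; ring.
Qed.

(** * Regularity of sigma *)

Section MeanValue.
Variable R : realType.

(** Turns a quadratic Taylor bound back into a derivative, so that the mean value theorem can be
    used along arbitrary lines although only coordinate derivatives are given. *)
Lemma quad_is_derive (g : R -> R) (t D M : R) :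
  (forall h, `|g (t + h) - g t - D * h| <= M * h ^+ 2) -> is_derive t 1 g D.
Proof.
move=> H.
have M0 : 0 <= M.
  by have := le_trans (normr_ge0 _) (H 1); rewrite expr1n mulr1.
have cv : (fun h => h^-1 *: ((g \o shift t) (h *: 1) - g t)) @ 0^' --> D.
  apply/cvgrPdist_le => e e0.
  have M1 : 0 < M + 1 by rewrite ltr_wpDl.
  have eM : 0 < e / (M + 1) by exact: divr_gt0.
  near=> h.
  have h0 : h != 0 by near: h; exact: nbhs_dnbhs_neq.
  rewrite /= /shift /= [h *: 1]mulr1 [h + t]addrC.
  have -> : D - h^-1 *: (g (t + h) - g t) = - (h^-1 * (g (t + h) - g t - D * h)).
    by rewrite [h^-1 *: _]/(h^-1 * _) mulrBr (mulrC D) mulKf // opprB.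
  rewrite normrN normrM normfV mulrC ler_pdivrMr ?normr_gt0 //.
  apply: (le_trans (H h)); rewrite -real_normK ?num_real // expr2 mulrA ler_wpM2r //.
  have hM : `|h| <= e / (M + 1) by near: h; exact: dnbhs0_le.
  rewrite ler_pdivlMr // in hM; apply: le_trans hM.
  by rewrite mulrC ler_wpM2l // lerDl.
apply: DeriveDef; [by apply/cvg_ex; exists D|exact: cvg_lim].
Unshelve. all: end_near. Qed.

Lemma mean_value_ineq (g D : R -> R) (B : R) :
  (forall t : R, is_derive t 1 g (D t)) -> (forall t, 0 <= t <= 1 -> `|D t| <= B) ->
  `|g 1 - g 0| <= B.
Proof.
move=> hg hB.
have [c] := @MVT_segment R g D 0 1 ler01 (fun x _ => hg x) (derivable_within_continuous (fun x _ => @ex_derive _ _ _ _ _ _ _ (hg x))).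
by rewrite in_itv /= => /hB h ->; rewrite subr0 mulr1.
Qed.

(** Covers both signs of [c], at the price of locating the point by its absolute value only. *)
Lemma mean_value_pt (g D : R -> R) (c : R) :
  (forall t : R, is_derive t 1 g (D t)) ->
  exists2 t, `|t| <= `|c| & g c - g 0 = D t * c.
Proof.
move=> hg; have [c0|c0] := lerP 0 c.
  have [t] := @MVT_segment R g D 0 c c0 (fun x _ => hg x) (derivable_within_continuous (fun x _ => @ex_derive _ _ _ _ _ _ _ (hg x))).
  rewrite in_itv /= => /andP[t0 tc] ->; exists t; last by rewrite subr0.
  by rewrite !ger0_norm.
have [t] := @MVT_segment R g D c 0 (ltW c0) (fun x _ => hg x) (derivable_within_continuous (fun x _ => @ex_derive _ _ _ _ _ _ _ (hg x))).
rewrite in_itv /= => /andP[ct t0] h; exists t.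
  by rewrite !ler0_norm ?lerN2 // ltW.
by rewrite -opprB h sub0r mulrN opprK.
Qed.

End MeanValue.

Lemma addACK (V : zmodType) (a b : V) : a + b - a = b.
Proof. by rewrite addrAC subrr add0r. Qed.

Section EntrywiseNorm.
Variables (R : realType) (p q : nat).
Implicit Types A B : 'M[R]_(p, q).

(** The entrywise sum is additive over entries and bounds each of them; it replaces [frob] in all
    estimates on states. *)
Definition l1n A : R := \sum_i \sum_j `|A i j|.

Lemma l1n_ge0 A : 0 <= l1n A.
Proof. by apply: sumr_ge0 => i _; apply: sumr_ge0. Qed.

Lemma l1n0 : l1n 0 = 0.
Proof. by apply: big1 => i _; apply: big1 => j _; rewrite mxE normr0. Qed.

Lemma l1nD A B : l1n (A + B) <= l1n A + l1n B.
Proof.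
rewrite /l1n -big_split /=; apply: ler_sum => i _.
by rewrite -big_split /=; apply: ler_sum => j _; rewrite mxE ler_normD.
Qed.

Lemma l1nN A : l1n (- A) = l1n A.
Proof. by apply: eq_bigr => i _; apply: eq_bigr => j _; rewrite mxE normrN. Qed.

Lemma l1nB A B : l1n (A - B) <= l1n A + l1n B.
Proof. by rewrite -(l1nN B) l1nD. Qed.

Lemma l1nBC A B : l1n (A - B) = l1n (B - A).
Proof. by rewrite -opprB l1nN. Qed.

Lemma l1nZ a A : l1n (a *: A) = `|a| * l1n A.
Proof.
rewrite /l1n mulr_sumr; apply: eq_bigr => i _.
by rewrite mulr_sumr; apply: eq_bigr => j _; rewrite mxE normrM.
Qed.

Lemma l1n_entry A i j : `|A i j| <= l1n A.
Proof.
rewrite /l1n (bigD1 i) //= (bigD1 j) //= -addrA lerDl addr_ge0 //; first exact: sumr_ge0.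
by apply: sumr_ge0 => k _; apply: sumr_ge0.
Qed.

End EntrywiseNorm.

Lemma finite_unif_bound (R : realType) (I : finType) (X : Type) (F : I -> X -> R) :
  (forall i, exists M : R, forall x, `|F i x| <= M) ->
  exists M : R, 0 <= M /\ forall i x, `|F i x| <= M.
Proof.
move=> /choice[M hM]; exists (\sum_i `|M i|); split; first exact: sumr_ge0.
move=> i x; apply: (le_trans (hM i x)); apply: (le_trans (ler_norm _)).
by rewrite (bigD1 i) //= lerDl sumr_ge0.
Qed.

(** * Taylor expansions and four-point bounds for functions with bounded derivatives *)

Section Regular.
Variables (R : realType) (d : nat).
Implicit Types (f : 'cV[R]_d -> R) (G : 'I_d -> 'cV[R]_d -> R) (y v z : 'cV[R]_d).

(** Quantitative differentiability with gradient field [G] and one constant for the gradient, its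
    Lipschitz norm and the Taylor remainder. *)
Record C11 f G (M : R) : Prop := {
  C11_ge0 : 0 <= M ;
  C11_bd : forall k y, `|G k y| <= M ;
  C11_lip : forall k y z, `|G k y - G k z| <= M * l1n (y - z) ;
  C11_taylor : forall y v,
    `|f (y + v) - f y - \sum_k v k 0 * G k y| <= M * l1n v ^+ 2 }.

(** [fp_four] is the form in which a bounded second derivative is used: second differences of [f]
    are controlled by second differences of the arguments plus a product of first differences. *)
Record four_point f (M : R) : Prop := {
  fp_ge0 : 0 <= M ;
  fp_bd : forall y, `|f y| <= M ;
  fp_lip : forall y z, `|f y - f z| <= M * l1n (y - z) ;
  fp_four : forall a b c e, `|f a - f b - (f c - f e)| <=
    M * l1n (a - b - (c - e)) + M * (l1n (a - b) + l1n (c - e)) * l1n (a - c) }.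

Lemma l1n_cV v : l1n v = \sum_k `|v k 0|.
Proof. by apply: eq_bigr => k _; rewrite big_ord1. Qed.

Lemma cV_sum_delta v : v = \sum_k v k 0 *: delta_mx k 0.
Proof. by rewrite {1}(matrix_sum_delta v); apply: eq_bigr => k _; rewrite big_ord1. Qed.

Lemma grad_pairing_le (g : 'I_d -> R) v (B : R) :
  (forall k, `|g k| <= B) -> `|\sum_k v k 0 * g k| <= B * l1n v.
Proof.
move=> h; rewrite l1n_cV mulr_sumr; apply: (le_trans (ler_norm_sum _ _ _)).
by apply: ler_sum => k _; rewrite normrM mulrC ler_wpM2r.
Qed.

Lemma coord_is_derive f (y : 'cV[R]_d) k : (forall y, derivable f y (delta_mx k 0)) ->
  forall t : R, is_derive t 1 (fun t => f (y + t *: delta_mx k 0))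
    (partial k f (y + t *: delta_mx k 0)).
Proof.
move=> hf t.
have E : (fun h : R => h^-1 *: (((fun t => f (y + t *: delta_mx k 0)) \o shift t) (h *: 1)
     - f (y + t *: delta_mx k 0))) =
   (fun h : R => h^-1 *: ((f \o shift (y + t *: delta_mx k 0)) (h *: delta_mx k 0)
      - f (y + t *: delta_mx k 0))).
  apply/funext => h /=; rewrite /shift /= [h *: 1]mulr1 scalerDl.
  by rewrite addrCA.
by apply: DeriveDef; [have := hf (y + t *: delta_mx k 0)|];
  rewrite /partial /derivable /derive -E.
Qed.

Lemma coord_mvt f k : (forall y, derivable f y (delta_mx k 0)) -> forall (y : 'cV[R]_d) (c : R),
  exists2 t : R, `|t| <= `|c| & f (y + c *: delta_mx k 0) - f y
    = partial k f (y + t *: delta_mx k 0) * c.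
Proof.
move=> hf y c.
by have [t tc] := mean_value_pt c (coord_is_derive y hf); rewrite scale0r addr0; exists t.
Qed.

Lemma l1n_delta (c : R) (k : 'I_d) : l1n (c *: delta_mx k 0 : 'cV[R]_d) = `|c|.
Proof.
rewrite l1nZ l1n_cV (bigD1 k) //= mxE !eqxx normr1 big1 ?addr0 ?mulr1 // => j jk.
by rewrite mxE (negbTE jk) normr0.
Qed.

(** The increment is decomposed into moves along the axes, one coordinate at a time, so that partial
    derivatives suffice. *)
Lemma partial_lip f (M : R) : 0 <= M -> (forall k y, derivable f y (delta_mx k 0)) ->
  (forall k y, `|partial k f y| <= M) -> forall y z, `|f y - f z| <= M * l1n (y - z).
Proof.
move=> M0 hf hM y z; have [v ->] : exists v, y = z + v by exists (y - z); rewrite addrC subrK.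
have -> : z + v - z = v by rewrite addACK.
rewrite l1n_cV {1}[v]cV_sum_delta.
elim: (index_enum _) => [|k s IH]; first by rewrite !big_nil addr0 subrr normr0 mulr0.
rewrite !big_cons mulrDr; set w := \sum_(j <- s) _ in IH *.
rewrite [_ *: _ + w]addrC addrA.
have [t _ ht] := coord_mvt (hf k) (z + w) (v k 0).
rewrite -(subrK (f (z + w)) (f (z + w + _))) -addrA; apply: (le_trans (ler_normD _ _)).
by rewrite lerD // ht normrM ler_wpM2r.
Qed.

(** Again one coordinate at a time: each move has an exact mean value, and the derivative at the
    intermediate point differs from the one at [y] by M times the distance already covered. *)
Lemma partial_C11 f (M : R) : 0 <= M -> (forall k y, derivable f y (delta_mx k 0)) ->
  (forall k y, `|partial k f y| <= M) ->
  (forall l k y, derivable (partial k f) y (delta_mx l 0)) ->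
  (forall l k y, `|partial l (partial k f) y| <= M) ->
  C11 f (fun k => partial k f) M.
Proof.
move=> M0 hf hM hf2 hM2.
have lip k := partial_lip M0 (fun l => hf2 l k) (fun l => hM2 l k).
split=> // y v; rewrite l1n_cV {1}[v]cV_sum_delta.
have key (s : seq 'I_d) :
  l1n (\sum_(k <- s) v k 0 *: (delta_mx k 0 : 'cV[R]_d)) <= \sum_(k <- s) `|v k 0| /\
  `|f (y + \sum_(k <- s) v k 0 *: delta_mx k 0) - f y
     - \sum_(k <- s) v k 0 * partial k f y| <= M * (\sum_(k <- s) `|v k 0|) ^+ 2.
  elim: s => [|k s [IH1 IH2]].
    by rewrite !big_nil addr0 subrr subr0 normr0 l1n0 expr0n /= mulr0.
  rewrite !big_cons; set w := \sum_(j <- s) _ *: _ in IH1 IH2 *.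
  set S := \sum_(j <- s) `|_| in IH1 IH2 *; set P := \sum_(j <- s) _ * _ in IH2 *.
  have S0 : 0 <= S by apply: sumr_ge0.
  split; first by apply: (le_trans (l1nD _ _)); rewrite l1n_delta lerD2l.
  rewrite [_ *: _ + w]addrC addrA.
  have [t tc ht] := coord_mvt (hf k) (y + w) (v k 0).
  set a := f (y + w + _) in ht *; set b := f (y + w) in IH2 ht *.
  set q := partial k f (y + w + _) in ht *.
  have h1 : `|q - partial k f y| <= M * (S + `|v k 0|).
    apply: (le_trans (lip k _ _)); rewrite ler_wpM2l //.
    have -> : y + w + t *: delta_mx k 0 - y = w + t *: delta_mx k 0.
      by rewrite -[y + w + _]addrA addACK.
    by apply: (le_trans (l1nD _ _)); rewrite l1n_delta lerD.
  have -> : a - f y - (v k 0 * partial k f y + P) =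
      (b - f y - P) + (q - partial k f y) * v k 0.
    by rewrite -(subrK b a) ht; ring.
  apply: (le_trans (ler_normD _ _)); apply: (le_trans (lerD IH2 (lexx _))).
  rewrite normrM; have := ler_wpM2r (normr_ge0 (v k 0)) h1.
  set c := `|v k 0|; set X := _ * c => hX.
  have c0 : 0 <= c by exact: normr_ge0.
  have : 0 <= M * S * c by rewrite !mulr_ge0.
  move=> hS; apply: (le_trans (lerD (lexx _) hX)); rewrite -subr_ge0.
  by apply: (le_trans hS); rewrite le_eqVlt; apply/orP; left; apply/eqP; ring.
by have [_] := key (index_enum _).
Qed.

Lemma C11_line_is_derive f G M : C11 f G M -> forall z v (t : R),
  is_derive t 1 (fun t : R => f (z + t *: v)) (\sum_k v k 0 * G k (z + t *: v)).
Proof.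
move=> hf z v t; apply: (@quad_is_derive _ _ _ _ (M * l1n v ^+ 2)) => h.
have -> : M * l1n v ^+ 2 * h ^+ 2 = M * l1n (h *: v) ^+ 2.
  by rewrite l1nZ exprMn real_normK ?num_real //; ring.
have -> : (\sum_k v k 0 * G k (z + t *: v)) * h = \sum_k (h *: v) k 0 * G k (z + t *: v).
  by rewrite mulr_suml; apply: eq_bigr => k _; rewrite mxE; ring.
by rewrite scalerDl addrA; exact: C11_taylor.
Qed.

(** Interpolation between the pairs (c, e) at t = 0 and (a, b) at t = 1. The derivative splits into
    the gradient applied to the second difference of the arguments and a difference of gradients
    applied to a - c. *)
Lemma C11_four f G M : C11 f G M -> forall a b c e,
  `|f a - f b - (f c - f e)| <=
    M * l1n (a - b - (c - e)) + M * (l1n (a - b) + l1n (c - e)) * l1n (a - c).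
Proof.
move=> hf a b c e.
have M0 := C11_ge0 hf.
pose v := a - c; pose w := b - e.
pose g t := f (c + t *: v) - f (e + t *: w).
pose Dg t := \sum_k v k 0 * G k (c + t *: v) - \sum_k w k 0 * G k (e + t *: w).
have hg (t : R) : is_derive t 1 g (Dg t).
  by apply: is_deriveB; exact: (C11_line_is_derive hf).
have -> : f a - f b - (f c - f e) = g 1 - g 0.
  by rewrite /g !scale1r !scale0r !addr0 /v /w !(addrC _ (_ - _)) !subrK.
apply: (mean_value_ineq hg) => t /andP[t0 t1].
have -> : Dg t = \sum_k (a - b - (c - e)) k 0 * G k (e + t *: w)
    + \sum_k v k 0 * (G k (c + t *: v) - G k (e + t *: w)).
  rewrite /Dg -sumrB -big_split /=; apply: eq_bigr => k _.
  by rewrite /v /w !mxE; ring.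
apply: (le_trans (ler_normD _ _)); apply: lerD.
  by apply: grad_pairing_le => k; exact: (C11_bd hf).
apply: grad_pairing_le => k; apply: (le_trans (C11_lip hf _ _ _)); rewrite ler_wpM2l //.
have -> : c + t *: v - (e + t *: w) = t *: (a - b) + (1 - t) *: (c - e).
  by apply/matrixP => i j; rewrite /v /w !mxE; ring.
apply: (le_trans (l1nD _ _)); rewrite !l1nZ.
by apply: lerD; rewrite ler_piMl ?l1n_ge0 // ger0_norm ?subr_ge0 //; clear -t0; lra.
Qed.

Lemma four_point_C11 f G M : C11 f G M -> (forall y, `|f y| <= M) ->
  (forall y z, `|f y - f z| <= M * l1n (y - z)) -> four_point f M.
Proof. by move=> hf hb hl; split=> //; [exact: (C11_ge0 hf)|exact: (C11_four hf)]. Qed.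

(** The remainder at (y, v) is compared with the one at (z, u) through (y, u). Changing the
    direction at a fixed base point is a Taylor remainder at y + u plus a gradient difference.
    Changing the base point along a fixed direction is a mean value in t, whose derivative is a
    second difference of [G]. *)
Lemma C11_remainder_four f G M : C11 f G M -> (forall k, four_point (G k) M) ->
  forall y v z u,
  `|(f (y + v) - f y - \sum_k v k 0 * G k y) - (f (z + u) - f z - \sum_k u k 0 * G k z)|
   <= M * (2 * l1n u + l1n v) * l1n (v - u) + 2 * M * l1n u ^+ 2 * l1n (y - z).
Proof.
move=> hf hG y v z u; have M0 := C11_ge0 hf.
pose r y u := f (y + u) - f y - \sum_k u k 0 * G k y.
rewrite -/(r y v) -/(r z u) -(subrK (r y u) (r y v)) -addrA.
apply: (le_trans (ler_normD _ _)); apply: lerD.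
  have -> : r y v - r y u = (f (y + u + (v - u)) - f (y + u)
      - \sum_k (v - u) k 0 * G k (y + u)) + \sum_k (v - u) k 0 * (G k (y + u) - G k y).
    have -> : y + u + (v - u) = y + v by rewrite -[y + u + _]addrA [u + (v - u)]addrC subrK.
    rewrite /r.
    have -> : \sum_k (v - u) k 0 * (G k (y + u) - G k y) =
       \sum_k (v - u) k 0 * G k (y + u) - (\sum_k v k 0 * G k y - \sum_k u k 0 * G k y).
      by rewrite -!sumrB; apply: eq_bigr => k _; rewrite !mxE; ring.
    by ring.
  apply: (le_trans (ler_normD _ _)).
  apply: (le_trans (lerD (C11_taylor hf _ _) (grad_pairing_le (B := M * l1n u) _ _))).
    by move=> k; apply: (le_trans (C11_lip hf _ _ _)); rewrite addACK.
  rewrite expr2 mulrA -mulrDl ler_wpM2r ?l1n_ge0 // -mulrDr ler_wpM2l //.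
  by have := l1nB v u; clear; lra.
(* The linear part is included in [g], so the gradient terms of its derivative combine into a second
   difference. *)
pose g t := (f (y + t *: u) - f (z + t *: u)) - t * (\sum_k u k 0 * (G k y - G k z)).
pose Dg t := (\sum_k u k 0 * G k (y + t *: u) - \sum_k u k 0 * G k (z + t *: u))
   - \sum_k u k 0 * (G k y - G k z).
have hg (t : R) : is_derive t 1 g (Dg t).
  apply: is_deriveB.
    by apply: is_deriveB; exact: (C11_line_is_derive hf).
  apply: (@quad_is_derive _ _ _ _ 0) => h.
  by rewrite [X in `|X|](_ : _ = 0) ?normr0 ?mul0r //; ring.
have -> : r y u - r z u = g 1 - g 0.
  rewrite /g /r !scale1r !scale0r !addr0 mul1r mul0r subr0.
  have -> : \sum_k u k 0 * (G k y - G k z) = \sum_k u k 0 * G k y - \sum_k u k 0 * G k z.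
    by rewrite -sumrB; apply: eq_bigr => k _; rewrite mulrBr.
  by ring.
apply: (mean_value_ineq hg) => t /andP[t0 t1].
have -> : Dg t = \sum_k u k 0 * (G k (y + t *: u) - G k y - (G k (z + t *: u) - G k z)).
  by rewrite /Dg -!sumrB; apply: eq_bigr => k _; ring.
have -> : 2 * M * l1n u ^+ 2 * l1n (y - z) = (2 * M * l1n u * l1n (y - z)) * l1n u by ring.
apply: grad_pairing_le => k; apply: (le_trans (fp_four (hG k) _ _ _ _)).
have -> : y + t *: u - y = t *: u by rewrite addACK.
have -> : z + t *: u - z = t *: u by rewrite addACK.
have -> : y + t *: u - (z + t *: u) = y - z by rewrite opprD addrACA subrr addr0.
rewrite subrr l1n0 mulr0 add0r ler_wpM2r ?l1n_ge0 // [2 * M]mulrC -mulrA ler_wpM2l //.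
by rewrite l1nZ ger0_norm // mulr2n mulrDl mul1r; have := l1n_ge0 u; clear -t1 => ?; nra.
Qed.

(** Leibniz rule for second differences; boundedness of both factors is used, and it also keeps the
    product of a second difference with a first difference linear. *)
Lemma four_pointM f g M M' : four_point f M -> four_point g M' ->
  four_point (fun y => f y * g y) (6 * M * M').
Proof.
move=> hf hg; have [M0 M'0] := (fp_ge0 hf, fp_ge0 hg).
have MM : 0 <= M * M' by rewrite mulr_ge0.
have bf := fp_bd hf; have bg := fp_bd hg; have lf := fp_lip hf; have lg := fp_lip hg.
split; first by rewrite -mulrA mulr_ge0.
- move=> y; rewrite normrM -mulrA.
  have := ler_pM (normr_ge0 _) (normr_ge0 _) (bf y) (bg y).
  by move: MM; clear; lra.
- move=> y z.
  have -> : f y * g y - f z * g z = (f y - f z) * g y + f z * (g y - g z) by ring.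
  apply: (le_trans (ler_normD _ _)); rewrite !normrM.
  have h1 := ler_pM (normr_ge0 _) (normr_ge0 _) (lf y z) (bg y).
  have h2 := ler_pM (normr_ge0 _) (normr_ge0 _) (bf z) (lg y z).
  have h3 : 0 <= M * M' * l1n (y - z) by rewrite mulr_ge0 // l1n_ge0.
  apply: (le_trans (lerD h1 h2)).
  by move: h3; clear; lra.
move=> a b c e.
have -> : f a * g a - f b * g b - (f c * g c - f e * g e) =
  (f a - f b - (f c - f e)) * g a + (f c - f e) * (g a - g c)
  + (f b * (g a - g b - (g c - g e)) + ((f a - f c) - (f a - f b - (f c - f e))) * (g c - g e)).
  by ring.
set A := l1n (a - b - _); set B1 := l1n (a - b); set B2 := l1n (c - e); set D := l1n (a - c).
have A0 : 0 <= A := l1n_ge0 _. have B10 : 0 <= B1 := l1n_ge0 _.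
have B20 : 0 <= B2 := l1n_ge0 _. have D0 : 0 <= D := l1n_ge0 _.
have ff := fp_four hf a b c e; have gg := fp_four hg a b c e.
rewrite -/A -/B1 -/B2 -/D in ff gg.
have lf1 := lf a c; have lf2 := lf c e; have lg1 := lg a c; have lg2 := lg c e.
rewrite -/D in lf1 lg1; rewrite -/B2 in lf2 lg2.
have bgg : `|g c - g e| <= 2 * M'.
  by apply: (le_trans (ler_normB _ _)); have := bg c; have := bg e; clear; lra.
have h1 := ler_pM (normr_ge0 _) (normr_ge0 _) ff (bg a).
have h2 := ler_pM (normr_ge0 _) (normr_ge0 _) lf2 lg1.
have h3 := ler_pM (normr_ge0 _) (normr_ge0 _) (bf b) gg.
have h4 := ler_pM (normr_ge0 _) (normr_ge0 _) lf1 lg2.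
have h5 := ler_pM (normr_ge0 _) (normr_ge0 _) ff bgg.
apply: (le_trans (ler_normD _ _)); apply: (le_trans (lerD (ler_normD _ _) (ler_normD _ _))).
have h45 := le_trans (ler_normB ((f a - f c) * (g c - g e))
  ((f a - f b - (f c - f e)) * (g c - g e))) _.
rewrite -mulrBl !normrM in h45; have {}h45 := h45 _ (lerD h4 h5).
rewrite !normrM.
apply: (le_trans (lerD (lerD h1 h2) (lerD h3 h45))).
rewrite -subr_ge0.
have -> : 6 * M * M' * A + 6 * M * M' * (B1 + B2) * D -
  ((M * A + M * (B1 + B2) * D) * M' + M * B2 * (M' * D) +
   (M * (M' * A + M' * (B1 + B2) * D) + (M * D * (M' * B2) +
    (M * A + M * (B1 + B2) * D) * (2 * M')))) =
  2 * (M * M' * A) + 2 * (M * M' * (B1 * D)) by ring.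
by rewrite addr_ge0 // mulr_ge0 // mulr_ge0 // mulr_ge0.
Qed.

Lemma four_pointW f M M' : four_point f M -> M <= M' -> four_point f M'.
Proof.
move=> hf MM; have M0 := fp_ge0 hf.
split; first exact: le_trans MM.
- by move=> y; exact: le_trans (fp_bd hf y) MM.
- by move=> y z; apply: (le_trans (fp_lip hf y z)); rewrite ler_wpM2r ?l1n_ge0.
move=> a b c e; apply: (le_trans (fp_four hf a b c e)).
by rewrite -mulrA -[in leRHS]mulrA; apply: lerD; rewrite ler_wpM2r // ?mulr_ge0 ?addr_ge0 ?l1n_ge0.
Qed.

Lemma four_pointD f g M M' : four_point f M -> four_point g M' ->
  four_point (fun y => f y + g y) (M + M').
Proof.
move=> hf hg; split; first by rewrite addr_ge0 // ?(fp_ge0 hf) ?(fp_ge0 hg).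
- move=> y; apply: (le_trans (ler_normD _ _)); apply: lerD; [exact: (fp_bd hf)|exact: (fp_bd hg)].
- move=> y z; rewrite opprD addrACA mulrDl; apply: (le_trans (ler_normD _ _)).
  by apply: lerD; [exact: (fp_lip hf)|exact: (fp_lip hg)].
move=> a b c e.
have -> : f a + g a - (f b + g b) - (f c + g c - (f e + g e)) =
  (f a - f b - (f c - f e)) + (g a - g b - (g c - g e)) by ring.
apply: (le_trans (ler_normD _ _)).
apply: (le_trans (lerD (fp_four hf _ _ _ _) (fp_four hg _ _ _ _))).
by rewrite le_eqVlt; apply/orP; left; apply/eqP; ring.
Qed.

Lemma four_point0 : four_point (fun=> 0) 0.
Proof.
split=> // [y|y z|a b c e]; rewrite ?subr0 ?normr0 //.
- by rewrite mul0r.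
- by rewrite !mul0r addr0.
Qed.

Lemma four_point_sum (I : Type) (s : seq I) (f : I -> 'cV[R]_d -> R) M :
  (forall i, four_point (f i) M) ->
  four_point (fun y => \sum_(i <- s) f i y) (\sum_(i <- s) M).
Proof.
move=> hf; elim: s => [|i s IH].
  have -> : (fun y => \sum_(i <- [::]) f i y) = fun=> 0 by apply/funext => y; rewrite big_nil.
  by rewrite big_nil; exact: four_point0.
have -> : (fun y => \sum_(j <- i :: s) f j y) = fun y => f i y + \sum_(j <- s) f j y.
  by apply/funext => y; rewrite big_cons.
by rewrite big_cons; exact: four_pointD.
Qed.

(** Orders 1 and 2 give the expansion of [f], orders 2 and 3 that of its partial derivatives; the
    latter yields their four-point bound. *)
Lemma C3b_regular f : C3b f -> exists M, [/\ C11 f (fun k => partial k f) M,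
  four_point f M & forall k, four_point (partial k f) M].
Proof.
move=> [hd hb].
have [M0 [M00 h0]] : exists M : R, 0 <= M /\ forall y, `|f y| <= M.
  have [|M [M0 hM]] := @finite_unif_bound R unit _ (fun _ => f).
    by move=> _; have [_] := hb [::] isT.
  by exists M; split=> // y; exact: (hM tt).
have [|M1 [M10 h1]] := @finite_unif_bound R 'I_d _ (fun k => partial k f).
  by move=> k; have [_] := hb [:: k] isT.
have [|M2 [M20 h2]] := @finite_unif_bound R ('I_d * 'I_d)%type _
    (fun p => partial p.1 (partial p.2 f)).
  by move=> [l k]; have [_] := hb [:: l; k] isT.
have [|M3 [M30 h3]] := @finite_unif_bound R ('I_d * 'I_d * 'I_d)%type _
    (fun p => partial p.1.1 (partial p.1.2 (partial p.2 f))).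
  by move=> [[m l] k]; have [_] := hb [:: m; l; k] isT.
pose M := M0 + M1 + M2 + M3.
have Mge0 : 0 <= M by rewrite !addr_ge0.
have m0 y : `|f y| <= M by have := h0 y; move: M10 M20 M30; rewrite /M; clear; lra.
have m1 k y : `|partial k f y| <= M.
  by have := h1 k y; move: M00 M20 M30; rewrite /M; clear; lra.
have m2 l k y : `|partial l (partial k f) y| <= M.
  by have := h2 (l, k) y; move: M00 M10 M30; rewrite /M; clear; lra.
have m3 m l k y : `|partial m (partial l (partial k f)) y| <= M.
  by have := h3 (m, l, k) y; move: M00 M10 M20; rewrite /M; clear; lra.
have d0 k y : derivable f y (delta_mx k 0) by exact: (hd [::] isT).
have d1 l k y : derivable (partial k f) y (delta_mx l 0) by exact: (hd [:: k] isT).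
have d2 m l k y : derivable (partial l (partial k f)) y (delta_mx m 0).
  exact: (hd [:: l; k] isT).
have cf := partial_C11 Mge0 d0 m1 d1 m2.
have cg k := partial_C11 Mge0 (fun l => d1 l k) (fun l => m2 l k)
  (fun m l => d2 m l k) (fun m l => m3 m l k).
exists M; split=> //.
- by apply: four_point_C11 cf _ _ => //; exact: partial_lip.
- by move=> k; apply: four_point_C11 (cg k) _ _ => //; exact: (C11_lip cf k).
Qed.

End Regular.

(** * The weighted space L1 *)

Section WeightedL1.
Variables (R : realType) (phi : R -> R).
Hypothesis mphi : measurable_fun (`]0, +oo[ : set R) phi.
Implicit Types f g : R -> R.
Local Notation H := (@halfline R).
Local Notation leb := (@lebesgue_measure R).

Definition wabs f (x : R) : R := `|phi x| * (1 + x) * `|f x|.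

Definition wint f : Prop := measurable_fun H f /\ (\int[leb]_(x in H) (wabs f x)%:E < +oo)%E.

Definition wnorm f : R := fine (\int[leb]_(x in H) (wabs f x)%:E).

Lemma halflineE (x : R) : H x = (0 <= x).
Proof. by rewrite /halfline /= in_itv /= andbT. Qed.

Lemma measurable_halfline : measurable H.
Proof. exact: measurable_itv. Qed.

(** [halfline] contains 0 whereas [phi] is measurable on the open half-line; adding one point
    preserves measurability. *)
Lemma mphi0 : measurable_fun H phi.
Proof. exact/measurable_fun_itv_obnd_cbndP. Qed.

Lemma weight_ge0 (x : R) : 0 <= x -> 0 <= `|phi x| * (1 + x).
Proof. by move=> x0; rewrite mulr_ge0 // addr_ge0. Qed.

Lemma wabs_ge0 f x : H x -> 0 <= wabs f x.
Proof. by rewrite halflineE => x0; rewrite mulr_ge0 // weight_ge0. Qed.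

Lemma wabs_ge0E f x : H x -> (0 <= (wabs f x)%:E)%E.
Proof. by move=> Hx; rewrite lee_fin wabs_ge0. Qed.

Lemma measurable_wabs f : measurable_fun H f -> measurable_fun H (fun x => (wabs f x)%:E).
Proof.
move=> mf; apply/measurable_EFinP; apply: measurable_funM.
  apply: measurable_funM; first by apply: measurableT_comp => //; exact: mphi0.
  by apply: measurable_funD => //; exact: measurable_id.
exact: measurableT_comp.
Qed.

Lemma wnormE f : wint f -> ((wnorm f)%:E = \int[leb]_(x in H) (wabs f x)%:E)%E.
Proof.
move=> [mf foo]; rewrite /wnorm fineK // ge0_fin_numE //.
by apply: integral_ge0 => x; exact: wabs_ge0E.
Qed.

Lemma wnorm_ge0 f : 0 <= wnorm f.
Proof. by apply: fine_ge0; apply: integral_ge0 => x; exact: wabs_ge0E. Qed.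

Lemma le_int_wabs f g : measurable_fun H f -> measurable_fun H g ->
  (forall x, 0 <= x -> `|f x| <= `|g x|) ->
  (\int[leb]_(x in H) (wabs f x)%:E <= \int[leb]_(x in H) (wabs g x)%:E)%E.
Proof.
move=> mf mg fg; apply: ge0_le_integral => //.
- exact: measurable_halfline.
- by move=> x; exact: wabs_ge0E.
- exact: measurable_wabs.
- exact: measurable_wabs.
move=> x; rewrite halflineE => x0; rewrite lee_fin ler_wpM2l ?weight_ge0 //.
exact: fg.
Qed.

Lemma le_wint f g : measurable_fun H f -> wint g ->
  (forall x, 0 <= x -> `|f x| <= `|g x|) -> wint f /\ wnorm f <= wnorm g.
Proof.
move=> mf wg fg; have le := le_int_wabs mf (proj1 wg) fg.
have wf : wint f by split=> //; apply: le_lt_trans le _; case: wg.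
by split=> //; rewrite -lee_fin !wnormE.
Qed.

Lemma eq_wint f g : (forall x, 0 <= x -> f x = g x) -> wint f -> wint g.
Proof.
move=> fg [mf foo]; have fgH : {in H, f =1 g}.
  by move=> x; rewrite inE halflineE => x0; exact: fg.
split; first exact: (eq_measurable_fun f).
rewrite (_ : (\int[leb]_(x in H) (wabs g x)%:E = \int[leb]_(x in H) (wabs f x)%:E)%E) //.
by apply: eq_integral => x /fgH; rewrite /wabs => ->.
Qed.

Lemma eq_wnorm f g : (forall x, 0 <= x -> f x = g x) -> wnorm f = wnorm g.
Proof.
move=> fg; congr fine; apply: eq_integral => x.
by rewrite inE halflineE /wabs => /fg ->.
Qed.

Lemma wint0 : wint (fun=> 0).
Proof.
split; first exact: measurable_cst.
by rewrite integral0_eq // => x _; rewrite /wabs normr0 mulr0.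
Qed.

Lemma wnorm0 : wnorm (fun=> 0) = 0.
Proof. by rewrite /wnorm integral0_eq // => x _; rewrite /wabs normr0 mulr0. Qed.

Lemma wintD f g : wint f -> wint g ->
  wint (fun x => f x + g x) /\ wnorm (fun x => f x + g x) <= wnorm f + wnorm g.
Proof.
move=> wf wg; have [mf _] := wf; have [mg _] := wg.
have mfg : measurable_fun H (fun x => f x + g x) by exact: measurable_funD.
have le : (\int[leb]_(x in H) (wabs (fun x => f x + g x) x)%:E <=
    (wnorm f + wnorm g)%:E)%E.
  rewrite EFinD !wnormE // -ge0_integralD //; last first.
  - exact: measurable_wabs.
  - by move=> x; exact: wabs_ge0E.
  - exact: measurable_wabs.
  - by move=> x; exact: wabs_ge0E.
  - exact: measurable_halfline.
  apply: ge0_le_integral => //.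
  - exact: measurable_halfline.
  - by move=> x; exact: wabs_ge0E.
  - exact: measurable_wabs.
  - by apply: emeasurable_funD; exact: measurable_wabs.
  move=> x; rewrite halflineE => x0; rewrite -EFinD lee_fin /wabs -mulrDr.
  by rewrite ler_wpM2l ?weight_ge0 // ler_normD.
have wfg : wint (fun x => f x + g x).
  by split=> //; apply: le_lt_trans le _; rewrite ltry.
by split=> //; rewrite -lee_fin wnormE.
Qed.

Lemma wintZ a f : wint f -> wint (fun x => a * f x) /\ wnorm (fun x => a * f x) = `|a| * wnorm f.
Proof.
move=> wf; have [mf _] := wf.
have E : (\int[leb]_(x in H) (wabs (fun x => a * f x) x)%:E = (`|a| * wnorm f)%:E)%E.
  rewrite EFinM wnormE // -ge0_integralZl_EFin //; last 3 first.
  - exact: measurable_halfline.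
  - by move=> x; exact: wabs_ge0E.
  - exact: measurable_wabs.
  by apply: eq_integral => x _; rewrite -EFinM /wabs normrM mulrCA.
have wfa : wint (fun x => a * f x).
  by split; [apply: measurable_funM => //; exact: measurable_cst|rewrite E ltry].
by split=> //; apply: EFin_inj; rewrite wnormE.
Qed.

Lemma wintN f : wint f -> wint (fun x => - f x) /\ wnorm (fun x => - f x) = wnorm f.
Proof.
move=> wf; have [h1 h2] := wintZ (-1) wf.
have E x : -1 * f x = - f x by rewrite mulN1r.
split; first by apply: eq_wint h1 => x _.
by rewrite -(eq_wnorm (fun x _ => E x)) h2 normrN normr1 mul1r.
Qed.

Lemma wint_phi f : wint f -> leb.-integrable H (EFin \o (fun x => phi x * f x)).
Proof.
move=> wf; have [mf foo] := wf; apply/integrableP; split.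
  by apply/measurable_EFinP; apply: measurable_funM => //; exact: mphi0.
apply: le_lt_trans foo; apply: ge0_le_integral => //.
- exact: measurable_halfline.
- apply/measurable_EFinP; apply: measurableT_comp => //.
  by apply: measurable_funM => //; exact: mphi0.
- exact: measurable_wabs.
move=> x; rewrite halflineE => x0; rewrite /= lee_fin normrM /wabs ler_wpM2r //.
by rewrite ler_peMr // lerDl.
Qed.

Lemma Rint0D f g : wint f -> wint g ->
  Rint0 (fun x => phi x * (f x + g x)) = Rint0 (fun x => phi x * f x) + Rint0 (fun x => phi x * g x).
Proof.
move=> wf wg; rewrite /Rint0 -RintegralD.
- by congr Rintegral; apply/funext => x; rewrite mulrDr.
- exact: measurable_halfline.
- exact: wint_phi.
- exact: wint_phi.
Qed.

Lemma Rint0Z a f : wint f -> Rint0 (fun x => phi x * (a * f x)) = a * Rint0 (fun x => phi x * f x).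
Proof.
move=> wf; rewrite /Rint0 -RintegralZl.
- by congr Rintegral; apply/funext => x; rewrite mulrCA.
- exact: measurable_halfline.
- exact: wint_phi.
Qed.

(** The integral against [phi] carries no weight, so the factor 1 + x of the norm is available to
    absorb a function [g] that is larger than [f] by that factor. *)
Lemma Rint0_bound f g (h : R) : measurable_fun H g -> wint f -> 0 <= h ->
  (forall x, 0 <= x -> `|g x| <= h * (1 + x) * `|f x|) ->
  `|Rint0 (fun x => phi x * g x)| <= h * wnorm f.
Proof.
move=> mg wf h0 fg; have [mf _] := wf.
rewrite -lee_fin EFinM wnormE // -ge0_integralZl_EFin //; last 3 first.
- exact: measurable_halfline.
- by move=> x; exact: wabs_ge0E.
- exact: measurable_wabs.
pose G (x : R) : \bar R := (phi x * g x)%:E.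
have mpg : measurable_fun H G.
  by apply/measurable_EFinP; apply: measurable_funM => //; exact: mphi0.
have le : (\int[leb]_(x in H) `|G x| <=
    \int[leb]_(x in H) (h%:E * (wabs f x)%:E))%E.
  apply: ge0_le_integral => //.
  - exact: measurable_halfline.
  - exact: measurableT_comp.
  - by apply: measurable_funeM; exact: measurable_wabs.
  move=> x; rewrite halflineE => x0; rewrite -EFinM lee_fin /= normrM /wabs.
  rewrite [leRHS](_ : _ = `|phi x| * (h * (1 + x) * `|f x|)); last by ring.
  by rewrite ler_wpM2l // fg.
have fin : (\int[leb]_(x in H) `|G x| < +oo)%E.
  apply: le_lt_trans le _; rewrite ge0_integralZl_EFin //; last 3 first.
  - exact: measurable_halfline.
  - by move=> x; exact: wabs_ge0E.
  - exact: measurable_wabs.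
  by rewrite -wnormE // -EFinM ltry.
have intg : leb.-integrable H G by apply/integrableP.
apply: le_trans (le_trans (le_abse_integral leb measurable_halfline mpg) le).
have : (\int[leb]_(x in H) G x)%E \is a fin_num.
  by apply: integrable_fin_num => //; exact: measurable_halfline.
have -> : Rint0 (fun x => phi x * g x) = fine (\int[leb]_(x in H) G x)%E by [].
by case: (\int[leb]_(x in H) _)%E.
Qed.

Lemma Rint0_le f : wint f -> `|Rint0 (fun x => phi x * f x)| <= wnorm f.
Proof.
move=> wf; have [mf _] := wf; rewrite -[wnorm f]mul1r; apply: Rint0_bound => // x x0.
by rewrite mul1r ler_peMl // lerDl.
Qed.

Lemma measurable_heat (t : R) : measurable_fun H (fun x => expR (- x * t)).
Proof.
apply: measurableT_comp; first exact: measurable_expR.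
by apply: measurable_funM => //; apply: measurableT_comp => //; exact: measurable_id.
Qed.

Lemma heat_itv (x t : R) : 0 <= x -> 0 <= t -> 0 <= expR (- x * t) <= 1.
Proof.
move=> x0 t0; rewrite expR_ge0 /= -expR0 ler_expR mulNr oppr_le0 mulr_ge0 //.
Qed.

Lemma wint_heat (t : R) f : 0 <= t -> wint f ->
  wint (fun x => expR (- x * t) * f x) /\ wnorm (fun x => expR (- x * t) * f x) <= wnorm f.
Proof.
move=> t0 wf; have [mf _] := wf; apply: le_wint => //.
  by apply: measurable_funM => //; exact: measurable_heat.
move=> x x0; have /andP[h0 h1] := heat_itv x0 t0.
by rewrite normrM ger0_norm // ler_piMl.
Qed.

(** From 0 <= 1 - e^{-xt} <= xt: the unbounded factor x is paid by the weight, and what remains is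
    linear in time. *)
Lemma Rint0_heat (t : R) f : 0 <= t -> wint f ->
  `|Rint0 (fun x => phi x * (expR (- x * t) * f x - f x))| <= t * wnorm f.
Proof.
move=> t0 wf; have [mf _] := wf; apply: Rint0_bound => //.
  apply: measurable_funB => //.
  by apply: measurable_funM => //; exact: measurable_heat.
move=> x x0; have /andP[h0 h1] := heat_itv x0 t0.
rewrite -[X in _ - X]mul1r -mulrBl normrM ler_wpM2r // ler0_norm ?subr_le0 // opprB.
have := expR_ge1Dx (- x * t); have : 0 <= x * t by rewrite mulr_ge0.
by rewrite mulNr; move: t0; clear; lra.
Qed.

(** Strong continuity of the semigroup at 0, without a rate since the weight has no further factor
    to give: dominated convergence along the times 1/(n+1). *)
Lemma heat_small f : wint f -> forall e : R, 0 < e -> exists2 dl : R, 0 < dl &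
  forall h, 0 <= h -> h < dl ->
    wint (fun x => (1 - expR (- x * h)) * f x) /\
    wnorm (fun x => (1 - expR (- x * h)) * f x) < e.
Proof.
move=> wf e e0; have [mf foo] := wf.
pose g h x := (1 - expR (- x * h)) * f x.
have mg h : measurable_fun H (g h).
  apply: measurable_funM => //; apply: measurable_funB => //.
  exact: measurable_heat.
have wg h : 0 <= h -> wint (g h).
  move=> h0; apply: (le_wint (mg h) wf _).1 => x x0; have /andP[a0 a1] := heat_itv x0 h0.
  by rewrite normrM ler_piMl // ger0_norm ?subr_ge0 // gerBl.
have gE h x : 0 <= x -> 0 <= h -> wabs (g h) x = wabs f x * (1 - expR (- x * h)).
  move=> x0 h0; have /andP[a0 a1] := heat_itv x0 h0.
  by rewrite /wabs /g normrM (ger0_norm (_ : 0 <= 1 - _)) ?subr_ge0 //; ring.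
have cv : {ae leb, forall x, H x -> (wabs (g n.+1%:R^-1) x)%:E @[n --> \oo] --> 0%E}.
  apply: aeW => x; rewrite halflineE => x0.
  apply: cvg_EFin; first by apply: nearW.
  have -> : fine \o (fun n : nat => (wabs (g n.+1%:R^-1) x)%:E) =
      fun n : nat => wabs f x * (1 - expR (- x * harmonic n)).
    by apply/funext => n /=; rewrite gE.
  have -> : (0 : R) = wabs f x * (1 - expR (- x * 0)) by rewrite mulr0 expR0 subrr mulr0.
  apply: cvgM; first exact: cvg_cst.
  apply: cvgB; first exact: cvg_cst.
  apply: (@cvg_comp _ _ _ (fun n => - x * harmonic n) expR); last exact: continuous_expR.
  by apply: cvgM; [exact: cvg_cst|exact: cvg_harmonic].
have dom : leb.-integrable H (fun x => (wabs f x)%:E).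
  apply/integrableP; split; first exact: measurable_wabs.
  rewrite (_ : (\int[leb]_(x in H) _ = \int[leb]_(x in H) (wabs f x)%:E)%E) //.
  by apply: eq_integral => x; rewrite inE => Hx; rewrite gee0_abs // wabs_ge0E.
have bd : {ae leb, forall x (n : nat), H x -> (`|(wabs (g n.+1%:R^-1) x)%:E| <= (wabs f x)%:E)%E}.
  apply: aeW => x n Hx; rewrite gee0_abs ?wabs_ge0E // lee_fin.
  have x0 : 0 <= x by rewrite -halflineE.
  have n0 : 0 <= n.+1%:R^-1 :> R by [].
  by rewrite gE // ler_piMr ?wabs_ge0 // gerBl expR_ge0.
have [_ _] := @dominated_convergence _ _ _ leb H measurable_halfline
  (fun n x => (wabs (g n.+1%:R^-1) x)%:E) (fun=> 0%E) _
  (fun n : nat => measurable_wabs (mg n.+1%:R^-1)) (measurable_cst 0%E) cv dom bd.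
rewrite integral0_eq // => /fine_cvgP[_ /cvgrPdist_lt /(_ e e0) [n _ /(_ n (leqnn n))]].
rewrite /= sub0r normrN => hn.
(* One time of the sequence suffices, since 1 - e^{-xh} is nondecreasing in h. *)
exists n.+1%:R^-1 => // h h0 hn'; split; first exact: wg.
apply: le_lt_trans hn; apply: le_trans (ler_norm _).
apply: (le_wint (mg h) (wg n.+1%:R^-1 _) _).2 => // x x0.
have /andP[a0 a1] := heat_itv x0 h0.
have n0 : 0 <= n.+1%:R^-1 :> R by [].
have /andP[b0 b1] := heat_itv x0 n0.
rewrite /g !normrM ler_wpM2r // !ger0_norm ?subr_ge0 //.
by rewrite lerD2l lerN2 ler_expR !mulNr lerN2 ler_wpM2l // ltW.
Qed.

(** The bounds on the tail force the upper limit to be finite, so that [fine] returns its true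
    value. *)
Lemma limn_esup_itv (u : nat -> R) (a b : R) k : (forall n, (k <= n)%N -> a <= u n <= b) ->
  a <= fine (limn_esup (fun n => (u n)%:E)) <= b.
Proof.
move=> hu; set v := fun n => (u n)%:E.
have hb n : (k <= n)%N -> (a%:E <= esups v n <= b%:E)%E.
  move=> kn; apply/andP; split.
    apply: (@le_trans _ _ (v n)); first by rewrite lee_fin; case/andP: (hu n kn).
    by apply: ereal_sup_ubound; exists n => //=.
  apply: ge_ereal_sup => _ [m /= nm <-]; rewrite lee_fin.
  by case/andP: (hu m (leq_trans kn nm)).
have ha' : (a%:E <= limn_esup v)%E.
  rewrite limn_esup_lim; apply: lime_ge; first exact: is_cvg_esups.
  by exists k => // n /= /hb/andP[].
have hb' : (limn_esup v <= b%:E)%E.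
  rewrite limn_esup_lim; apply: lime_le; first exact: is_cvg_esups.
  by exists k => // n /= /hb/andP[].
by case: (limn_esup v) ha' hb' => [r||] //=; rewrite !lee_fin => -> ->.
Qed.

(* The limit is the pointwise upper limit: if the tail series at x is finite it dominates
   the distance to it, and otherwise there is nothing to prove. *)
Lemma wnorm_complete (u : nat -> R -> R) (c q : R) : 0 <= q -> q < 1 ->
  (forall k, wint (u k)) -> (forall k, wnorm (fun x => u k.+1 x - u k x) <= c * q ^+ k) ->
  exists2 l, wint l & forall k, wint (fun x => u k x - l x) /\
    wnorm (fun x => u k x - l x) <= c / (1 - q) * q ^+ k.
Proof.
move=> q0 q1 wu hu.
have q1' : 0 < 1 - q by rewrite subr_gt0.
have c0 : 0 <= c.
  by have := le_trans (wnorm_ge0 _) (hu 0%N); rewrite expr0 mulr1.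
have mu k : measurable_fun H (u k) := proj1 (wu k).
pose l x := fine (limn_esup (fun n => (u n x)%:E)).
have ml : measurable_fun H l.
  apply: measurableT_comp; first exact: fine_measurable.
  by apply: measurable_fun_limn_esup => n; apply/measurable_EFinP.
pose dl k x := u k.+1 x - u k x.
have wdl k : wint (dl k) by have [] := wintD (wu k.+1) (wintN (wu k)).1.
have key k : (\int[leb]_(x in H) (wabs (fun x => u k x - l x) x)%:E <=
    (c / (1 - q) * q ^+ k)%:E)%E.
  pose a j x := (wabs (dl (k + j)%N) x)%:E.
  have a0 j x : H x -> (0 <= a j x)%E by exact: wabs_ge0E.
  have ma j : measurable_fun H (a j) by apply: measurable_wabs; case: (wdl (k + j)%N).
  apply: (@le_trans _ _ (\int[leb]_(x in H) (\sum_(0 <= j <oo) a j x))%E).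
    apply: ge0_le_integral => //.
    - exact: measurable_halfline.
    - by move=> x; exact: wabs_ge0E.
    - by apply: measurable_wabs; exact: measurable_funB.
    - exact: (ge0_emeasurable_sum (P := xpredT) (fun j y Hy _ => a0 j y Hy) (fun j _ => ma j)).
    move=> x Hx; have x0 : 0 <= x by rewrite -halflineE.
    have S0 : (0 <= \sum_(0 <= j <oo) a j x)%E by apply: nneseries_ge0 => j _ _; exact: a0.
    (* Where [phi] vanishes the sequence may diverge, but the weighted distance there is 0. *)
    rewrite /wabs; have [->|w0] := eqVneq (`|phi x| * (1 + x)) 0; first by rewrite mul0r.
    have {}w0 : 0 < `|phi x| * (1 + x) by rewrite lt_neqAle eq_sym w0 weight_ge0.
    have hn n : (\sum_(0 <= j < n) a j x <= \sum_(0 <= j <oo) a j x)%E.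
      by apply: nneseries_lim_ge => j _ _; exact: a0.
    case: (\sum_(0 <= j <oo) a j x)%E hn S0 => [r hn _|_ _|//]; last exact: leey.
    rewrite lee_fin mulrC -ler_pdivlMr //.
    set W := `|phi x| * (1 + x) in w0 *.
    have tel n : W * `|u (k + n)%N x - u k x| <= r.
      have := hn n; rewrite sumEFin lee_fin; apply: le_trans.
      elim: n => [|n IH]; first by rewrite addn0 subrr normr0 mulr0 big_nil.
      rewrite big_nat_recr //=; apply: le_trans (lerD IH (lexx _)).
      rewrite /wabs -/W -mulrDr ler_wpM2l ?(ltW w0) //.
      rewrite addnS -(subrK (u (k + n)%N x) (u (k + n).+1 x)) -addrA addrC.
      exact: ler_normD.
    have [|h1 h2] := andP (@limn_esup_itv (fun n => u n x) (u k x - r / W) (u k x + r / W) k _).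
      move=> n kn; rewrite -ler_distl ler_pdivlMr // mulrC -(subnKC kn); exact: tel.
    by rewrite distrC ler_distl; apply/andP.
  rewrite integral_nneseries //; last exact: measurable_halfline.
  apply: lime_le; first by apply: is_cvg_nneseries => n _ _; apply: integral_ge0 => x; exact: a0.
  apply: nearW => n.
  apply: (@le_trans _ _ (\sum_(0 <= j < n) (c * q ^+ (k + j))%:E)%E).
    by apply: lee_sum => j _; rewrite -wnormE // lee_fin; exact: hu.
  rewrite sumEFin lee_fin.
  have -> : \sum_(0 <= j < n) c * q ^+ (k + j) = c / (1 - q) * q ^+ k * (1 - q ^+ n).
    elim: n => [|n IH]; first by rewrite big_nil expr0 subrr mulr0.
    by rewrite big_nat_recr //= IH exprS exprD; field; rewrite gt_eqF.
  have h : 0 <= c / (1 - q) * q ^+ k by rewrite mulr_ge0 ?exprn_ge0 // divr_ge0 // ltW.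
  by rewrite ler_piMr // gerBl exprn_ge0.
have wul k : wint (fun x => u k x - l x).
  by split; [exact: measurable_funB|apply: le_lt_trans (key k) _; rewrite ltry].
exists l; last first.
  by move=> k; split=> //; rewrite -lee_fin wnormE.
have [w _] := wintD (wu 0%N) (wintN (wul 0%N)).1.
by apply: eq_wint w => x _; rewrite opprB addrC subrK.
Qed.

End WeightedL1.

(** * Matrix-valued functions: norms, semigroup and integrals against [phi] *)

Section WeightedL1Matrix.
Variables (R : realType) (phi : R -> R).
Hypothesis mphi : measurable_fun (`]0, +oo[ : set R) phi.
Local Notation H := (@halfline R).
Local Notation leb := (@lebesgue_measure R).

Lemma wint_sum (I : Type) (s : seq I) (f : I -> R -> R) : (forall i, wint phi (f i)) ->
  wint phi (fun x => \sum_(i <- s) f i x) /\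
  wnorm phi (fun x => \sum_(i <- s) f i x) <= \sum_(i <- s) wnorm phi (f i).
Proof.
move=> wf; elim: s => [|i s [IH1 IH2]].
  have E x : (0 : R) = \sum_(i <- [::]) f i x by rewrite big_nil.
  split; first by apply: eq_wint (wint0 phi) => x _.
  by rewrite big_nil -(eq_wnorm phi (fun x _ => E x)) wnorm0.
have E x : f i x + \sum_(j <- s) f j x = \sum_(j <- i :: s) f j x by rewrite big_cons.
have [h1 h2] := wintD mphi (wf i) IH1.
split; first by apply: eq_wint h1 => x _.
rewrite big_cons -(eq_wnorm phi (fun x _ => E x)); apply: (le_trans h2).
by rewrite lerD2l.
Qed.

Lemma wint_norm f : wint phi f -> wint phi (fun x => `|f x|) /\
  wnorm phi (fun x => `|f x|) = wnorm phi f.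
Proof.
move=> wf; have [mf foo] := wf.
have E x : wabs phi (fun x => `|f x|) x = wabs phi f x by rewrite /wabs normr_id.
split; last by congr fine; apply: eq_integral => x _; rewrite E.
split; first exact: measurableT_comp.
rewrite (_ : (\int[leb]_(x in H) (wabs phi (fun x => `|f x|) x)%:E
  = \int[leb]_(x in H) (wabs phi f x)%:E)%E) //.
by apply: eq_integral => x _; rewrite E.
Qed.

Section Shape.
Variables p q : nat.
Implicit Types (f g : R -> 'M[R]_(p, q)) (A : 'M[R]_(p, q)).

Definition mwint f : Prop := forall i j, wint phi (fun x => f x i j).
(** Real-valued and additive over entries, equivalent to [NL1] up to the factor p q by [NL1_le] and
    [mwnorm_le]. All estimates use it, and [NL1] reappears only at the interface with the
    statement. *)
Definition mwnorm f : R := \sum_i \sum_j wnorm phi (fun x => f x i j).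

Lemma frob_ge0 A : 0 <= frob A.
Proof. exact: sqrtr_ge0. Qed.

Lemma frob_entry A i j : `|A i j| <= frob A.
Proof.
rewrite /frob -sqrtr_sqr; apply: ler_wsqrtr.
rewrite (bigD1 i) //= (bigD1 j) //= -addrA lerDl addr_ge0 ?sumr_ge0 // => k _.
  exact: sqr_ge0.
by apply: sumr_ge0 => l _; exact: sqr_ge0.
Qed.

Lemma frob_le_l1n A : frob A <= l1n A.
Proof.
rewrite /frob -[leRHS]ger0_norm ?l1n_ge0 // -sqrtr_sqr.
apply: ler_wsqrtr.
have key (I : finType) (a : I -> R) : (forall i, 0 <= a i) -> \sum_i a i ^+ 2 <= (\sum_i a i) ^+ 2.
  move=> a0; rewrite expr2 mulr_suml; apply: ler_sum => i _.
  by rewrite expr2 ler_wpM2l // (bigD1 i) //= lerDl sumr_ge0.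
rewrite /l1n; apply: le_trans (key _ _ _); last by move=> i; apply: sumr_ge0.
apply: ler_sum => i _; apply: le_trans (key _ _ _) => //.
by apply: ler_sum => j _; rewrite real_normK ?num_real.
Qed.

Lemma measurable_frob f : (forall i j, measurable_fun H (fun x => f x i j)) ->
  measurable_fun H (fun x => frob (f x)).
Proof.
move=> mf; apply: measurableT_comp.
  by apply: continuous_measurable_fun; exact: sqrt_continuous.
apply: measurable_sum => i; apply: measurable_sum => j.
by apply: measurable_funX.
Qed.

Lemma NL1E f : NL1 phi f = (\int[leb]_(x in H) (wabs phi (fun x => frob (f x)) x)%:E)%E.
Proof. by apply: eq_integral => x _; rewrite /wabs (ger0_norm (frob_ge0 (f x))). Qed.

Lemma mwnorm_ge0 f : 0 <= mwnorm f.
Proof. by apply: sumr_ge0 => i _; apply: sumr_ge0 => j _; exact: wnorm_ge0. Qed.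

Lemma mwint_frob f : mwint f -> wint phi (fun x => frob (f x)) /\
  wnorm phi (fun x => frob (f x)) <= mwnorm f.
Proof.
move=> wf.
have h i := wint_sum (index_enum _) (fun j => (wint_norm (wf i j)).1).
have [h1 h2] := wint_sum (index_enum _) (fun i => (h i).1).
have mf : measurable_fun H (fun x => frob (f x)).
  by apply: measurable_frob => i j; case: (wf i j).
have [|h3 h4] := le_wint mphi mf h1 _.
  by move=> x _; rewrite (ger0_norm (frob_ge0 _)) (ger0_norm (l1n_ge0 (f x))) frob_le_l1n.
split=> //; apply: (le_trans h4); apply: (le_trans h2); apply: ler_sum => i _.
apply: (le_trans (h i).2); apply: ler_sum => j _.
by rewrite (wint_norm (wf i j)).2.
Qed.

Lemma inL1_mwint f : inL1 phi f <-> mwint f.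
Proof.
split=> [[mf foo] i j|wf]; last first.
  split; first by move=> i j; case: (wf i j).
  by rewrite NL1E; case: (mwint_frob wf) => -[].
rewrite NL1E in foo.
apply: (le_wint mphi (mf i j) (conj (measurable_frob mf) foo) _).1 => x _.
by rewrite (ger0_norm (frob_ge0 _)) frob_entry.
Qed.

Lemma NL1_le f : mwint f -> (NL1 phi f <= (mwnorm f)%:E)%E.
Proof.
move=> wf; have [h1 h2] := mwint_frob wf.
by rewrite NL1E -wnormE // lee_fin.
Qed.

Lemma mwnorm_le f (c : R) : mwint f -> (NL1 phi f <= c%:E)%E -> mwnorm f <= (p * q)%:R * c.
Proof.
move=> wf; have [h1 h2] := mwint_frob wf; rewrite NL1E -wnormE // lee_fin => hc.
have : mwnorm f <= \sum_(i < p) \sum_(j < q) c.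
  apply: ler_sum => i _; apply: ler_sum => j _; apply: le_trans hc.
  apply: (le_wint mphi (wf i j).1 h1 _).2 => x _.
  by rewrite (ger0_norm (frob_ge0 _)) frob_entry.
by rewrite !sumr_const !card_ord -mulrnA mulnC mulr_natl.
Qed.

Lemma mwintD f g : mwint f -> mwint g -> mwint (fun x => f x + g x) /\
  mwnorm (fun x => f x + g x) <= mwnorm f + mwnorm g.
Proof.
move=> wf wg.
have E i j x : f x i j + g x i j = (f x + g x) i j by rewrite mxE.
split=> [i j|].
  by apply: eq_wint (wintD mphi (wf i j) (wg i j)).1 => x _.
rewrite /mwnorm -big_split /=; apply: ler_sum => i _.
rewrite -big_split /=; apply: ler_sum => j _.
by rewrite -(eq_wnorm phi (fun x _ => E i j x)); exact: (wintD mphi (wf i j) (wg i j)).2.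
Qed.

Lemma mwintN f : mwint f -> mwint (fun x => - f x) /\ mwnorm (fun x => - f x) = mwnorm f.
Proof.
move=> wf; have E i j x : - f x i j = (- f x) i j by rewrite mxE.
split=> [i j|]; first by apply: eq_wint (wintN mphi (wf i j)).1 => x _.
apply: eq_bigr => i _; apply: eq_bigr => j _.
by rewrite -(eq_wnorm phi (fun x _ => E i j x)); exact: (wintN mphi (wf i j)).2.
Qed.

Lemma mwintB f g : mwint f -> mwint g -> mwint (fun x => f x - g x) /\
  mwnorm (fun x => f x - g x) <= mwnorm f + mwnorm g.
Proof.
move=> wf wg; have [w e] := mwintN wg.
by have [h1 h2] := mwintD wf w; rewrite e in h2.
Qed.

Lemma mwint0 : mwint (fun=> 0) /\ mwnorm (fun=> 0) = 0.
Proof.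
have E i j (x : R) : (0 : R) = ((fun=> 0) x : 'M[R]_(p, q)) i j by rewrite mxE.
split=> [i j|]; first by apply: eq_wint (wint0 phi) => x _; exact: E.
apply: big1 => i _; apply: big1 => j _.
by rewrite -(eq_wnorm phi (fun x _ => E i j x)) wnorm0.
Qed.

Lemma eq_mwint f g : (forall x, 0 <= x -> f x = g x) -> mwint f -> mwint g.
Proof. by move=> fg wf i j; apply: eq_wint (wf i j) => x /fg ->. Qed.

Lemma eq_mwnorm f g : (forall x, 0 <= x -> f x = g x) -> mwnorm f = mwnorm g.
Proof.
by move=> fg; apply: eq_bigr => i _; apply: eq_bigr => j _; apply: eq_wnorm => x /fg ->.
Qed.

(** With this operator [dtil1 f t s] is f_t minus the image of f_s at time t - s. *)
Definition heat (t : R) f : R -> 'M[R]_(p, q) := fun x => expR (- x * t) *: f x.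

Lemma mwint_heat t f : 0 <= t -> mwint f -> mwint (heat t f) /\ mwnorm (heat t f) <= mwnorm f.
Proof.
move=> t0 wf; have E i j x : expR (- x * t) * f x i j = heat t f x i j by rewrite mxE.
split=> [i j|].
  by apply: eq_wint (wint_heat mphi t0 (wf i j)).1 => x _.
apply: ler_sum => i _; apply: ler_sum => j _.
by rewrite -(eq_wnorm phi (fun x _ => E i j x)); exact: (wint_heat mphi t0 (wf i j)).2.
Qed.

Lemma phintD f g : mwint f -> mwint g -> phint phi (fun x => f x + g x) = phint phi f + phint phi g.
Proof.
move=> wf wg; apply/matrixP => i j; rewrite !mxE -Rint0D //.
by congr Rint0; apply/funext => x; rewrite mxE.
Qed.

Lemma phintN f : mwint f -> phint phi (fun x => - f x) = - phint phi f.
Proof.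
move=> wf; apply/matrixP => i j; rewrite !mxE -mulN1r -Rint0Z //.
by congr Rint0; apply/funext => x; rewrite mxE mulN1r.
Qed.

Lemma phintB f g : mwint f -> mwint g -> phint phi (fun x => f x - g x) = phint phi f - phint phi g.
Proof. by move=> wf wg; rewrite phintD ?phintN //; case: (mwintN wg). Qed.

Lemma eq_phint f g : (forall x, 0 <= x -> f x = g x) -> phint phi f = phint phi g.
Proof.
move=> fg; apply/matrixP => i j; rewrite !mxE; congr fine; apply: eq_integral => x.
by rewrite inE halflineE => /fg ->.
Qed.

Lemma l1n_phint f : mwint f -> l1n (phint phi f) <= mwnorm f.
Proof.
move=> wf; apply: ler_sum => i _; apply: ler_sum => j _; rewrite mxE.
exact: Rint0_le.
Qed.

Lemma l1n_phint_heat t f : 0 <= t -> mwint f ->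
  l1n (phint phi (fun x => heat t f x - f x)) <= t * mwnorm f.
Proof.
move=> t0 wf; rewrite /mwnorm mulr_sumr; apply: ler_sum => i _.
rewrite mulr_sumr; apply: ler_sum => j _; rewrite mxE.
have -> : (fun x => phi x * (heat t f x - f x) i j)
  = fun x => phi x * (expR (- x * t) * f x i j - f x i j).
  by apply/funext => x; rewrite !mxE.
exact: Rint0_heat.
Qed.

End Shape.

Section TracePairing.
Variables (d p q : nat).
Implicit Types (M : R -> 'M[R]_(p, q)) (c : 'I_d -> 'M[R]_(q, p)).

(** One pairing for both terms of the integral: for p = 1 the product of a row with a column, for p
    = q the trace pairing of x2 with a Gubinelli derivative, one matrix [c j] per coordinate of the
    result. *)
Definition trp M c : R -> 'cV[R]_d := fun x => \col_j \tr (M x *m c j).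

Lemma trpE M c x j : trp M c x j 0 = \sum_a \sum_b M x a b * c j b a.
Proof. by rewrite mxE /mxtrace; apply: eq_bigr => a _; rewrite mxE. Qed.

Lemma trp_wint M c (b : R) : mwint M -> (forall j k l, `|c j k l| <= b) ->
  mwint (trp M c) /\ mwnorm (trp M c) <= d%:R * (b * mwnorm M).
Proof.
move=> wM cb.
have h1 j a := wint_sum (index_enum _) (fun b => (wintZ mphi (c j b a) (wM a b)).1).
have h2 j := wint_sum (index_enum _) (fun a => (h1 j a).1).
have E j x : \sum_a \sum_b c j b a * M x a b = trp M c x j 0.
  by rewrite trpE; apply: eq_bigr => a _; apply: eq_bigr => k _; rewrite mulrC.
split=> [j k|].
  by rewrite (ord1 k); apply: eq_wint (h2 j).1 => x _.
have -> : d%:R * (b * mwnorm M) = \sum_(j < d) b * mwnorm M.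
  by rewrite sumr_const card_ord mulr_natl.
apply: ler_sum => j _; rewrite big_ord1 -(eq_wnorm phi (fun x _ => E j x)).
apply: (le_trans (h2 j).2); rewrite mulr_sumr; apply: ler_sum => a _.
apply: (le_trans (h1 j a).2); rewrite mulr_sumr; apply: ler_sum => k _.
by rewrite (wintZ mphi _ (wM a k)).2 ler_wpM2r ?wnorm_ge0.
Qed.

Lemma trp_phint M c : mwint M -> phint phi (trp M c) = \col_j \tr (phint phi M *m c j).
Proof.
move=> wM; apply/matrixP => j k; rewrite (ord1 k) !mxE /mxtrace.
pose f j x := \sum_a \sum_b c j b a * M x a b.
have key (I : Type) (s : seq I) (g : I -> R -> R) : (forall i, wint phi (g i)) ->
    Rint0 (fun x => phi x * \sum_(i <- s) g i x) = \sum_(i <- s) Rint0 (fun x => phi x * g i x).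
  move=> wg; elim: s => [|i s IH].
    rewrite big_nil /Rint0 /Rintegral integral0_eq // => x _.
    by rewrite big_nil mulr0.
  rewrite big_cons -IH -Rint0D //; last exact: (wint_sum s wg).1.
  by congr Rint0; apply/funext => x; rewrite big_cons.
have h1 j a := wint_sum (index_enum _) (fun b => (wintZ mphi (c j b a) (wM a b)).1).
transitivity (Rint0 (fun x => phi x * \sum_a \sum_b c j b a * M x a b)).
  congr Rint0; apply/funext => x; rewrite trpE; congr (_ * _).
  by apply: eq_bigr => a _; apply: eq_bigr => b _; rewrite mulrC.
rewrite key => [|a]; last exact: (h1 j a).1.
apply: eq_bigr => a _; rewrite mxE key => [|b]; last exact: (wintZ mphi _ (wM a b)).1.
by apply: eq_bigr => b _; rewrite Rint0Z // mxE mulrC.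
Qed.

End TracePairing.

End WeightedL1Matrix.

(** * L1 as a complete seminormed group *)

Section L1Space.
Variables (R : realType) (phi : R -> R).
Hypothesis mphi : measurable_fun (`]0, +oo[ : set R) phi.
Variable d : nat.

(* The measurability proof is an argument only so that closure instances can be declared. *)
Definition mwint_pred of measurable_fun (`]0, +oo[ : set R) phi : {pred R -> 'cV[R]_d} :=
  fun g => `[< mwint phi g >].

Lemma mwint_predP g : reflect (mwint phi g) (g \in mwint_pred mphi).
Proof. exact: asboolP. Qed.

Lemma mwint_zmod_closed : zmod_closed (mwint_pred mphi).
Proof.
split; first by apply/mwint_predP; exact: (mwint0 phi d 1).1.
by move=> f g /mwint_predP wf /mwint_predP wg; apply/mwint_predP; exact: (mwintB mphi wf wg).1.
Qed.

HB.instance Definition _ := GRing.isZmodClosed.Build (R -> 'cV[R]_d) (mwint_pred mphi)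
  mwint_zmod_closed.

Record L1v := MkL1v { L1val : R -> 'cV[R]_d ; L1valP : L1val \in mwint_pred mphi }.

HB.instance Definition _ := [isSub for L1val].
HB.instance Definition _ := [Choice of L1v by <:].
HB.instance Definition _ := [SubChoice_isSubZmodule of L1v by <:].

(* Opaque, so that unification never compares two elements of L1v by their constructions. *)
Lemma toL1_subproof (g : R -> 'cV[R]_d) : {Y : L1v | mwint phi g -> L1val Y = g}.
Proof.
by exists (insubd 0 g) => wg; rewrite insubdK //; apply/mwint_predP.
Qed.

Definition toL1 (g : R -> 'cV[R]_d) : L1v := proj1_sig (toL1_subproof g).

Lemma toL1K g : mwint phi g -> L1val (toL1 g) = g.
Proof. exact: (proj2_sig (toL1_subproof g)). Qed.

Lemma L1val_mwint (Y : L1v) : mwint phi (L1val Y).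
Proof. by apply/mwint_predP; exact: L1valP. Qed.

Lemma L1valB (Y Z : L1v) : L1val (Y - Z) = fun x => L1val Y x - L1val Z x.
Proof. by have /= -> := raddfB (val : L1v -> _) Y Z. Qed.

Definition L1norm (Y : L1v) : R := mwnorm phi (L1val Y).

Lemma L1norm_seminorm : seminorm L1norm.
Proof.
split.
- by move=> Y; exact: mwnorm_ge0.
- move=> Y Z; rewrite /L1norm; have /= -> := raddfD (val : L1v -> _) Y Z.
  exact: (mwintD mphi (L1val_mwint Y) (L1val_mwint Z)).2.
- by move=> Y; exact: (mwintN mphi (L1val_mwint Y)).2.
- exact: (mwint0 phi d 1).2.
Qed.

(** Limits are taken in each coordinate, where the increments are bounded by the full norm; summing
    the d rates gives the constant d. *)
Lemma L1norm_complete : geometrically_complete L1norm.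
Proof.
exists d%:R => // u c q q0 q1 hu.
pose un k i x := L1val (u k) x i 0.
have hi i : exists l, wint phi l /\ forall k, wint phi (fun x => un k i x - l x) /\
    wnorm phi (fun x => un k i x - l x) <= c / (1 - q) * q ^+ k.
  have [|k|l wl hl] := @wnorm_complete R phi mphi (un ^~ i) c q q0 q1; last by exists l.
    by move=> k; exact: L1val_mwint.
  apply: le_trans (hu k).
  rewrite /L1norm L1valB /mwnorm (bigD1 i) //= big_ord1.
  rewrite (@eq_wnorm _ _ _ (fun x => (L1val (u k.+1) x - L1val (u k) x) i 0)).
    by rewrite lerDl sumr_ge0 // => j _; rewrite big_ord1; exact: wnorm_ge0.
  by move=> x _; rewrite !mxE.
have [l hl] := choice hi.
pose L x : 'cV[R]_d := \col_i l i x.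
have wL : mwint phi L.
  move=> i j; rewrite (ord1 j); apply: eq_wint (hl i).1 => x _; by rewrite mxE.
exists (toL1 L) => k; rewrite /L1norm L1valB toL1K //.
have -> : d%:R * (c / (1 - q)) * q ^+ k = \sum_(i < d) c / (1 - q) * q ^+ k.
  by rewrite sumr_const card_ord -mulrA mulr_natl.
apply: ler_sum => i _; rewrite big_ord1; apply: le_trans ((hl i).2 k).2.
rewrite le_eqVlt; apply/orP; left; apply/eqP; apply: eq_wnorm => x _.
by rewrite !mxE.
Qed.

End L1Space.

(** * The one-step scheme and its defect *)

Section TraceVector.
Variables (R : realType) (d p q : nat).
Implicit Types (A B : 'M[R]_(p, q)) (c e : 'I_d -> 'M[R]_(q, p)).

Definition trv A c : 'cV[R]_d := \col_j \tr (A *m c j).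

Lemma trvDl A B c : trv (A + B) c = trv A c + trv B c.
Proof. by apply/matrixP => j k; rewrite !mxE mulmxDl mxtraceD. Qed.

Lemma trvZl a A c : trv (a *: A) c = a *: trv A c.
Proof. by apply/matrixP => j k; rewrite !mxE -scalemxAl mxtraceZ. Qed.

Lemma trvBr A c e : trv A (fun j => c j - e j) = trv A c - trv A e.
Proof. by apply/matrixP => j k; rewrite !mxE mulmxBr raddfB. Qed.

Lemma l1n_trv A c (b : R) : (forall j k l, `|c j k l| <= b) -> l1n (trv A c) <= d%:R * (b * l1n A).
Proof.
move=> cb; have -> : d%:R * (b * l1n A) = \sum_(j < d) b * l1n A.
  by rewrite sumr_const card_ord mulr_natl.
apply: ler_sum => j _; rewrite big_ord1 mxE /mxtrace.
apply: (le_trans (ler_norm_sum _ _ _)); rewrite mulr_sumr; apply: ler_sum => a _.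
rewrite mxE; apply: (le_trans (ler_norm_sum _ _ _)); rewrite mulr_sumr; apply: ler_sum => k _.
by rewrite normrM mulrC ler_wpM2r.
Qed.

End TraceVector.

(** Hypothesis (H) in the form used by the scheme: exponent [kap], bounds valid on the diagonal as
    well, one power of t - s in place of a decomposition of the third-order term, and the algebraic
    relations solved for the large interval. *)
Record rough_driver (R : realType) (phi : R -> R) (T kap : R) (n : nat)
    (xt1 : R -> R -> R -> 'M[R]_(1, n)) (xt2 : R -> R -> R -> 'M[R]_(n, n))
    (xt3 : R -> R -> R -> R -> 'M[R]_(n, n)) (C : R) : Prop := {
  rd_C : 0 <= C ;
  rd_w1 : forall t s, 0 <= s -> s <= t -> t <= T ->
    mwint phi (xt1 t s) /\ mwnorm phi (xt1 t s) <= C * (t - s) `^ kap ;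
  rd_w2 : forall t s, 0 <= s -> s <= t -> t <= T ->
    mwint phi (xt2 t s) /\ mwnorm phi (xt2 t s) <= C * ((t - s) `^ kap) ^+ 2 ;
  rd_w3 : forall t u s, 0 <= s -> s <= u -> u <= t -> t <= T ->
    mwint phi (xt3 t u s) /\ mwnorm phi (xt3 t u s) <= C * ((t - s) `^ kap) ^+ 3 ;
  rd_c1 : forall t u s xi, 0 <= s -> s <= u -> u <= t -> t <= T -> 0 <= xi ->
    xt1 t s xi = xt1 t u xi + heat (t - u) (xt1 u s) xi ;
  rd_c2 : forall t u s xi, 0 <= s -> s <= u -> u <= t -> t <= T -> 0 <= xi ->
    xt2 t s xi = xt2 t u xi + heat (t - u) (xt2 u s) xi
      + ((xt1 t u xi)^T *m x1 phi xt1 u s + xt3 t u s xi) }.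

(** [rs_prod_four] concerns the Gubinelli derivative of sigma^(j)(y) when that of y is sigma(y), the
    coefficient of x2. *)
Record regular_sigma (R : realType) (n d : nat) (sigma : 'cV[R]_d -> 'M[R]_(n, d)) (M : R) : Prop := {
  rs_M : 0 <= M ;
  rs_C11 : forall i j, C11 (fun y => sigma y i j) (fun k => partial k (fun y => sigma y i j)) M ;
  rs_four : forall i j, four_point (fun y => sigma y i j) M ;
  rs_grad_four : forall i j k, four_point (partial k (fun y => sigma y i j)) M ;
  rs_prod_four : forall j a b,
    four_point (fun y => (sigma y *m (jac_col sigma j y)^T) a b) M }.

Lemma C11W (R : realType) d (f : 'cV[R]_d -> R) G (M M' : R) : C11 f G M -> M <= M' -> C11 f G M'.
Proof.
move=> hf MM; have M0 := C11_ge0 hf; split; first exact: le_trans MM.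
- by move=> k y; apply: (le_trans (C11_bd hf k y)).
- by move=> k y z; apply: (le_trans (C11_lip hf k y z)); rewrite ler_wpM2r ?l1n_ge0.
- by move=> y v; apply: (le_trans (C11_taylor hf y v)); rewrite ler_wpM2r ?sqr_ge0.
Qed.

Lemma C3b_regular_sigma (R : realType) n d (sigma : 'cV[R]_d -> 'M[R]_(n, d)) :
  (forall i j, C3b (fun z => sigma z i j)) -> exists M, regular_sigma sigma M.
Proof.
move=> hs.
have h (p : 'I_n * 'I_d) := C3b_regular (hs p.1 p.2).
have [F hF] := choice h.
pose M1 := \sum_p `|F p|.
have leM p : F p <= M1.
  apply: (le_trans (ler_norm _)); rewrite /M1 (bigD1 p) //= lerDl.
  by apply: sumr_ge0.
have M10 : 0 <= M1 by apply: sumr_ge0.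
pose M2 := \sum_(k < d) 6 * M1 * M1.
have f1 i j : four_point (fun y => sigma y i j) M1.
  by have [_ h1 _] := hF (i, j); exact: four_pointW h1 (leM (i, j)).
have f2 i j k : four_point (partial k (fun y => sigma y i j)) M1.
  by have [_ _ h1] := hF (i, j); exact: four_pointW (h1 k) (leM (i, j)).
have M20 : 0 <= M2 by apply: sumr_ge0 => k _; rewrite mulr_ge0 // mulr_ge0.
have M1M : M1 <= M1 + M2 by rewrite lerDl.
exists (M1 + M2); split; first by rewrite addr_ge0.
- by move=> i j; have [h1 _ _] := hF (i, j); apply: C11W h1 (le_trans (leM (i, j)) M1M).
- by move=> i j; exact: four_pointW (f1 i j) M1M.
- by move=> i j k; exact: four_pointW (f2 i j k) M1M.
move=> j a b.
have -> : (fun y => (sigma y *m (jac_col sigma j y)^T) a b) =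
    fun y => \sum_k sigma y a k * partial k (fun y => sigma y b j) y.
  by apply/funext => y; rewrite mxE; apply: eq_bigr => k _; rewrite !mxE.
apply: (four_pointW (M := M2)); last by rewrite lerDr.
by apply: four_point_sum => k; exact: four_pointM.
Qed.

Section Defect.
Variables (R : realType) (phi : R -> R).
Hypothesis mphi : measurable_fun (`]0, +oo[ : set R) phi.
Variables (T kap C : R) (n d : nat).
Variables (xt1 : R -> R -> R -> 'M[R]_(1, n)) (xt2 : R -> R -> R -> 'M[R]_(n, n)).
Variables (xt3 : R -> R -> R -> R -> 'M[R]_(n, n)) (sigma : 'cV[R]_d -> 'M[R]_(n, d)).
Implicit Types y z : 'cV[R]_d.

Definition sig_coef y (j : 'I_d) : 'M[R]_(n, 1) := col j (sigma y).
Definition sig2_coef y (j : 'I_d) : 'M[R]_n := sigma y *m (jac_col sigma j y)^T.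

(** The germ of the rough integral of sigma(y), with y frozen at its value at time s. *)
Definition increment (t s : R) y : R -> 'cV[R]_d :=
  fun xi => trv (xt1 t s xi) (sig_coef y) + trv (xt2 t s xi) (sig2_coef y).

Definition lead (u s : R) y : 'cV[R]_d := trv (x1 phi xt1 u s) (sig_coef y).

(** For p the leading increment of y, this is the remainder of the j-th column of sigma along the
    path. *)
Definition taylor_coef (p y yu : 'cV[R]_d) (j : 'I_d) : 'M[R]_(n, 1) :=
  sig_coef yu j - sig_coef y j - jac_col sigma j y *m p.

(** The function h of the definition of the integral, seen as depending only on the values [y] at s
    and [yu] at u. *)
Definition defect (t u s : R) y yu : R -> 'cV[R]_d :=
  fun xi => trv (xt1 t u xi) (taylor_coef (lead u s y) y yu)
    + trv (xt2 t u xi) (fun j => sig2_coef yu j - sig2_coef y j)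
    - trv (xt3 t u s xi) (sig2_coef y).

(** Cyclicity of the trace. It identifies the product term of the relation for x2, paired with sigma
    Dsigma, with x1 applied to the first-order variation of sigma; these two cancel in the
    defect. *)
Lemma trv_outer (A B : 'M[R]_(1, n)) y :
  trv (A^T *m B) (sig2_coef y) = trv A (fun j => jac_col sigma j y *m trv B (sig_coef y)).
Proof.
have E : trv B (sig_coef y) = (B *m sigma y)^T.
  apply/matrixP => j k; rewrite !mxE /mxtrace big_ord1 !mxE (ord1 k).
  by apply: eq_bigr => a _; rewrite !mxE.
rewrite E; apply/matrixP => j k; rewrite !mxE /sig2_coef.
rewrite -mxtrace_tr !trmx_mul !trmxK -!mulmxA.
rewrite [RHS](_ : _ = \tr (A *m (jac_col sigma j y *m ((sigma y)^T *m B^T)))) //.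
by rewrite mxtrace_mulC -!mulmxA mxtrace_mulC -!mulmxA mxtrace_mulC -!mulmxA mxtrace_mulC -!mulmxA.
Qed.

Lemma increment_defect (Hd : rough_driver phi T kap xt1 xt2 xt3 C) (t u s : R) y yu (xi : R) :
  0 <= s -> s <= u -> u <= t -> t <= T -> 0 <= xi ->
  increment t u yu xi + heat (t - u) (increment u s y) xi - increment t s y xi =
  defect t u s y yu xi.
Proof.
move=> s0 su ut tT xi0; rewrite /increment /defect /taylor_coef /heat.
rewrite (rd_c1 Hd s0 su ut tT xi0) (rd_c2 Hd s0 su ut tT xi0) /heat.
rewrite !trvDl !trvZl trv_outer !trvBr -/(lead u s y).
do ?[move: (trv _ _) => ?].
by apply/matrixP => i j; rewrite !mxE; ring.
Qed.

Lemma lead_le (M u s : R) y : regular_sigma sigma M ->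
  l1n (lead u s y) <= d%:R * (M * l1n (x1 phi xt1 u s)).
Proof.
move=> hs; apply: l1n_trv => j a b; rewrite mxE.
exact: (fp_bd (rs_four hs a j)).
Qed.

Lemma leadB_le (M u s : R) y z : regular_sigma sigma M ->
  l1n (lead u s y - lead u s z) <= d%:R * (M * l1n (y - z) * l1n (x1 phi xt1 u s)).
Proof.
move=> hs; rewrite -trvBr; apply: l1n_trv => j a b.
by rewrite !mxE; exact: (fp_lip (rs_four hs a j)).
Qed.

Lemma taylor_coefE p y yu j a b : taylor_coef p y yu j a b =
  sigma yu a j - sigma y a j - \sum_k p k 0 * partial k (fun z => sigma z a j) y.
Proof.
rewrite (ord1 b) !mxE; congr (_ - _); apply: eq_bigr => k _.
by rewrite !mxE mulrC.
Qed.

(** The point y + p is inserted: a genuine Taylor remainder, plus the Lipschitz effect of replacing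
    y + p by yu. *)
Lemma taylor_coef_le (M : R) p y yu j a b : regular_sigma sigma M ->
  `|taylor_coef p y yu j a b| <= M * l1n p ^+ 2 + M * l1n (yu - y - p).
Proof.
move=> hs; rewrite taylor_coefE.
have -> : sigma yu a j - sigma y a j - \sum_k p k 0 * partial k (fun z => sigma z a j) y =
  (sigma (y + p) a j - sigma y a j - \sum_k p k 0 * partial k (fun z => sigma z a j) y)
  + (sigma yu a j - sigma (y + p) a j) by ring.
apply: (le_trans (ler_normD _ _)); apply: lerD; first exact: (C11_taylor (rs_C11 hs a j)).
by rewrite -[yu - y - p]addrA -opprD; exact: (fp_lip (rs_four hs a j)).
Qed.

(** The same insertion for both triples: the Taylor parts are compared by [C11_remainder_four], the
    displacements by the four-point bound of sigma. *)
Lemma taylor_coefB_le (M : R) p p' y yu z zu j a b : regular_sigma sigma M ->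
  `|taylor_coef p y yu j a b - taylor_coef p' z zu j a b| <=
    M * (2 * l1n p' + l1n p) * l1n (p - p') + 2 * M * l1n p' ^+ 2 * l1n (y - z)
    + (M * l1n ((yu - y - p) - (zu - z - p'))
      + M * (l1n (yu - y - p) + l1n (zu - z - p')) * (l1n (y - z) + l1n (p - p'))).
Proof.
move=> hs; have M0 := rs_M hs; rewrite !taylor_coefE.
set r := \sum_k p k 0 * _; set r' := \sum_k p' k 0 * _.
have -> : sigma yu a j - sigma y a j - r - (sigma zu a j - sigma z a j - r') =
  ((sigma (y + p) a j - sigma y a j - r) - (sigma (z + p') a j - sigma z a j - r'))
  - ((sigma (y + p) a j - sigma yu a j) - (sigma (z + p') a j - sigma zu a j)) by ring.
apply: (le_trans (ler_normB _ _)); apply: lerD.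
  exact: (C11_remainder_four (rs_C11 hs a j) (rs_grad_four hs a j)).
apply: (le_trans (fp_four (rs_four hs a j) _ _ _ _)).
have E (v vu q : 'cV[R]_d) : v + q - vu = - (vu - v - q) by rewrite !opprB addrA [q + v]addrC.
rewrite (E y yu) (E z zu) !l1nN.
have -> : - (yu - y - p) - - (zu - z - p') = - ((yu - y - p) - (zu - z - p')).
  by move: (yu - y - p) (zu - z - p') => A B; rewrite opprK opprB addrC.
rewrite l1nN lerD2l ler_wpM2l //.
  by rewrite mulr_ge0 // addr_ge0 // l1n_ge0.
have -> : y + p - (z + p') = (y - z) + (p - p') by rewrite opprD addrACA.
exact: l1nD.
Qed.

Lemma sig2_coefB_le (M : R) y yu j a b : regular_sigma sigma M ->
  `|(sig2_coef yu j - sig2_coef y j) a b| <= M * l1n (yu - y).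
Proof.
by move=> hs; rewrite [X in `|X|]mxE [X in _ + X]mxE; exact: (fp_lip (rs_prod_four hs j a b)).
Qed.

Lemma sig2_coefBB_le (M : R) y yu z zu j a b : regular_sigma sigma M ->
  `|((sig2_coef yu j - sig2_coef y j) - (sig2_coef zu j - sig2_coef z j)) a b| <=
    M * l1n (yu - y - (zu - z)) + M * (l1n (yu - y) + l1n (zu - z)) * l1n (y - z).
Proof.
move=> hs.
have -> : ((sig2_coef yu j - sig2_coef y j) - (sig2_coef zu j - sig2_coef z j)) a b =
    - ((sig2_coef y j a b - sig2_coef yu j a b) - (sig2_coef z j a b - sig2_coef zu j a b)).
  move: (sig2_coef y j) (sig2_coef yu j) (sig2_coef z j) (sig2_coef zu j) => A B D E.
  by rewrite !mxE; ring.
rewrite normrN; apply: (le_trans (fp_four (rs_prod_four hs j a b) _ _ _ _)).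
have -> : y - yu - (z - zu) = - (yu - y - (zu - z)) by rewrite -[y - yu]opprB -[z - zu]opprB -opprD.
by rewrite l1nN (l1nBC y yu) (l1nBC z zu).
Qed.

(** Each term is of third order in [e] once p is of order [e] and yu - y - p of order [e] squared;
    these sizes are inserted later, since they depend on where y and yu come from. *)
Lemma defect_wint (M : R) (Hd : rough_driver phi T kap xt1 xt2 xt3 C) (t u s : R) y yu :
  regular_sigma sigma M -> 0 <= s -> s <= u -> u <= t -> t <= T ->
  let p := lead u s y in let e := (t - s) `^ kap in 0 <= kap ->
  mwint phi (defect t u s y yu) /\
  mwnorm phi (defect t u s y yu) <=
    d%:R * (C * ((M * l1n p ^+ 2 + M * l1n (yu - y - p)) * e
              + M * l1n (yu - y) * e ^+ 2 + M * e ^+ 3)).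
Proof.
move=> hs s0 su ut tT p e k0; have M0 := rs_M hs; have C0 := rd_C Hd.
have [w1 n1] := rd_w1 Hd (le_trans s0 su) ut tT.
have [w2 n2] := rd_w2 Hd (le_trans s0 su) ut tT.
have [w3 n3] := rd_w3 Hd s0 su ut tT.
have e0 : 0 <= e by exact: powR_ge0.
have eu0 : 0 <= (t - u) `^ kap by exact: powR_ge0.
have eu : (t - u) `^ kap <= e by apply: ler_powRl; rewrite ?subr_ge0 // lerD2l lerN2.
have [wa na] := trp_wint mphi w1 (fun j a b => taylor_coef_le p y yu j a b hs).
have [wb nb] := trp_wint mphi w2 (fun j a b => sig2_coefB_le y yu j a b hs).
have [wc nc] := trp_wint mphi w3 (fun j a b => fp_bd (rs_prod_four hs j a b) y).
have [wab nab] := mwintD mphi wa wb.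
have [wabc nabc] := mwintB mphi wab wc.
split; first exact: wabc.
apply: (le_trans nabc); apply: (le_trans (lerD nab (lexx _))).
apply: (le_trans (lerD (lerD na nb) nc)).
rewrite -[X in X + _ <= _]mulrDr -[leLHS]mulrDr ler_wpM2l //.
have -> : C * ((M * l1n p ^+ 2 + M * l1n (yu - y - p)) * e
              + M * l1n (yu - y) * e ^+ 2 + M * e ^+ 3) =
  (M * l1n p ^+ 2 + M * l1n (yu - y - p)) * (C * e) + M * l1n (yu - y) * (C * e ^+ 2)
  + M * (C * e ^+ 3) by ring.
have q0 : 0 <= M * l1n (yu - y) by rewrite mulr_ge0 // l1n_ge0.
apply: lerD; last by rewrite ler_wpM2l.
apply: lerD; rewrite ler_wpM2l //.
- by rewrite addr_ge0 // mulr_ge0 ?l1n_ge0 // exprn_ge0 // l1n_ge0.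
- by apply: (le_trans n1); rewrite ler_wpM2l.
- by apply: (le_trans n2); rewrite ler_wpM2l // lerXn2r ?nnegrE.
Qed.

Lemma defectB_wint (M : R) (Hd : rough_driver phi T kap xt1 xt2 xt3 C) (t u s : R) y yu z zu :
  regular_sigma sigma M -> 0 <= s -> s <= u -> u <= t -> t <= T ->
  let p := lead u s y in let p' := lead u s z in
  let rho := yu - y - p in let rho' := zu - z - p' in let e := (t - s) `^ kap in 0 <= kap ->
  mwnorm phi (fun xi => defect t u s y yu xi - defect t u s z zu xi) <=
    d%:R * (C * ((M * (2 * l1n p' + l1n p) * l1n (p - p') + 2 * M * l1n p' ^+ 2 * l1n (y - z)
    + (M * l1n (rho - rho') + M * (l1n rho + l1n rho') * (l1n (y - z) + l1n (p - p')))) * e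
    + (M * l1n (yu - y - (zu - z)) + M * (l1n (yu - y) + l1n (zu - z)) * l1n (y - z)) * e ^+ 2
    + M * l1n (y - z) * e ^+ 3)).
Proof.
move=> hs s0 su ut tT p p' rho rho' e k0; have M0 := rs_M hs; have C0 := rd_C Hd.
have [w1 n1] := rd_w1 Hd (le_trans s0 su) ut tT.
have [w2 n2] := rd_w2 Hd (le_trans s0 su) ut tT.
have [w3 n3] := rd_w3 Hd s0 su ut tT.
have e0 : 0 <= e by exact: powR_ge0.
have eu : (t - u) `^ kap <= e by apply: ler_powRl; rewrite ?subr_ge0 // lerD2l lerN2.
pose ca j := taylor_coef p y yu j - taylor_coef p' z zu j.
pose cb j := (sig2_coef yu j - sig2_coef y j) - (sig2_coef zu j - sig2_coef z j).
pose cc j := sig2_coef y j - sig2_coef z j.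
have ha j a b : `|ca j a b| <= M * (2 * l1n p' + l1n p) * l1n (p - p')
    + 2 * M * l1n p' ^+ 2 * l1n (y - z)
    + (M * l1n (rho - rho') + M * (l1n rho + l1n rho') * (l1n (y - z) + l1n (p - p'))).
  by rewrite [X in `|X|]mxE [X in _ + X]mxE; exact: taylor_coefB_le.
have hc j a b : `|cc j a b| <= M * l1n (y - z) by exact: sig2_coefB_le.
have [wa na] := trp_wint mphi w1 ha.
have [wb nb] := trp_wint mphi w2 (fun j a b => sig2_coefBB_le y yu z zu j a b hs).
have [wc nc] := trp_wint mphi w3 hc.
have [wab nab] := mwintD mphi wa wb.
have [wabc nabc] := mwintB mphi wab wc.
rewrite (@eq_mwnorm _ _ _ _ _ (fun xi => trp (xt1 t u) ca xi + trp (xt2 t u) cb xi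
  - trp (xt3 t u s) cc xi)); last first.
  move=> xi _.
  have -> : trp (xt1 t u) ca xi = trv (xt1 t u xi) (taylor_coef (lead u s y) y yu)
    - trv (xt1 t u xi) (taylor_coef (lead u s z) z zu) by rewrite -trvBr.
  have -> : trp (xt2 t u) cb xi = trv (xt2 t u xi) (fun j => sig2_coef yu j - sig2_coef y j)
    - trv (xt2 t u xi) (fun j => sig2_coef zu j - sig2_coef z j) by rewrite -trvBr.
  have -> : trp (xt3 t u s) cc xi = trv (xt3 t u s xi) (sig2_coef y)
    - trv (xt3 t u s xi) (sig2_coef z) by rewrite -trvBr.
  rewrite /defect; do 6!move: (trv _ _) => ?.
  by apply/matrixP => i j; rewrite !mxE; ring.
apply: (le_trans nabc); apply: (le_trans (lerD nab (lexx _))).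
apply: (le_trans (lerD (lerD na nb) nc)).
rewrite -[X in X + _ <= _]mulrDr -[leLHS]mulrDr ler_wpM2l // [leRHS]mulrDr [X in _ <= X + _]mulrDr.
apply: lerD; last first.
  by rewrite [leRHS]mulrCA ler_wpM2l // mulr_ge0 // l1n_ge0.
apply: lerD; rewrite [leRHS]mulrCA ler_wpM2l //.
- rewrite !addr_ge0 // ?mulr_ge0 ?l1n_ge0 ?addr_ge0 ?mulr_ge0 ?l1n_ge0 ?exprn_ge0 ?l1n_ge0 //.
- by apply: (le_trans n1); rewrite ler_wpM2l.
- rewrite !addr_ge0 // ?mulr_ge0 ?l1n_ge0 ?addr_ge0 ?l1n_ge0 //.
- by apply: (le_trans n2); rewrite ler_wpM2l // lerXn2r ?nnegrE ?powR_ge0.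
Qed.

End Defect.

(** Linear time counts as second order since 2 kap <= 1; this places the contribution of the
    semigroup on a par with that of x2. *)
Lemma rough_time (R : realType) (T kap t s : R) : 0 < kap -> 2 * kap <= 1 -> 0 <= s -> s <= t -> t <= T ->
  t - s <= T `^ (1 - 2 * kap) * ((t - s) `^ kap) ^+ 2.
Proof.
move=> k0 k1 s0 st tT.
have h0 : 0 <= t - s by rewrite subr_ge0.
have hT : t - s <= T by clear -s0 tT; lra.
have k2 : 0 < 2 * kap by clear -k0; lra.
have := ler_powRr h0 hT k2 k1; rewrite powRr1 // => h; apply: (le_trans h).
by rewrite mulrC [2 * kap]mulrC powRrM powR_mulrn ?powR_ge0 // mulrC.
Qed.

(** * The one-step map on L1 and the expansion of the state it produces *)

Section Flow.
Variables (R : realType) (phi : R -> R).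
Hypothesis mphi : measurable_fun (`]0, +oo[ : set R) phi.
Variables (n d : nat).
Variables (xt1 : R -> R -> R -> 'M[R]_(1, n)) (xt2 : R -> R -> R -> 'M[R]_(n, n)).
Variables (xt3 : R -> R -> R -> R -> 'M[R]_(n, n)) (sigma : 'cV[R]_d -> 'M[R]_(n, d)).
Variable a0 : 'cV[R]_d.
Local Notation E := (@L1v R phi mphi d).
Local Notation nE := (@L1norm R phi mphi d).
Local Notation incr := (increment xt1 xt2 sigma).
Local Notation dfct := (defect phi xt1 xt2 xt3 sigma).
Local Notation lead := (lead phi xt1 sigma).

Definition state (g : R -> 'cV[R]_d) : 'cV[R]_d := a0 + phint phi g.

Definition flow (t s : R) (Y : E) : E :=
  toL1 mphi (fun xi => heat (t - s) (L1val Y) xi + incr t s (state (L1val Y)) xi).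

Lemma heatD (t s u : R) (g : R -> 'cV[R]_d) (xi : R) :
  heat (t - u) (heat (u - s) g) xi = heat (t - s) g xi.
Proof. by rewrite /heat scalerA -expRD; congr (expR _ *: _); ring. Qed.

Lemma heat_add (t : R) (f g : R -> 'cV[R]_d) (xi : R) :
  heat t (fun x => f x + g x) xi = heat t f xi + heat t g xi.
Proof. by rewrite /heat scalerDr. Qed.

Lemma increment_wint (T kap C M t s : R) y : rough_driver phi T kap xt1 xt2 xt3 C ->
  regular_sigma sigma M -> 0 <= s -> s <= t -> t <= T ->
  let e := (t - s) `^ kap in
  mwint phi (incr t s y) /\ mwnorm phi (incr t s y) <= d%:R * (M * (C * (e + e ^+ 2))).
Proof.
move=> Hd hs s0 st tT e; have M0 := rs_M hs.
have [w1 n1] := rd_w1 Hd s0 st tT; have [w2 n2] := rd_w2 Hd s0 st tT.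
have ha j a b : `|sig_coef sigma y j a b| <= M.
  by rewrite mxE; exact: (fp_bd (rs_four hs a j)).
have [wa na] := trp_wint mphi w1 ha.
have [wb nb] := trp_wint mphi w2 (fun j a b => fp_bd (rs_prod_four hs j a b) y).
have [wab nab] := mwintD mphi wa wb; split; first exact: wab.
apply: (le_trans nab); apply: (le_trans (lerD na nb)).
rewrite -[leLHS]mulrDr -[X in _ * X <= _]mulrDr ler_wpM2l // ler_wpM2l //.
by rewrite mulrDr lerD.
Qed.

Lemma increment_four (T kap C M t s : R) y y' z z' : rough_driver phi T kap xt1 xt2 xt3 C ->
  regular_sigma sigma M -> 0 <= s -> s <= t -> t <= T ->
  let e := (t - s) `^ kap in
  mwint phi (fun xi => (incr t s y xi - incr t s y' xi) - (incr t s z xi - incr t s z' xi)) /\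
  mwnorm phi (fun xi => (incr t s y xi - incr t s y' xi) - (incr t s z xi - incr t s z' xi)) <=
    d%:R * ((M * l1n (y - y' - (z - z')) + M * (l1n (y - y') + l1n (z - z')) * l1n (y - z))
     * (C * (e + e ^+ 2))).
Proof.
move=> Hd hs s0 st tT e; have M0 := rs_M hs.
have [w1 n1] := rd_w1 Hd s0 st tT; have [w2 n2] := rd_w2 Hd s0 st tT.
set B := M * _ + _.
have B0 : 0 <= B.
  by rewrite addr_ge0 // mulr_ge0 ?l1n_ge0 // mulr_ge0 // addr_ge0 // l1n_ge0.
pose ca j := (sig_coef sigma y j - sig_coef sigma y' j) - (sig_coef sigma z j - sig_coef sigma z' j).
pose cb j := (sig2_coef sigma y j - sig2_coef sigma y' j)
  - (sig2_coef sigma z j - sig2_coef sigma z' j).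
have ha j a b : `|ca j a b| <= B.
  by rewrite !mxE; exact: (fp_four (rs_four hs a j)).
have hb j a b : `|cb j a b| <= B.
  have := fp_four (rs_prod_four hs j a b) y y' z z'; rewrite -/B.
  by rewrite /cb /sig2_coef; move: (_ *m _) (_ *m _) (_ *m _) (_ *m _) => A1 A2 A3 A4; rewrite !mxE.
have [wa na] := trp_wint mphi w1 ha.
have [wb nb] := trp_wint mphi w2 hb.
have [wab nab] := mwintD mphi wa wb.
have Exi xi : trp (xt1 t s) ca xi + trp (xt2 t s) cb xi =
    (incr t s y xi - incr t s y' xi) - (incr t s z xi - incr t s z' xi).
  have -> : trp (xt1 t s) ca xi = (trv (xt1 t s xi) (sig_coef sigma y)
     - trv (xt1 t s xi) (sig_coef sigma y')) - (trv (xt1 t s xi) (sig_coef sigma z)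
     - trv (xt1 t s xi) (sig_coef sigma z')) by rewrite -!trvBr.
  have -> : trp (xt2 t s) cb xi = (trv (xt2 t s xi) (sig2_coef sigma y)
     - trv (xt2 t s xi) (sig2_coef sigma y')) - (trv (xt2 t s xi) (sig2_coef sigma z)
     - trv (xt2 t s xi) (sig2_coef sigma z')) by rewrite -!trvBr.
  rewrite /increment; do 8!move: (trv _ _) => ?.
  by apply/matrixP => i j; rewrite !mxE; ring.
split; first by apply: eq_mwint wab => xi _.
rewrite -(eq_mwnorm phi (fun xi _ => Exi xi)).
apply: (le_trans nab); apply: (le_trans (lerD na nb)).
rewrite -[leLHS]mulrDr -[X in _ * X <= _]mulrDr ler_wpM2l // ler_wpM2l //.
by rewrite mulrDr lerD.
Qed.

Lemma flowE (T kap C M t s : R) (Y : E) : rough_driver phi T kap xt1 xt2 xt3 C ->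
  regular_sigma sigma M -> 0 <= s -> s <= t -> t <= T ->
  L1val (flow t s Y) = fun xi => heat (t - s) (L1val Y) xi + incr t s (state (L1val Y)) xi.
Proof.
move=> Hd hs s0 st tT; rewrite /flow toL1K //.
have ts0 : 0 <= t - s by rewrite subr_ge0.
exact: (mwintD mphi (mwint_heat mphi ts0 (L1val_mwint Y)).1
  (increment_wint _ Hd hs s0 st tT).1).1.
Qed.

Lemma l1n_stateB (Y Z : E) : l1n (state (L1val Y) - state (L1val Z)) <= nE (Y - Z).
Proof.
rewrite /state opprD addrACA subrr add0r -(phintB mphi (L1val_mwint Y) (L1val_mwint Z)).
by rewrite /L1norm L1valB; apply: (l1n_phint mphi); exact: (mwintB mphi (L1val_mwint Y) (L1val_mwint Z)).1.
Qed.

(** This is the remainder r^y of a controlled path: the semigroup part and the second-order part of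
    the germ, integrated against [phi]. *)
Lemma flow_remainder (T kap C M u s : R) (Y : E) : rough_driver phi T kap xt1 xt2 xt3 C ->
  regular_sigma sigma M -> 0 <= s -> s <= u -> u <= T ->
  let y := state (L1val Y) in
  state (L1val (flow u s Y)) - y - lead u s y =
  phint phi (fun xi => heat (u - s) (L1val Y) xi - L1val Y xi)
    + trv (phint phi (xt2 u s)) (sig2_coef sigma y).
Proof.
move=> Hd hs s0 su uT y.
have us0 : 0 <= u - s by rewrite subr_ge0.
have [w1 _] := rd_w1 Hd s0 su uT; have [w2 _] := rd_w2 Hd s0 su uT.
have wY := L1val_mwint Y; have wh := (mwint_heat mphi us0 wY).1.
have wi := (increment_wint y Hd hs s0 su uT).1.
have M0 := rs_M hs.
have ha j a b : `|sig_coef sigma y j a b| <= M.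
  by rewrite mxE; exact: (fp_bd (rs_four hs a j)).
have wa := (trp_wint mphi w1 ha).1.
have wb := (trp_wint mphi w2 (fun j a b => fp_bd (rs_prod_four hs j a b) y)).1.
rewrite (flowE _ Hd hs s0 su uT) -/y /state phintD // phintB //.
have -> : phint phi (incr u s y) = lead u s y + trv (phint phi (xt2 u s)) (sig2_coef sigma y).
  rewrite (_ : incr u s y = fun xi => trp (xt1 u s) (sig_coef sigma y) xi
    + trp (xt2 u s) (sig2_coef sigma y) xi) //.
  by rewrite phintD // !trp_phint.
have yE : y = a0 + phint phi (L1val Y) by [].
rewrite [X in _ - X - lead _ _ _]yE.
move: (phint phi (heat _ _)) (phint phi (L1val Y)) (lead u s y) (trv _ _) => A B D F.
by apply/matrixP => i j; rewrite !mxE; ring.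
Qed.

(** The semigroup part is linear in [Y], hence the factor 1 + N(Y) in the third bound and, by
    linearity, the clean factor N(Y - Z) in the fourth. The bounds use t - s in place of u - s to
    combine directly with those of the defect. *)
Lemma flow_remainder_le (T kap C M t u s : R) (Y Z : E) : rough_driver phi T kap xt1 xt2 xt3 C ->
  regular_sigma sigma M -> 0 < kap -> 2 * kap <= 1 -> 0 <= s -> s <= u -> u <= t -> t <= T ->
  let y := state (L1val Y) in let z := state (L1val Z) in
  let rY := state (L1val (flow u s Y)) - y - lead u s y in
  let rZ := state (L1val (flow u s Z)) - z - lead u s z in
  let e := (t - s) `^ kap in let P := d%:R * (M * C) in let Q := P + T `^ (1 - 2 * kap) in
  [/\ l1n (lead u s y) <= P * e, l1n (lead u s y - lead u s z) <= P * e * nE (Y - Z),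
      l1n rY <= Q * e ^+ 2 * (1 + nE Y) & l1n (rY - rZ) <= Q * e ^+ 2 * nE (Y - Z)].
Proof.
move=> Hd hs k0 k1 s0 su ut tT y z rY rZ e P Q.
have uT := le_trans ut tT; have us0 : 0 <= u - s by rewrite subr_ge0.
have M0 := rs_M hs; have C0 := rd_C Hd.
have P0 : 0 <= P by rewrite !mulr_ge0.
have [w1 n1] := rd_w1 Hd s0 su uT; have [w2 n2] := rd_w2 Hd s0 su uT.
have e0 : 0 <= e by exact: powR_ge0.
have eu0 : 0 <= (u - s) `^ kap by exact: powR_ge0.
have eu : (u - s) `^ kap <= e by apply: ler_powRl; rewrite ?(ltW k0) // lerD2r.
have eu2 : ((u - s) `^ kap) ^+ 2 <= e ^+ 2 by rewrite lerXn2r ?nnegrE.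
have x1le : l1n (x1 phi xt1 u s) <= C * e.
  apply: (le_trans (l1n_phint mphi w1)); apply: (le_trans n1); exact: ler_wpM2l.
have x2le : l1n (phint phi (xt2 u s)) <= C * e ^+ 2.
  apply: (le_trans (l1n_phint mphi w2)); apply: (le_trans n2); exact: ler_wpM2l.
have tm : u - s <= T `^ (1 - 2 * kap) * e ^+ 2.
  by apply: (le_trans (rough_time k0 k1 s0 su uT)); rewrite ler_wpM2l ?powR_ge0.
have D0 := sn_ge0 (L1norm_seminorm mphi d).
have yz : l1n (y - z) <= nE (Y - Z) by exact: l1n_stateB.
have lip2 j a b : `|(sig2_coef sigma y j - sig2_coef sigma z j) a b| <= M * nE (Y - Z).
  by apply: (le_trans (sig2_coefB_le z y j a b hs)); rewrite ler_wpM2l.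
split.
- apply: (le_trans (lead_le phi xt1 u s y hs)).
  by rewrite -mulrA ler_wpM2l // -mulrA ler_wpM2l.
- apply: (le_trans (leadB_le phi xt1 u s y z hs)).
  have -> : P * e * nE (Y - Z) = d%:R * (M * nE (Y - Z) * (C * e)) by rewrite /P; ring.
  by rewrite ler_wpM2l // ler_pM ?mulr_ge0 ?l1n_ge0 // ler_wpM2l.
- rewrite /rY (flow_remainder _ Hd hs s0 su uT) -/y.
  apply: (le_trans (l1nD _ _)).
  have h1 := l1n_phint_heat mphi us0 (L1val_mwint Y).
  have h2 := l1n_trv (phint phi (xt2 u s)) (fun j a b => fp_bd (rs_prod_four hs j a b) y).
  have h3 : (u - s) * nE Y <= T `^ (1 - 2 * kap) * e ^+ 2 * nE Y by rewrite ler_wpM2r.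
  have h4 : d%:R * (M * l1n (phint phi (xt2 u s))) <= P * e ^+ 2.
    by rewrite /P -!mulrA ler_wpM2l // ler_wpM2l.
  apply: (le_trans (lerD (le_trans h1 h3) (le_trans h2 h4))).
  rewrite -subr_ge0.
  have -> : Q * e ^+ 2 * (1 + nE Y) - (T `^ (1 - 2 * kap) * e ^+ 2 * nE Y + P * e ^+ 2) =
    P * e ^+ 2 * nE Y + T `^ (1 - 2 * kap) * e ^+ 2 by rewrite /Q; ring.
  by rewrite addr_ge0 // !mulr_ge0 ?exprn_ge0 ?powR_ge0.
- rewrite /rY /rZ !(flow_remainder _ Hd hs s0 su uT) -/y -/z.
  have -> : phint phi (fun xi => heat (u - s) (L1val Y) xi - L1val Y xi)
      + trv (phint phi (xt2 u s)) (sig2_coef sigma y)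
    - (phint phi (fun xi => heat (u - s) (L1val Z) xi - L1val Z xi)
      + trv (phint phi (xt2 u s)) (sig2_coef sigma z)) =
    phint phi (fun xi => heat (u - s) (L1val (Y - Z)) xi - L1val (Y - Z) xi)
     + trv (phint phi (xt2 u s)) (fun j => sig2_coef sigma y j - sig2_coef sigma z j).
    rewrite trvBr opprD addrACA; congr (_ + _); rewrite -(phintB mphi).
    - apply: eq_phint => xi _; rewrite !L1valB /heat.
      by apply/matrixP => i j; rewrite !mxE; ring.
    - exact: (mwintB mphi (mwint_heat mphi us0 (L1val_mwint Y)).1 (L1val_mwint Y)).1.
    - exact: (mwintB mphi (mwint_heat mphi us0 (L1val_mwint Z)).1 (L1val_mwint Z)).1.
  apply: (le_trans (l1nD _ _)).
  have h1 := l1n_phint_heat mphi us0 (L1val_mwint (Y - Z)).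
  have h2 := l1n_trv (phint phi (xt2 u s)) lip2.
  have h3 : (u - s) * nE (Y - Z) <= T `^ (1 - 2 * kap) * e ^+ 2 * nE (Y - Z) by rewrite ler_wpM2r.
  have h4 : d%:R * (M * nE (Y - Z) * l1n (phint phi (xt2 u s))) <= P * e ^+ 2 * nE (Y - Z).
    have -> : P * e ^+ 2 * nE (Y - Z) = d%:R * (M * nE (Y - Z) * (C * e ^+ 2)) by rewrite /P; ring.
    by rewrite ler_wpM2l // ler_wpM2l // mulr_ge0.
  apply: (le_trans (lerD (le_trans h1 h3) (le_trans h2 h4))).
  by rewrite le_eqVlt /Q; apply/orP; left; apply/eqP; ring.
Qed.

End Flow.

(** * The one-step scheme is an almost flow *)

(** Counting of orders: after inserting the sizes, every term is a multiple of [e ^+ 3], and the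
    difference of the two sides is an explicit nonnegative polynomial. *)
Lemma defect_arith (R : realType) (M P Q W e a S lp lr lpr : R) :
  0 <= M -> 0 <= P -> 0 <= Q -> 0 <= W -> 0 <= e -> 0 <= a -> S = 1 + a ->
  0 <= lp -> lp <= P * e -> lr <= Q * e ^+ 2 * S -> lpr <= W * e * S ->
  (M * lp ^+ 2 + M * lr) * e + M * lpr * e ^+ 2 + M * e ^+ 3
    <= M * (P ^+ 2 + Q + W + 1) * S * e ^+ 3.
Proof.
move=> M0 P0 Q0 W0 e0 a0 SE lp0 hp hr hpr.
have Pe0 : 0 <= P * e by rewrite mulr_ge0.
have h1 : M * lp ^+ 2 <= M * (P * e) ^+ 2 by rewrite ler_wpM2l // lerXn2r ?nnegrE.
have h2 : M * lr <= M * (Q * e ^+ 2 * S) by rewrite ler_wpM2l.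
have h3 : M * lpr <= M * (W * e * S) by rewrite ler_wpM2l.
have h4 := ler_wpM2r e0 (lerD h1 h2).
have h5 := ler_wpM2r (exprn_ge0 2 e0) h3.
apply: (le_trans (lerD (lerD h4 h5) (lexx _))); rewrite -subr_ge0.
have -> : M * (P ^+ 2 + Q + W + 1) * S * e ^+ 3 - ((M * (P * e) ^+ 2 +
   M * (Q * e ^+ 2 * S)) * e + M * (W * e * S) * e ^+ 2 + M * e ^+ 3) =
   M * (P ^+ 2 + 1) * e ^+ 3 * a by rewrite SE; ring.
by rewrite mulr_ge0 // mulr_ge0 ?exprn_ge0 // mulr_ge0 // addr_ge0 // exprn_ge0.
Qed.

(** The same count for the difference of two defects; every term has exactly one factor [N], the
    distance of the states, and at most one factor [S], their size. *)
Lemma defectB_arith (R : realType) (M P Q W V e a S N lp lp' lpp lr lr' lrr lD lq lq' lqq : R) :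
  0 <= M -> 0 <= P -> 0 <= Q -> 0 <= W -> 0 <= V -> 0 <= e -> 0 <= a -> S = 1 + a -> 0 <= N ->
  0 <= lp -> 0 <= lp' -> 0 <= lpp -> 0 <= lr -> 0 <= lr' -> 0 <= lD -> 0 <= lq -> 0 <= lq' ->
  lp <= P * e -> lp' <= P * e -> lpp <= P * e * N ->
  lr <= Q * e ^+ 2 * S -> lr' <= Q * e ^+ 2 * S -> lrr <= Q * e ^+ 2 * N ->
  lD <= N -> lD + lpp <= V * N -> lq <= W * e * S -> lq' <= W * e * S -> lqq <= W * e * N ->
  (M * (2 * lp' + lp) * lpp + 2 * M * lp' ^+ 2 * lD + (M * lrr + M * (lr + lr') * (lD + lpp))) * e
    + (M * lqq + M * (lq + lq') * lD) * e ^+ 2 + M * lD * e ^+ 3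
  <= M * (5 * P ^+ 2 + Q + 2 * Q * V + 3 * W + 1) * S * N * e ^+ 3.
Proof.
move=> M0 P0 Q0 W0 V0 e0 a0 SE N0 lp0 lp'0 lpp0 lr0 lr'0 lD0 lq0 lq'0.
move=> hp hp' hpp hr hr' hrr hD hV hq hq' hqq.
have Pe0 : 0 <= P * e by rewrite mulr_ge0.
have h1 : M * (2 * lp' + lp) * lpp <= M * (2 * (P * e) + P * e) * (P * e * N).
  apply: ler_pM => //; first by rewrite mulr_ge0 // addr_ge0 // mulr_ge0.
  by rewrite ler_wpM2l // lerD // ler_wpM2l.
have h2 : 2 * M * lp' ^+ 2 * lD <= 2 * M * (P * e) ^+ 2 * N.
  apply: ler_pM => //; first by rewrite mulr_ge0 ?exprn_ge0 // mulr_ge0.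
  by rewrite ler_wpM2l ?lerXn2r ?nnegrE // mulr_ge0.
have h3 : M * lrr <= M * (Q * e ^+ 2 * N) by rewrite ler_wpM2l.
have h4 : M * (lr + lr') * (lD + lpp) <= M * (Q * e ^+ 2 * S + Q * e ^+ 2 * S) * (V * N).
  apply: ler_pM => //; [by rewrite mulr_ge0 // addr_ge0|by rewrite addr_ge0|].
  by rewrite ler_wpM2l // lerD.
have h5 : M * lqq <= M * (W * e * N) by rewrite ler_wpM2l.
have h6 : M * (lq + lq') * lD <= M * (W * e * S + W * e * S) * N.
  apply: ler_pM => //; first by rewrite mulr_ge0 // addr_ge0.
  by rewrite ler_wpM2l // lerD.
have h7 : M * lD * e ^+ 3 <= M * N * e ^+ 3 by rewrite ler_wpM2r ?exprn_ge0 // ler_wpM2l.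
have h8 := ler_wpM2r e0 (lerD (lerD h1 h2) (lerD h3 h4)).
have h9 := ler_wpM2r (exprn_ge0 2 e0) (lerD h5 h6).
apply: (le_trans (lerD (lerD h8 h9) h7)); rewrite -subr_ge0.
set L := (X in 0 <= X).
have -> : L = M * (5 * P ^+ 2 + Q + W + 1) * N * e ^+ 3 * a by rewrite /L SE; ring.
rewrite mulr_ge0 // mulr_ge0 ?exprn_ge0 // mulr_ge0 // mulr_ge0 // !addr_ge0 //.
by rewrite mulr_ge0 ?exprn_ge0.
Qed.

(** The four-point axiom has the power of time on its linear term only; in the quadratic term [e] is
    bounded by [E0]. *)
Lemma four_arith (R : realType) (N M C e E0 A B D a b c K : R) :
  0 <= N -> 0 <= M -> 0 <= C -> 0 <= e -> 0 <= E0 -> 0 <= A -> 0 <= B -> 0 <= D ->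
  0 <= a -> 0 <= b -> 0 <= c -> a <= A -> b <= B -> c <= D ->
  e + e ^+ 2 <= (1 + E0) * e -> e <= E0 ->
  N * (M * C) * (1 + E0) <= K -> N * (M * C) * (1 + E0) * E0 <= K ->
  N * ((M * a + M * b * c) * (C * (e + e ^+ 2))) <= K * e * A + K * B * D.
Proof.
move=> N0 M0 C0 e0 E00 A0 B0 D0 a0 b0 c0 aA bB cD he eE K1 K2.
have BD0 : 0 <= B * D by exact: mulr_ge0.
have h1 : M * a + M * b * c <= M * (A + B * D).
  by rewrite -mulrA -mulrDr ler_wpM2l // lerD // ler_pM.
have h2 : C * (e + e ^+ 2) <= C * ((1 + E0) * e) by rewrite ler_wpM2l.
have h3 : N * ((M * a + M * b * c) * (C * (e + e ^+ 2)))
    <= N * (M * (A + B * D) * (C * ((1 + E0) * e))).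
  rewrite ler_wpM2l // ler_pM //; last by rewrite mulr_ge0 // addr_ge0 // exprn_ge0.
  by rewrite addr_ge0 // mulr_ge0 // mulr_ge0.
apply: (le_trans h3).
have -> : N * (M * (A + B * D) * (C * ((1 + E0) * e))) =
  N * (M * C) * (1 + E0) * e * A + N * (M * C) * (1 + E0) * e * (B * D) by ring.
rewrite -[K * B * D]mulrA; apply: lerD.
  by rewrite ler_wpM2r // ler_wpM2r.
rewrite ler_wpM2r //; apply: le_trans K2; rewrite ler_wpM2l // mulr_ge0 ?mulr_ge0 //.
by rewrite addr_ge0.
Qed.

Section FlowIsAlmostFlow.
Variables (R : realType) (phi : R -> R).
Hypothesis mphi : measurable_fun (`]0, +oo[ : set R) phi.
Variables (n d : nat).
Variables (xt1 : R -> R -> R -> 'M[R]_(1, n)) (xt2 : R -> R -> R -> 'M[R]_(n, n)).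
Variables (xt3 : R -> R -> R -> R -> 'M[R]_(n, n)) (sigma : 'cV[R]_d -> 'M[R]_(n, d)).
Variable a0 : 'cV[R]_d.
Local Notation E := (@L1v R phi mphi d).
Local Notation nE := (@L1norm R phi mphi d).
Local Notation incr := (increment xt1 xt2 sigma).
Local Notation dfct := (defect phi xt1 xt2 xt3 sigma).
Local Notation lead := (lead phi xt1 sigma).
Local Notation state := (state phi a0).
Local Notation flow := (flow (mphi := mphi) xt1 xt2 sigma a0).

(** The states enter through equations between plain functions, so the algebra is done away from the
    subtype of integrable functions. *)
Lemma one_step_defect (T kap C M t u s : R) (f g h Y : R -> 'cV[R]_d) y yu (xi : R) :
  rough_driver phi T kap xt1 xt2 xt3 C ->
  regular_sigma sigma M -> 0 <= s -> s <= u -> u <= t -> t <= T -> 0 <= xi ->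
  f = (fun xi => heat (t - u) g xi + incr t u yu xi) ->
  h = (fun xi => heat (t - s) Y xi + incr t s y xi) ->
  g = (fun xi => heat (u - s) Y xi + incr u s y xi) ->
  f xi - h xi = dfct t u s y yu xi.
Proof.
move=> Hd hs s0 su ut tT xi0 -> -> ->; cbv beta.
rewrite heat_add heatD -(increment_defect sigma Hd y yu s0 su ut tT xi0).
move: (heat _ Y xi) (heat _ (incr u s y) xi) (incr t u yu xi) (incr t s y xi) => A B D F.
by apply/matrixP => i j; rewrite !mxE; ring.
Qed.

Lemma flow_defect (T kap C M t u s : R) (Y : E) (xi : R) : rough_driver phi T kap xt1 xt2 xt3 C ->
  regular_sigma sigma M -> 0 <= s -> s <= u -> u <= t -> t <= T -> 0 <= xi ->
  L1val (flow t u (flow u s Y) - flow t s Y) xi =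
  dfct t u s (state (L1val Y)) (state (L1val (flow u s Y))) xi.
Proof.
move=> Hd hs s0 su ut tT xi0; rewrite L1valB.
exact: (one_step_defect Hd hs s0 su ut tT xi0
  (flowE a0 (flow u s Y) Hd hs (le_trans s0 su) ut tT)
  (flowE a0 Y Hd hs s0 (le_trans su ut) tT)
  (flowE a0 Y Hd hs s0 su (le_trans ut tT))).
Qed.

Lemma flow_defectB (T kap C M t u s : R) (Y Z : E) (xi : R) :
  rough_driver phi T kap xt1 xt2 xt3 C ->
  regular_sigma sigma M -> 0 <= s -> s <= u -> u <= t -> t <= T -> 0 <= xi ->
  L1val ((flow t u (flow u s Y) - flow t s Y) - (flow t u (flow u s Z) - flow t s Z)) xi =
  dfct t u s (state (L1val Y)) (state (L1val (flow u s Y))) xi -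
  dfct t u s (state (L1val Z)) (state (L1val (flow u s Z))) xi.
Proof.
move=> Hd hs s0 su ut tT xi0; rewrite L1valB.
exact: (congr2 (fun a b => a - b) (flow_defect Y Hd hs s0 su ut tT xi0)
  (flow_defect Z Hd hs s0 su ut tT xi0)).
Qed.

Lemma heat_four (h : R) (f1 f2 f3 f4 b1 b2 b3 b4 g1 g2 g3 g4 : R -> 'cV[R]_d) (xi : R) :
  f1 = (fun xi => heat h b1 xi + g1 xi) -> f2 = (fun xi => heat h b2 xi + g2 xi) ->
  f3 = (fun xi => heat h b3 xi + g3 xi) -> f4 = (fun xi => heat h b4 xi + g4 xi) ->
  f1 xi - f2 xi - (f3 xi - f4 xi) =
  heat h (fun xi => b1 xi - b2 xi - (b3 xi - b4 xi)) xi + (g1 xi - g2 xi - (g3 xi - g4 xi)).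
Proof.
by move=> -> -> -> ->; rewrite /heat; apply/matrixP => i j; rewrite !mxE; ring.
Qed.

Lemma L1val_four (Y Y' Z Z' : E) : L1val (Y - Y' - (Z - Z')) =
  fun xi => L1val Y xi - L1val Y' xi - (L1val Z xi - L1val Z' xi).
Proof. by rewrite !L1valB. Qed.

Lemma flow_four (T kap C M t s : R) (Y Y' Z Z' : E) (xi : R) :
  rough_driver phi T kap xt1 xt2 xt3 C ->
  regular_sigma sigma M -> 0 <= s -> s <= t -> t <= T ->
  L1val (flow t s Y - flow t s Y' - (flow t s Z - flow t s Z')) xi =
  heat (t - s) (L1val (Y - Y' - (Z - Z'))) xi +
  (incr t s (state (L1val Y)) xi - incr t s (state (L1val Y')) xi
   - (incr t s (state (L1val Z)) xi - incr t s (state (L1val Z')) xi)).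
Proof.
move=> Hd hs s0 st tT; rewrite L1val_four [in RHS]L1val_four.
exact: (heat_four xi (flowE a0 Y Hd hs s0 st tT) (flowE a0 Y' Hd hs s0 st tT)
  (flowE a0 Z Hd hs s0 st tT) (flowE a0 Z' Hd hs s0 st tT)).
Qed.

(** [a] will be N(Y) + N(Z) and [D] the distance N(Y - Z). The displacements of y are recovered from
    lead plus remainder, with one factor [e] of the remainder bounded by [E0]. *)
Lemma defectB_step (T kap C M t u s P Q E0 a D : R) y z yu zu :
  rough_driver phi T kap xt1 xt2 xt3 C ->
  regular_sigma sigma M -> 0 <= s -> s <= u -> u <= t -> t <= T -> 0 <= kap ->
  0 <= P -> 0 <= Q -> 0 <= E0 -> let e := (t - s) `^ kap in e <= E0 -> 0 <= a -> 0 <= D ->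
  let py := lead u s y in let pz := lead u s z in
  l1n py <= P * e -> l1n pz <= P * e -> l1n (py - pz) <= P * e * D ->
  l1n (yu - y - py) <= Q * e ^+ 2 * (1 + a) -> l1n (zu - z - pz) <= Q * e ^+ 2 * (1 + a) ->
  l1n (yu - y - py - (zu - z - pz)) <= Q * e ^+ 2 * D -> l1n (y - z) <= D ->
  mwnorm phi (fun xi => dfct t u s y yu xi - dfct t u s z zu xi) <=
    d%:R * (C * (M * (5 * P ^+ 2 + Q + 2 * Q * (1 + P * E0) + 3 * (P + Q * E0) + 1)
     * (1 + a) * D * e ^+ 3)).
Proof.
move=> Hd hs s0 su ut tT k0 P0 Q0 E00 e eE0 a0' D0 py pz b1 c1 b2 b3 c3 b4 yz.
have M0 := rs_M hs; have C0 := rd_C Hd.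
have e0 : 0 <= e := powR_ge0 _ _.
have PE0 : 0 <= P * E0 := mulr_ge0 P0 E00; have QE0 : 0 <= Q * E0 := mulr_ge0 Q0 E00.
have W0 : 0 <= P + Q * E0 by exact: addr_ge0.
have V0 : 0 <= 1 + P * E0 by exact: addr_ge0.
have S0 : 0 <= 1 + a by exact: addr_ge0.
have PeS : 0 <= P * e * a by apply: mulr_ge0 => //; exact: mulr_ge0.
have QeS x : 0 <= x -> 0 <= Q * e * x * (E0 - e).
  by move=> x0; rewrite mulr_ge0 ?subr_ge0 // mulr_ge0 // mulr_ge0.
have hW x r : x <= P * e -> r <= Q * e ^+ 2 * (1 + a) -> r + x <= (P + Q * E0) * e * (1 + a).
  move=> hx hr; apply: (le_trans (lerD hr hx)); rewrite -subr_ge0.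
  have -> : (P + Q * E0) * e * (1 + a) - (Q * e ^+ 2 * (1 + a) + P * e) =
    P * e * a + Q * e * (1 + a) * (E0 - e) by ring.
  exact: addr_ge0 PeS (QeS _ S0).
have q1 : l1n (yu - y) <= (P + Q * E0) * e * (1 + a).
  by rewrite -(subrK py (yu - y)); apply: (le_trans (l1nD _ _)); exact: hW.
have q2 : l1n (zu - z) <= (P + Q * E0) * e * (1 + a).
  by rewrite -(subrK pz (zu - z)); apply: (le_trans (l1nD _ _)); exact: hW.
have q3 : l1n (yu - y - (zu - z)) <= (P + Q * E0) * e * D.
  have -> : yu - y - (zu - z) = (yu - y - py - (zu - z - pz)) + (py - pz).
    by apply/matrixP => i j; rewrite !mxE; ring.
  apply: (le_trans (l1nD _ _)); apply: (le_trans (lerD b4 b2)); rewrite -subr_ge0.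
  have -> : (P + Q * E0) * e * D - (Q * e ^+ 2 * D + P * e * D) = Q * e * D * (E0 - e) by ring.
  exact: QeS.
have hV : l1n (y - z) + l1n (py - pz) <= (1 + P * E0) * D.
  apply: (le_trans (lerD yz b2)); rewrite mulrDl mul1r lerD2l.
  by rewrite ler_wpM2r // ler_wpM2l.
have hA := defectB_arith M0 P0 Q0 W0 V0 e0 a0' erefl D0 (l1n_ge0 _) (l1n_ge0 _) (l1n_ge0 _)
  (l1n_ge0 _) (l1n_ge0 _) (l1n_ge0 _) (l1n_ge0 _) (l1n_ge0 _) b1 c1 b2 b3 c3 b4 yz hV q1 q2 q3.
apply: (le_trans (defectB_wint mphi Hd y yu z zu hs s0 su ut tT k0)).
exact: (ler_wpM2l (ler0n R d) (ler_wpM2l C0 hA)).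
Qed.

Lemma flow_almost_flow (T kap C M : R) : rough_driver phi T kap xt1 xt2 xt3 C ->
  regular_sigma sigma M -> 0 < T -> 1 / 3 < kap -> kap < 1 / 2 ->
  exists K, almost_flow nE T kap (3 * kap) K flow.
Proof.
move=> Hd hs T0 k3 k2; have M0 := rs_M hs; have C0 := rd_C Hd.
have k0 : 0 < kap by apply: lt_trans k3; rewrite divr_gt0.
have k21 : 2 * kap <= 1 by rewrite mulrC -ler_pdivlMr // ltW.
(* [P] bounds the leading increments, [Q] the second-order remainders, [E0] all powers (t-s)^kap,
   [W] the displacement of the state and [V] the distance of base points together with leads; [K1]
   serves growth and four points, [K2] the defects. *)
pose P := d%:R * (M * C); pose Q := P + T `^ (1 - 2 * kap).
pose E0 := T `^ kap; pose W := P + Q * E0; pose V := 1 + P * E0.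
pose K1 := P * (1 + E0).
pose K2 := d%:R * C * (M * (5 * P ^+ 2 + Q + 2 * Q * V + 3 * W + 1)).
have E00 : 0 <= E0 := powR_ge0 _ _.
have P0 : 0 <= P by rewrite !mulr_ge0.
have Q0 : 0 <= Q by rewrite addr_ge0 // powR_ge0.
have W0 : 0 <= W by rewrite addr_ge0 // mulr_ge0.
have V0 : 0 <= V by rewrite addr_ge0 // mulr_ge0.
have K10 : 0 <= K1 by rewrite mulr_ge0 // addr_ge0.
have K20 : 0 <= K2.
  apply: mulr_ge0; first by apply: mulr_ge0.
  apply: mulr_ge0 => //; apply: addr_ge0 => //; apply: addr_ge0; last exact: mulr_ge0.
  apply: addr_ge0; last by apply: mulr_ge0 => //; exact: mulr_ge0.
  by apply: addr_ge0 => //; apply: mulr_ge0 => //; exact: exprn_ge0.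
have K1E : 0 <= K1 * E0 by rewrite mulr_ge0.
pose K := K1 + K1 * E0 + K2.
have K1K : K1 <= K by apply: (@le_trans _ _ (K1 + K1 * E0)); rewrite lerDl.
have K1EK : K1 * E0 <= K by apply: (@le_trans _ _ (K1 + K1 * E0)); [rewrite lerDr|rewrite lerDl].
have K2K : K2 <= K by rewrite lerDr; exact: addr_ge0.
have K0 : 0 <= K by exact: le_trans K1K.
have HN := L1norm_seminorm mphi d.
have eE t s : 0 <= s -> s <= t -> t <= T -> (t - s) `^ kap <= E0.
  move=> s0 st tT; apply: ler_powRl; rewrite ?(ltW k0) ?subr_ge0 //.
  by rewrite lerBlDr (le_trans tT) // lerDl.
have e2 (e : R) : 0 <= e -> e <= E0 -> e + e ^+ 2 <= (1 + E0) * e.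
  by move=> e0 ee; rewrite mulrDl mul1r lerD2l expr2 ler_wpM2r.
have cube t s : ((t - s) `^ kap) ^+ 3 = (t - s) `^ (3 * kap) :> R.
  by rewrite -powR_mulrn ?powR_ge0 // -powRrM mulrC.
exists K; split=> //.
- by rewrite mulrC -ltr_pdivrMr.
- move=> t Y t0 tT.
  have [w h] := increment_wint mphi (state (L1val Y)) Hd hs t0 (lexx t) tT.
  apply/eqP; rewrite eq_le (sn_ge0 HN) andbT.
  rewrite /L1norm L1valB (flowE _ _ Hd hs t0 (lexx t) tT).
  rewrite (@eq_mwnorm _ _ _ _ _ (incr t t (state (L1val Y)))); last first.
    move=> xi _; rewrite /heat subrr mulr0 expR0 scale1r addrAC subrr add0r //.
  apply: (le_trans h); rewrite subrr powR0 ?gt_eqF // expr0n /= addr0 !mulr0 //.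
- move=> t s Y s0 st tT.
  have ts0 : 0 <= t - s by rewrite subr_ge0.
  have [w1 h1] := mwint_heat mphi ts0 (L1val_mwint Y).
  have [w2 h2] := increment_wint mphi (state (L1val Y)) Hd hs s0 st tT.
  rewrite {1}/L1norm (flowE _ _ Hd hs s0 st tT).
  apply: (le_trans (mwintD mphi w1 w2).2); apply: lerD => //; apply: (le_trans h2).
  have e0 : 0 <= (t - s) `^ kap by exact: powR_ge0.
  have h3 := e2 _ e0 (eE t s s0 st tT).
  have -> : d%:R * (M * (C * ((t - s) `^ kap + (t - s) `^ kap ^+ 2))) =
    P * ((t - s) `^ kap + (t - s) `^ kap ^+ 2) by rewrite /P; ring.
  apply: (le_trans (ler_wpM2l P0 h3)); rewrite mulrA -/K1.
  by rewrite ler_wpM2r.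
- move=> t s Y Y' Z Z' s0 st tT.
  have ts0 : 0 <= t - s by rewrite subr_ge0.
  set y := state (L1val Y); set y' := state (L1val Y').
  set z := state (L1val Z); set z' := state (L1val Z').
  have wD := L1val_mwint (Y - Y' - (Z - Z')).
  have [w1 h1] := mwint_heat mphi ts0 wD.
  have [w2 h2] := increment_four mphi y y' z z' Hd hs s0 st tT.
  rewrite {1}/L1norm (@eq_mwnorm _ _ _ _ _ (fun xi => heat (t - s) (L1val (Y - Y' - (Z - Z'))) xi
    + ((incr t s y xi - incr t s y' xi) - (incr t s z xi - incr t s z' xi)))); last first.
    by move=> xi _; exact: (flow_four Y Y' Z Z' xi Hd hs s0 st tT).
  apply: (le_trans (mwintD mphi w1 w2).2); apply: (le_trans (lerD h1 h2)).
  have ny : l1n (y - y') <= nE (Y - Y') by exact: l1n_stateB.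
  have nz : l1n (z - z') <= nE (Z - Z') by exact: l1n_stateB.
  have nyz : l1n (y - z) <= nE (Y - Z) by exact: l1n_stateB.
  have nyy : l1n (y - y' - (z - z')) <= nE (Y - Y' - (Z - Z')).
    have -> : y - y' - (z - z') = phint phi (L1val (Y - Y' - (Z - Z'))).
      rewrite L1valB (phintB mphi (L1val_mwint _) (L1val_mwint _)) !L1valB.
      rewrite !(phintB mphi (L1val_mwint _) (L1val_mwint _)) /y /y' /z /z' /state.
      by move: (phint _ _) (phint _ _) (phint _ _) (phint _ _) => A1 A2 A3 A4;
        apply/matrixP => i j; rewrite !mxE; ring.
    exact: (l1n_phint mphi wD).
  set e := (t - s) `^ kap.
  have e0 : 0 <= e by exact: powR_ge0.
  have eE0 : e <= E0 by exact: eE.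
  have h3 := e2 _ e0 eE0.
  set A := nE (Y - Y' - _) in nyy *; set B1 := nE (Y - Y') in ny *.
  set B2 := nE (Z - Z') in nz *; set D := nE (Y - Z) in nyz *.
  have A0 : 0 <= A by exact: sn_ge0 HN _.
  have B10 : 0 <= B1 by exact: sn_ge0 HN _.
  have B20 : 0 <= B2 by exact: sn_ge0 HN _.
  have D0 : 0 <= D by exact: sn_ge0 HN _.
  have B0 : 0 <= B1 + B2 := addr_ge0 B10 B20.
  have b0 : 0 <= l1n (y - y') + l1n (z - z') := addr_ge0 (l1n_ge0 _) (l1n_ge0 _).
  have -> : (1 + K * e) * A + K * (B1 + B2) * D = A + (K * e * A + K * (B1 + B2) * D).
    by rewrite addrA [(1 + _) * A]mulrDl mul1r.
  rewrite lerD2l; exact: (four_arith (ler0n R d) M0 C0 e0 E00 A0 B0 D0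
    (l1n_ge0 _) b0 (l1n_ge0 _) nyy (lerD ny nz) nyz h3 eE0 K1K K1EK).
- move=> t u s Y s0 su ut tT.
  have st := le_trans su ut; have uT := le_trans ut tT.
  rewrite {1}/L1norm (eq_mwnorm phi (fun xi xi0 => flow_defect Y Hd hs s0 su ut tT xi0)).
  have [w h] := defect_wint mphi Hd (state (L1val Y)) (state (L1val (flow u s Y))) hs s0 su ut tT (ltW k0).
  have [b1 _ b3 _] := flow_remainder_le a0 Y Y Hd hs k0 k21 s0 su ut tT.
  apply: (le_trans h); rewrite -cube.
  have e0 : 0 <= (t - s) `^ kap by exact: powR_ge0.
  have eE0 := eE t s s0 st tT.
  have nY := sn_ge0 HN Y.
  have S0 : 0 <= 1 + nE Y by rewrite addr_ge0.
  have b4 : l1n (state (L1val (flow u s Y)) - state (L1val Y)) <= W * (t - s) `^ kap * (1 + nE Y).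
    rewrite -(subrK (lead u s (state (L1val Y))) (_ - state (L1val Y))).
    apply: (le_trans (l1nD _ _)); apply: (le_trans (lerD b3 b1)).
    rewrite -/P -/Q /W -subr_ge0.
    set e := (t - s) `^ kap in e0 eE0 *.
    have -> : (P + Q * E0) * e * (1 + nE Y) - (Q * e ^+ 2 * (1 + nE Y) + P * e) =
      P * e * nE Y + Q * e * (1 + nE Y) * (E0 - e) by ring.
    by rewrite addr_ge0 // ?mulr_ge0 // subr_ge0.
  have hA := defect_arith M0 P0 Q0 W0 e0 nY (erefl _) (l1n_ge0 _) b1 b3 b4.
  apply: (le_trans (ler_wpM2l (ler0n R d) (ler_wpM2l C0 hA))).
  set e3 := _ ^+ 3; have e30 : 0 <= e3 by rewrite exprn_ge0.
  have -> : d%:R * (C * (M * (P ^+ 2 + Q + W + 1) * (1 + nE Y) * e3)) =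
     d%:R * C * (M * (P ^+ 2 + Q + W + 1)) * (1 + nE Y) * e3 by ring.
  rewrite ler_wpM2r // ler_wpM2r //; apply: le_trans K2K.
  rewrite /K2 ler_wpM2l ?mulr_ge0 // ler_wpM2l //.
  rewrite -subr_ge0.
  have -> : 5 * P ^+ 2 + Q + 2 * Q * V + 3 * W + 1 - (P ^+ 2 + Q + W + 1) =
    4 * P ^+ 2 + 2 * Q * V + 2 * W by ring.
  by rewrite !addr_ge0 // ?mulr_ge0 ?exprn_ge0.
- move=> t u s Y Z s0 su ut tT.
  have st := le_trans su ut; have uT := le_trans ut tT.
  rewrite {1}/L1norm (eq_mwnorm phi (fun xi xi0 => flow_defectB Y Z Hd hs s0 su ut tT xi0)).
  have [b1 b2 b3 b4] := flow_remainder_le a0 Y Z Hd hs k0 k21 s0 su ut tT.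
  have [c1 _ c3 _] := flow_remainder_le a0 Z Z Hd hs k0 k21 s0 su ut tT.
  have e0 : 0 <= (t - s) `^ kap by exact: powR_ge0.
  have eE0 := eE t s s0 st tT.
  have nY := sn_ge0 HN Y; have nZ := sn_ge0 HN Z; have nD := sn_ge0 HN (Y - Z).
  have nYZ : 0 <= nE Y + nE Z := addr_ge0 nY nZ.
  have Qe0 : 0 <= Q * ((t - s) `^ kap) ^+ 2 := mulr_ge0 Q0 (exprn_ge0 2 e0).
  have wl : 1 + nE Y <= 1 + (nE Y + nE Z) by rewrite lerD2l lerDl.
  have wr : 1 + nE Z <= 1 + (nE Y + nE Z) by rewrite lerD2l lerDr.
  have h := defectB_step Hd hs s0 su ut tT (ltW k0) P0 Q0 E00 eE0 nYZ nD b1 c1 b2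
    (le_trans b3 (ler_wpM2l Qe0 wl)) (le_trans c3 (ler_wpM2l Qe0 wr)) b4 (l1n_stateB a0 Y Z).
  apply: (le_trans h); rewrite -cube {h b1 b2 b3 b4 c1 c3}.
  move: (_ `^ kap) e0 (nE (Y - Z)) nD (nE Y) (nE Z) nYZ {eE0 Qe0 wl wr nY nZ}
    => e e0 D D0 a b ab0.
  rewrite -/W -/V.
  have -> : d%:R * (C * (M * (5 * P ^+ 2 + Q + 2 * Q * V + 3 * W + 1) * (1 + (a + b)) *
     D * e ^+ 3)) = K2 * (1 + a + b) * D * e ^+ 3 by rewrite /K2; ring.
  rewrite ler_wpM2r ?exprn_ge0 // ler_wpM2r // ler_wpM2r // -addrA.
  exact: addr_ge0.
Qed.

End FlowIsAlmostFlow.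

(** * Paths of Davie type *)

(** A germ whose convolutional defect is of order 3 kap > 1; neither bound involves the state. *)
Record sewable (R : realType) (phi : R -> R) (T kap C : R) (d : nat)
    (B : R -> R -> R -> 'cV[R]_d) : Prop := {
  sw_C : 0 <= C ;
  sw_w : forall t s, 0 <= s -> s <= t -> t <= T ->
    mwint phi (B t s) /\ mwnorm phi (B t s) <= C * (t - s) `^ kap ;
  sw_defect : forall t u s, 0 <= s -> s <= u -> u <= t -> t <= T ->
    mwnorm phi (fun xi => B t u xi + heat (t - u) (B u s) xi - B t s xi)
      <= C * (t - s) `^ (3 * kap) }.

(** The exponent [a] is kept apart from 3 kap because a path built from [Lambda] comes with an
    unspecified exponent above 1. *)
Record davie (R : realType) (phi : R -> R) (T : R) (d : nat) (B : R -> R -> R -> 'cV[R]_d)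
    (f : R -> R -> 'cV[R]_d) (K a : R) : Prop := {
  dv_w : forall t, 0 <= t -> t <= T -> mwint phi (f t) ;
  dv_le : forall t s, 0 <= s -> s <= t -> t <= T ->
    mwnorm phi (fun xi => f t xi - heat (t - s) (f s) xi - B t s xi) <= K * (t - s) `^ a }.

Section Sewing.
Variables (R : realType) (phi : R -> R).
Hypothesis mphi : measurable_fun (`]0, +oo[ : set R) phi.
Variables (d : nat) (B : R -> R -> R -> 'cV[R]_d).
Local Notation E := (@L1v R phi mphi d).
Local Notation nE := (@L1norm R phi mphi d).

(** The affine one-step map of a germ: its defect is the same for all states, so almost-flow theory
    reduces to sewing. *)
Definition sew (t s : R) (Y : E) : E := toL1 mphi (fun xi => heat (t - s) (L1val Y) xi + B t s xi).

Lemma sewE (T kap C t s : R) (Y : E) : sewable phi T kap C B -> 0 <= s -> s <= t -> t <= T ->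
  L1val (sew t s Y) = fun xi => heat (t - s) (L1val Y) xi + B t s xi.
Proof.
move=> Hs s0 st tT; rewrite /sew toL1K //.
have ts0 : 0 <= t - s by rewrite subr_ge0.
exact: (mwintD mphi (mwint_heat mphi ts0 (L1val_mwint Y)).1 (sw_w Hs s0 st tT).1).1.
Qed.

Lemma one_step_sew (t u s : R) (f g h Y : R -> 'cV[R]_d) (xi : R) :
  f = (fun xi => heat (t - u) g xi + B t u xi) ->
  h = (fun xi => heat (t - s) Y xi + B t s xi) ->
  g = (fun xi => heat (u - s) Y xi + B u s xi) ->
  f xi - h xi = B t u xi + heat (t - u) (B u s) xi - B t s xi.
Proof.
move=> -> -> ->; rewrite heat_add heatD.
move: (heat _ Y xi) (heat _ (B u s) xi) => A D.
by apply/matrixP => i j; rewrite !mxE; ring.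
Qed.

Lemma sew_defect (T kap C t u s : R) (Y : E) (xi : R) : sewable phi T kap C B ->
  0 <= s -> s <= u -> u <= t -> t <= T ->
  L1val (sew t u (sew u s Y) - sew t s Y) xi = B t u xi + heat (t - u) (B u s) xi - B t s xi.
Proof.
move=> Hs s0 su ut tT; rewrite L1valB.
exact: (one_step_sew xi (sewE (sew u s Y) Hs (le_trans s0 su) ut tT)
  (sewE Y Hs s0 (le_trans su ut) tT) (sewE Y Hs s0 su (le_trans ut tT))).
Qed.

Lemma sew_defectB (T kap C t u s : R) (Y Z : E) (xi : R) : sewable phi T kap C B ->
  0 <= s -> s <= u -> u <= t -> t <= T ->
  L1val ((sew t u (sew u s Y) - sew t s Y) - (sew t u (sew u s Z) - sew t s Z)) xi = 0.
Proof.
move=> Hs s0 su ut tT; rewrite L1valB.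
apply: etrans (congr2 (fun a b => a - b) (sew_defect Y xi Hs s0 su ut tT)
  (sew_defect Z xi Hs s0 su ut tT)) _.
exact: subrr.
Qed.

Lemma sew_four (T kap C t s : R) (Y Y' Z Z' : E) (xi : R) :
  sewable phi T kap C B -> 0 <= s -> s <= t -> t <= T ->
  L1val (sew t s Y - sew t s Y' - (sew t s Z - sew t s Z')) xi =
  heat (t - s) (L1val (Y - Y' - (Z - Z'))) xi.
Proof.
move=> Hs s0 st tT; rewrite L1val_four [in RHS]L1val_four.
apply: etrans (heat_four xi (sewE Y Hs s0 st tT) (sewE Y' Hs s0 st tT)
  (sewE Z Hs s0 st tT) (sewE Z' Hs s0 st tT)) _.
by rewrite !subrr addr0.
Qed.

Lemma sew_almost_flow (T kap C : R) : sewable phi T kap C B -> 0 < T -> 1 / 3 < kap ->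
  almost_flow nE T kap (3 * kap) C sew.
Proof.
move=> Hs T0 k3; have C0 := sw_C Hs.
have k0 : 0 < kap by apply: lt_trans k3; rewrite divr_gt0.
have HN := L1norm_seminorm mphi d.
split=> //.
- by rewrite mulrC -ltr_pdivrMr.
- move=> t Y t0 tT; have [w h] := sw_w Hs t0 (lexx t) tT.
  apply/eqP; rewrite eq_le (sn_ge0 HN) andbT.
  rewrite /L1norm L1valB (sewE _ Hs t0 (lexx t) tT).
  rewrite (@eq_mwnorm _ _ _ _ _ (B t t)); last first.
    by move=> xi _; rewrite /heat subrr mulr0 expR0 scale1r addrAC subrr add0r.
  by apply: (le_trans h); rewrite subrr powR0 ?gt_eqF // mulr0.
- move=> t s Y s0 st tT; have [w2 h2] := sw_w Hs s0 st tT.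
  have ts0 : 0 <= t - s by rewrite subr_ge0.
  have [w1 h1] := mwint_heat mphi ts0 (L1val_mwint Y).
  rewrite {1}/L1norm (sewE _ Hs s0 st tT).
  by apply: (le_trans (mwintD mphi w1 w2).2); exact: lerD.
- move=> t s Y Y' Z Z' s0 st tT.
  have ts0 : 0 <= t - s by rewrite subr_ge0.
  have [w1 h1] := mwint_heat mphi ts0 (L1val_mwint (Y - Y' - (Z - Z'))).
  rewrite {1}/L1norm (eq_mwnorm phi (fun xi xi0 => sew_four Y Y' Z Z' xi Hs s0 st tT)).
  apply: (le_trans h1); rewrite -/(nE _).
  move: (sn_ge0 HN (Y - Y' - (Z - Z'))) (addr_ge0 (sn_ge0 HN (Y - Y')) (sn_ge0 HN (Z - Z')))
    (sn_ge0 HN (Y - Z)); move: (nE _) (nE _ + nE _) (nE _) => A D F A0 D0 F0.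
  rewrite mulrDl mul1r -addrA lerDl addr_ge0 // mulr_ge0 // mulr_ge0 ?powR_ge0 //.
- move=> t u s Y s0 su ut tT.
  rewrite {1}/L1norm (eq_mwnorm phi (fun xi xi0 => sew_defect Y xi Hs s0 su ut tT)).
  apply: (le_trans (sw_defect Hs s0 su ut tT)); rewrite ler_wpM2r ?powR_ge0 //.
  by rewrite ler_peMr // lerDl (sn_ge0 HN).
- move=> t u s Y Z s0 su ut tT.
  rewrite {1}/L1norm (eq_mwnorm phi (fun xi xi0 => sew_defectB Y Z xi Hs s0 su ut tT)).
  rewrite (mwint0 phi d 1).2; apply: mulr_ge0; last exact: powR_ge0.
  apply: mulr_ge0; last exact: (sn_ge0 HN).
  apply: mulr_ge0 => //; apply: addr_ge0; last exact: (sn_ge0 HN).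
  by apply: addr_ge0; last exact: (sn_ge0 HN).
Qed.

Lemma L1norm_toL1 (f g : R -> 'cV[R]_d) (Y : E) : mwint phi f -> L1val Y = g ->
  nE (toL1 mphi f - Y) = mwnorm phi (fun xi => f xi - g xi).
Proof. by move=> wf Yg; rewrite /L1norm L1valB toL1K // Yg. Qed.

Lemma subrD2 (V : zmodType) (a b c : V) : a - (b + c) = a - b - c.
Proof. by rewrite opprD addrA. Qed.

Lemma davie_sew (T kap C K a : R) (f : R -> R -> 'cV[R]_d) : sewable phi T kap C B ->
  davie phi T B f K a -> forall t s, 0 <= s -> s <= t -> t <= T ->
  nE (toL1 mphi (f t) - sew t s (toL1 mphi (f s))) <= K * (t - s) `^ a.
Proof.
move=> Hs Hf t s s0 st tT.
have t0 := le_trans s0 st; have sT := le_trans st tT.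
rewrite (L1norm_toL1 (dv_w Hf t0 tT) (sewE (toL1 mphi (f s)) Hs s0 st tT)).
rewrite (toL1K mphi (dv_w Hf s0 sT)).
rewrite (@eq_mwnorm _ _ _ _ _ (fun xi => f t xi - heat (t - s) (f s) xi - B t s xi)).
  exact: (dv_le Hf).
by move=> xi _; exact: subrD2.
Qed.

(** Allows two paths with different exponents and constants to be compared at common ones. *)
Lemma davieW (T K K' a a' : R) (f : R -> R -> 'cV[R]_d) : davie phi T B f K a -> 0 <= K ->
  0 < a' -> a' <= a -> K * T `^ (a - a') <= K' -> davie phi T B f K' a'.
Proof.
move=> Hf K0 a'0 aa KK; split; first exact: (dv_w Hf).
move=> t s s0 st tT; apply: (le_trans (dv_le Hf s0 st tT)).
have ts0 : 0 <= t - s by rewrite subr_ge0.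
have tsT : t - s <= T by rewrite lerBlDr (le_trans tT) // lerDl.
apply: (le_trans (ler_wpM2l K0 (ler_powRr ts0 tsT a'0 aa))).
by rewrite mulrA ler_wpM2r // powR_ge0.
Qed.

Lemma davie_unique (T kap C K a : R) (f g : R -> R -> 'cV[R]_d) :
  sewable phi T kap C B -> 0 < T -> 1 / 3 < kap -> 1 < a -> a <= 3 * kap ->
  davie phi T B f K a -> davie phi T B g K a ->
  mwnorm phi (fun xi => f 0 xi - g 0 xi) = 0 ->
  forall t, 0 <= t -> t <= T -> mwnorm phi (fun xi => f t xi - g t xi) = 0.
Proof.
move=> Hs T0 k3 a1 ak Hf Hg fg0 t t0 tT.
have nfg t' : 0 <= t' -> t' <= T -> nE (toL1 mphi (f t') - toL1 mphi (g t')) =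
    mwnorm phi (fun xi => f t' xi - g t' xi).
  by move=> ? ?; rewrite (L1norm_toL1 (dv_w Hf _ _) (toL1K mphi (dv_w Hg _ _))).
rewrite -nfg //.
apply: (almost_flow_unique (L1norm_seminorm mphi d) (sew_almost_flow Hs T0 k3) a1 ak
  (davie_sew Hs Hf) (davie_sew Hs Hg)) => //.
by rewrite nfg // ltW.
Qed.

(** Existence half of the convolutional sewing map: for such an [f], the remainder [dtil1 f - B] is
    of order 3 kap and has the prescribed image under [dtil2]. *)
Lemma davie_exists (T kap C : R) : sewable phi T kap C B -> 0 < T -> 1 / 3 < kap ->
  exists f M, [/\ 0 <= M, mwnorm phi (f 0) = 0 & davie phi T B f M (3 * kap)].
Proof.
move=> Hs T0 k3.
have [Y [M [M0 Y0 hY]]] := almost_flow_exists (L1norm_seminorm mphi d)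
  (sew_almost_flow Hs T0 k3) (L1norm_complete mphi d) 0.
exists (fun t => L1val (Y t)), M; split=> //; first by rewrite subr0 in Y0.
split=> [t _ _|t s s0 st tT]; first exact: L1val_mwint.
apply: le_trans (hY t s s0 st tT).
rewrite /L1norm L1valB (sewE _ Hs s0 st tT) le_eqVlt; apply/orP; left; apply/eqP.
by apply: eq_mwnorm => xi _; rewrite subrD2.
Qed.

End Sewing.

(** * Paths of the nonlinear one-step scheme *)

Section RoughDavie.
Variables (R : realType) (phi : R -> R).
Hypothesis mphi : measurable_fun (`]0, +oo[ : set R) phi.
Variables (n d : nat).
Variables (xt1 : R -> R -> R -> 'M[R]_(1, n)) (xt2 : R -> R -> R -> 'M[R]_(n, n)).
Variables (xt3 : R -> R -> R -> R -> 'M[R]_(n, n)) (sigma : 'cV[R]_d -> 'M[R]_(n, d)).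
Variable a0 : 'cV[R]_d.
Local Notation E := (@L1v R phi mphi d).
Local Notation nE := (@L1norm R phi mphi d).
Local Notation incr := (increment xt1 xt2 sigma).
Local Notation state := (state phi a0).
Local Notation flow := (flow (mphi := mphi) xt1 xt2 sigma a0).

(** Freezing the path y turns the nonlinear scheme into a germ; a solution is a path that is of
    Davie type for the germ built from its own state. *)
Definition path_incr (y : R -> 'cV[R]_d) : R -> R -> R -> 'cV[R]_d := fun t s => incr t s (y s).

Lemma davie_flow (T kap C M K a : R) (f : R -> R -> 'cV[R]_d) :
  rough_driver phi T kap xt1 xt2 xt3 C -> regular_sigma sigma M ->
  davie phi T (path_incr (fun s => state (f s))) f K a ->
  forall t s, 0 <= s -> s <= t -> t <= T ->
  nE (toL1 mphi (f t) - flow t s (toL1 mphi (f s))) <= K * (t - s) `^ a.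
Proof.
move=> Hd hs Hf t s s0 st tT.
have t0 := le_trans s0 st; have sT := le_trans st tT.
rewrite (L1norm_toL1 (dv_w Hf t0 tT) (flowE a0 (toL1 mphi (f s)) Hd hs s0 st tT)).
rewrite (toL1K mphi (dv_w Hf s0 sT)).
rewrite (@eq_mwnorm _ _ _ _ _ (fun xi => f t xi - heat (t - s) (f s) xi
  - path_incr (fun s => state (f s)) t s xi)).
  exact: (dv_le Hf).
by move=> xi _; exact: subrD2.
Qed.

Lemma davie_flow_unique (T kap C M K a : R) (f g : R -> R -> 'cV[R]_d) :
  rough_driver phi T kap xt1 xt2 xt3 C -> regular_sigma sigma M -> 0 < T ->
  1 / 3 < kap -> kap < 1 / 2 -> 1 < a -> a <= 3 * kap ->
  davie phi T (path_incr (fun s => state (f s))) f K a ->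
  davie phi T (path_incr (fun s => state (g s))) g K a ->
  mwnorm phi (fun xi => f 0 xi - g 0 xi) = 0 ->
  forall t, 0 <= t -> t <= T -> mwnorm phi (fun xi => f t xi - g t xi) = 0.
Proof.
move=> Hd hs T0 k3 k2 a1 ak Hf Hg fg0 t t0 tT.
have [K' Hfl] := flow_almost_flow mphi a0 Hd hs T0 k3 k2.
have nfg t' : 0 <= t' -> t' <= T -> nE (toL1 mphi (f t') - toL1 mphi (g t')) =
    mwnorm phi (fun xi => f t' xi - g t' xi).
  by move=> ? ?; rewrite (L1norm_toL1 (dv_w Hf _ _) (toL1K mphi (dv_w Hg _ _))).
rewrite -nfg //.
apply: (almost_flow_unique (L1norm_seminorm mphi d) Hfl a1 ak
  (davie_flow Hd hs Hf) (davie_flow Hd hs Hg)) => //.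
by rewrite nfg // ltW.
Qed.

Lemma davie_flow_exists (T kap C M : R) :
  rough_driver phi T kap xt1 xt2 xt3 C -> regular_sigma sigma M -> 0 < T ->
  1 / 3 < kap -> kap < 1 / 2 ->
  exists f K, [/\ 0 <= K, mwnorm phi (f 0) = 0 &
    davie phi T (path_incr (fun s => state (f s))) f K (3 * kap)].
Proof.
move=> Hd hs T0 k3 k2.
have [K' Hfl] := flow_almost_flow mphi a0 Hd hs T0 k3 k2.
have [Y [K [K0 Y0 hY]]] := almost_flow_exists (L1norm_seminorm mphi d)
  Hfl (L1norm_complete mphi d) 0.
exists (fun t => L1val (Y t)), K; split=> //; first by rewrite subr0 in Y0.
split=> [t _ _|t s s0 st tT]; first exact: L1val_mwint.
apply: le_trans (hY t s s0 st tT).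
rewrite /L1norm L1valB (flowE a0 (Y s) Hd hs s0 st tT) le_eqVlt; apply/orP; left; apply/eqP.
by apply: eq_mwnorm => xi _; exact: (esym (subrD2 _ _ _)).
Qed.

End RoughDavie.

(** * Continuity in L1 *)

Section MwConv.
Variables (R : realType) (phi : R -> R).
Hypothesis mphi : measurable_fun (`]0, +oo[ : set R) phi.

(** The smaller time factors out of the difference and acts as a contraction, reducing continuity at
    any time to continuity at 0. *)
Lemma heat_dist p q (h k : R) (b : R -> 'M[R]_(p, q)) : 0 <= h -> 0 <= k -> mwint phi b ->
  mwnorm phi (fun xi => heat h b xi - heat k b xi) <= mwnorm phi (fun xi => heat `|h - k| b xi - b xi).
Proof.
wlog hk : h k / h <= k.
  move=> H h0 k0 wb; have [|/ltW] := leP h k => hk; first exact: H.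
  rewrite distrC; apply: le_trans (H k h hk k0 h0 wb).
  have E xi : heat h b xi - heat k b xi = - (heat k b xi - heat h b xi) by rewrite opprB.
  have w := mwintB mphi (mwint_heat mphi k0 wb).1 (mwint_heat mphi h0 wb).1.
  by rewrite (eq_mwnorm phi (fun xi _ => E xi)) (mwintN mphi w.1).2.
move=> h0 k0 wb; have kh : 0 <= k - h by rewrite subr_ge0.
have w := (mwintB mphi (mwint_heat mphi kh wb).1 wb).1.
have [wn n1] := mwintN mphi (mwint_heat mphi h0 w).1.
rewrite distrC (ger0_norm kh); apply: le_trans (mwint_heat mphi h0 w).2.
rewrite -n1 le_eqVlt; apply/orP; left; apply/eqP; apply: eq_mwnorm => xi _.
rewrite /heat (_ : - xi * k = - xi * h + - xi * (k - h)); last by ring.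
by rewrite expRD scalerBr scalerA opprB.
Qed.

Lemma mwnorm_lt p q (f : R -> 'M[R]_(p, q)) (e : R) : 0 < e ->
  (forall i j, wnorm phi (fun x => f x i j) < e / (p * q).+1%:R) -> mwnorm phi f < e.
Proof.
move=> e0 hf.
have : mwnorm phi f <= \sum_(i < p) \sum_(j < q) e / (p * q).+1%:R.
  by apply: ler_sum => i _; apply: ler_sum => j _; exact: ltW.
rewrite !sumr_const !card_ord -mulrnA mulnC -[leRHS]mulr_natl => h; apply: le_lt_trans h _.
by rewrite mulrA ltr_pdivrMr // mulrC ltr_pM2l // ltr_nat.
Qed.

Lemma heat_near p q (f : R -> 'M[R]_(p, q)) (e : R) : mwint phi f -> 0 < e ->
  \forall h \near (0 : R), 0 <= h -> mwnorm phi (fun xi => heat h f xi - f xi) < e.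
Proof.
move=> wf e0.
have e'0 : 0 < e / (p * q).+1%:R by rewrite divr_gt0.
have hf i j : nbhs (0 : R) [set h | 0 <= h ->
    wnorm phi (fun xi => (heat h f xi - f xi) i j) < e / (p * q).+1%:R].
  have [dl dl0 hd] := heat_small mphi (wf i j) e'0.
  exists dl => // h /=; rewrite sub0r normrN => hdl h0.
  have [w1 h1] := hd h h0 (le_lt_trans (ler_norm h) hdl).
  rewrite (_ : wnorm phi _ = wnorm phi (fun x => - ((1 - expR (- x * h)) * f x i j))).
    by rewrite (wintN mphi w1).2.
  by apply: eq_wnorm => x _; rewrite !mxE; ring.
have FF := nbhs_filter (0 : R).
apply: filterS (filter_forall FF (fun i => filter_forall FF (hf i))) => h hh h0.
by apply: mwnorm_lt => // i j; exact: hh.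
Qed.

Section Filter.
Variables (X : Type) (F : set_system X).
Hypothesis FF : Filter F.

(** Eventual membership in L1 is part of the notion, since [mwnorm] takes meaningless values on
    other functions. *)
Definition mwconv p q (B : X -> R -> 'M[R]_(p, q)) (b : R -> 'M[R]_(p, q)) :=
  mwint phi b /\ forall e : R, 0 < e ->
    F [set x | mwint phi (B x) /\ mwnorm phi (fun xi => B x xi - b xi) < e].

Definition rconv (a : X -> R) (l : R) := forall e : R, 0 < e -> F [set x | `|a x - l| < e].

Lemma mwconvD p q (B B' : X -> R -> 'M[R]_(p, q)) b b' : mwconv B b -> mwconv B' b' ->
  mwconv (fun x xi => B x xi + B' x xi) (fun xi => b xi + b' xi).
Proof.
move=> [wb hb] [wb' hb']; split; first exact: (mwintD mphi wb wb').1.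
move=> e e0; have e20 : 0 < e / 2 by rewrite divr_gt0.
apply: filterS2 (hb _ e20) (hb' _ e20) => x [w1 h1] [w2 h2].
split; first exact: (mwintD mphi w1 w2).1.
have [_ h3] := mwintD mphi (mwintB mphi w1 wb).1 (mwintB mphi w2 wb').1.
rewrite (splitr e); apply: le_lt_trans (ltrD h1 h2); apply: le_trans h3.
rewrite le_eqVlt; apply/orP; left; apply/eqP; apply: eq_mwnorm => xi _.
by rewrite opprD addrACA.
Qed.

Lemma mwconvN p q (B : X -> R -> 'M[R]_(p, q)) b : mwconv B b ->
  mwconv (fun x xi => - B x xi) (fun xi => - b xi).
Proof.
move=> [wb hb]; split; first exact: (mwintN mphi wb).1.
move=> e e0; apply: filterS (hb _ e0) => x [w1 h1]; split; first exact: (mwintN mphi w1).1.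
apply: le_lt_trans h1; rewrite -(mwintN mphi (mwintB mphi w1 wb).1).2.
rewrite le_eqVlt; apply/orP; left; apply/eqP; apply: eq_mwnorm => xi _.
by rewrite opprB opprK addrC.
Qed.

Lemma mwconvB p q (B B' : X -> R -> 'M[R]_(p, q)) b b' : mwconv B b -> mwconv B' b' ->
  mwconv (fun x xi => B x xi - B' x xi) (fun xi => b xi - b' xi).
Proof. by move=> h h'; exact: mwconvD h (mwconvN h'). Qed.

Lemma eq_mwconv p q (B B' : X -> R -> 'M[R]_(p, q)) b b' :
  F [set x | forall xi, 0 <= xi -> B x xi = B' x xi] -> (forall xi, 0 <= xi -> b xi = b' xi) ->
  mwconv B b -> mwconv B' b'.
Proof.
move=> hB bb [wb hb]; split; first exact: eq_mwint wb.
move=> e e0; apply: filterS2 hB (hb _ e0) => x E [w h]; split; first exact: eq_mwint w.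
by rewrite -(eq_mwnorm phi (f := fun xi => B x xi - b xi)) // => xi xi0; rewrite E // bb.
Qed.

(** Only strong continuity is available: the contraction bound handles B - b, and the time is varied
    on the fixed limit [b]. *)
Lemma mwconv_heat p q (h : X -> R) h0 (B : X -> R -> 'M[R]_(p, q)) b :
  0 <= h0 -> F [set x | 0 <= h x] -> rconv h h0 -> mwconv B b ->
  mwconv (fun x => heat (h x) (B x)) (heat h0 b).
Proof.
move=> h00 hp hc [wb hb]; split; first exact: (mwint_heat mphi h00 wb).1.
move=> e e0; have e20 : 0 < e / 2 by rewrite divr_gt0.
have [dl dl0 hdl] := heat_near wb e20.
apply: filterS3 hp (hc _ dl0) (hb _ e20) => x hx0 hxd [w h1].
have [w2 h2] := mwint_heat mphi hx0 (mwintB mphi w wb).1.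
split; first exact: (mwint_heat mphi hx0 w).1.
have w3 := (mwintB mphi (mwint_heat mphi hx0 wb).1 (mwint_heat mphi h00 wb).1).1.
have h3 : mwnorm phi (fun xi => heat (h x) b xi - heat h0 b xi) < e / 2.
  apply: (le_lt_trans (heat_dist hx0 h00 wb)); apply: hdl => //=.
  by rewrite sub0r normrN normr_id.
rewrite (splitr e); apply: le_lt_trans (ltrD (le_lt_trans h2 h1) h3).
apply: le_trans (mwintD mphi w2 w3).2.
rewrite le_eqVlt; apply/orP; left; apply/eqP; apply: eq_mwnorm => xi _.
by rewrite /heat scalerBr addrA subrK.
Qed.

Lemma mwconv_trp p q d (A : X -> R -> 'M[R]_(p, q)) a (c : X -> 'I_d -> 'M[R]_(q, p)) (c0 : 'I_d -> 'M[R]_(q, p)) (K : R) :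
  0 <= K -> (forall x j k l, `|c x j k l| <= K) ->
  (forall j k l, rconv (fun x => c x j k l) (c0 j k l)) -> mwconv A a ->
  mwconv (fun x => trp (A x) (c x)) (trp a c0).
Proof.
move=> K0 cK hc [wa ha].
have [m hm] : exists m, forall j k l, `|c0 j k l| <= m.
  exists (\sum_j \sum_k \sum_l `|c0 j k l|) => j k l.
  rewrite (bigD1 j) //= (bigD1 k) //= (bigD1 l) //= -!addrA lerDl.
  by rewrite !addr_ge0 // ?sumr_ge0 // => *; rewrite ?sumr_ge0 // => *; rewrite ?sumr_ge0.
split; first exact: (trp_wint mphi wa hm).1.
move=> e e0; have e20 : 0 < e / 2 by rewrite divr_gt0.
pose e1 := e / 2 / (d%:R * K + 1); pose e2 := e / 2 / (d%:R * mwnorm phi a + 1).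
have D1 : 0 < d%:R * K + 1 by rewrite ltr_wpDl // mulr_ge0.
have D2 : 0 < d%:R * mwnorm phi a + 1 by rewrite ltr_wpDl // mulr_ge0 // mwnorm_ge0.
have e10 : 0 < e1 by rewrite divr_gt0.
have e220 : 0 < e2 by rewrite divr_gt0.
have hcc : F [set x | forall j k l, `|c x j k l - c0 j k l| < e2].
  exact: filter_forall FF (fun j => filter_forall FF (fun k =>
    filter_forall FF (fun l => hc j k l _ e220))).
apply: filterS2 hcc (ha _ e10) => x h1 [w h2].
split; first exact: (trp_wint mphi w (cK x)).1.
have [w1 n1] := trp_wint mphi (mwintB mphi w wa).1 (cK x).
have hd j k l : `|(c x j - c0 j) k l| <= e2 by rewrite !mxE; exact: ltW.
have [w2 n2] := trp_wint mphi wa hd.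
have E xi : trp (A x) (c x) xi - trp a c0 xi =
    trp (fun xi => A x xi - a xi) (c x) xi + trp a (fun j => c x j - c0 j) xi.
  apply/matrixP => j k; rewrite !mxE.
  rewrite mulmxBl mulmxBr !raddfB /=.
  move: (\tr _) (\tr _) (\tr _) => u v w'; ring.
rewrite (eq_mwnorm phi (fun xi _ => E xi)) (splitr e).
apply: (le_lt_trans (mwintD mphi w1 w2).2); apply: ltrD; [apply: (le_lt_trans n1)|apply: (le_lt_trans n2)].
  rewrite mulrA; apply: (@le_lt_trans _ _ (d%:R * K * e1)).
    by rewrite ler_wpM2l ?mulr_ge0 // ltW.
  by rewrite /e1 mulrCA gtr_pMr // ltr_pdivrMr // mul1r ltrDl.
have -> : d%:R * (e2 * mwnorm phi a) = e / 2 * (d%:R * mwnorm phi a / (d%:R * mwnorm phi a + 1)).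
  by rewrite /e2; ring.
by rewrite gtr_pMr // ltr_pdivrMr // mul1r ltrDl.
Qed.

End Filter.

Lemma mwconv_comp X Y (F : set_system X) (G : set_system Y) (h : Y -> X) p q
    (B : X -> R -> 'M[R]_(p, q)) b :
  (forall A, F A -> G (h @^-1` A)) -> mwconv F B b -> mwconv G (fun y => B (h y)) b.
Proof. by move=> FG [wb hb]; split=> // e e0; exact: (FG _ (hb e e0)). Qed.

(** Neighbourhoods relative to [0,T], and below relative to the simplex, shaped so that [tC1] and
    [tC2] become filter convergence. *)
Definition near1 (T t : R) : set_system R := [set A | exists2 dl : R, 0 < dl &
  forall t', 0 <= t' <= T -> `|t' - t| < dl -> A t'].

Definition near2 (T t s : R) : set_system (R * R) := [set A | exists2 dl : R, 0 < dl &
  forall t' s', 0 <= s' <= t' -> t' <= T -> `|t' - t| < dl -> `|s' - s| < dl -> A (t', s')].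

Lemma near2_filter T t s : Filter (near2 T t s).
Proof.
split; first by exists 1.
- move=> A B [d1 d10 h1] [d2 d20 h2]; exists (Num.min d1 d2); first by rewrite lt_min d10.
  by move=> t' s' hs ht; rewrite !lt_min => /andP[? ?] /andP[? ?]; split; [exact: h1|exact: h2].
- by move=> A B AB [dl dl0 h]; exists dl => // t' s' hs ht hd hd'; apply: AB; exact: h.
Qed.

Lemma near2_fst T t s A : near1 T t A -> near2 T t s (fst @^-1` A).
Proof.
move=> [dl dl0 h]; exists dl => // t' s' /andP[s0 st] tT ht _; apply: h => //.
by rewrite (le_trans s0 st).
Qed.

Lemma near2_snd T t s A : near1 T s A -> near2 T t s (snd @^-1` A).
Proof.
move=> [dl dl0 h]; exists dl => // t' s' /andP[s0 st] tT _ ht; apply: h => //.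
by rewrite s0 (le_trans st tT).
Qed.

Definition mwc1 T p q (f : R -> R -> 'M[R]_(p, q)) :=
  forall t, 0 <= t <= T -> mwconv (near1 T t) f (f t).
Definition mwc2 T p q (B : R -> R -> R -> 'M[R]_(p, q)) :=
  forall t s, 0 <= s <= t -> t <= T -> mwconv (near2 T t s) (fun x => B x.1 x.2) (B t s).

Lemma NL1_small p q (f : R -> 'M[R]_(p, q)) (e : R) : mwint phi f -> 0 < e ->
  (NL1 phi f < (e / (p * q).+1%:R)%:E)%E -> mwnorm phi f < e.
Proof.
move=> wf e0 h; apply: (le_lt_trans (mwnorm_le mphi wf (ltW h))).
by rewrite mulrCA gtr_pMr // ltr_pdivrMr // mul1r ltr_nat.
Qed.

Lemma tC1P T p q (f : R -> R -> 'M[R]_(p, q)) : tC1 phi T f <-> mwc1 T f.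
Proof.
split=> [[h1 h2] t ht|h].
  have w t' : 0 <= t' <= T -> mwint phi (f t') by move=> ht'; apply/(inL1_mwint mphi); exact: h1.
  split; first exact: w.
  move=> e e0; have [|dl dl0 hd] := h2 t ht (e / (p * q).+1%:R); first by rewrite divr_gt0.
  exists dl => // t' ht' htd; split; first exact: w.
  by apply: NL1_small; [|by []|]; [exact: (mwintB mphi (w _ ht') (w _ ht)).1|exact: hd].
split=> [t ht|t ht e e0]; first by apply/(inL1_mwint mphi); exact: (h t ht).1.
have [wt hc] := h t ht; have [dl dl0 hd] := hc e e0.
exists dl => // t' ht' htd; have [w' h'] := hd t' ht' htd.
by apply: (le_lt_trans (NL1_le mphi (mwintB mphi w' wt).1)); rewrite lte_fin.
Qed.

Lemma tC2P T p q (B : R -> R -> R -> 'M[R]_(p, q)) : tC2 phi T B <-> mwc2 T B.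
Proof.
split=> [[h1 h2] t s hs ht|h].
  have w t' s' : 0 <= s' <= t' -> t' <= T -> mwint phi (B t' s').
    by move=> hs' ht'; apply/(inL1_mwint mphi); exact: h1.
  split; first exact: w.
  move=> e e0; have [|dl dl0 hd] := h2 t s hs ht (e / (p * q).+1%:R); first by rewrite divr_gt0.
  exists dl => // t' s' hs' ht' htd hsd; split; first exact: w.
  by apply: NL1_small; [|by []|]; [exact: (mwintB mphi (w _ _ hs' ht') (w _ _ hs ht)).1|exact: hd].
split=> [t s hs ht|t s hs ht e e0]; first by apply/(inL1_mwint mphi); exact: (h t s hs ht).1.
have [wt hc] := h t s hs ht; have [dl dl0 hd] := hc e e0.
exists dl => // t' s' hs' ht' htd hsd; have [w' h'] := hd t' s' hs' ht' htd hsd.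
by apply: (le_lt_trans (NL1_le mphi (mwintB mphi w' wt).1)); rewrite lte_fin.
Qed.

Lemma eq_mwc2 T p q (B B' : R -> R -> R -> 'M[R]_(p, q)) :
  (forall t s xi, 0 <= s <= t -> t <= T -> 0 <= xi -> B t s xi = B' t s xi) -> mwc2 T B -> mwc2 T B'.
Proof.
move=> E h t s hs ht; apply: eq_mwconv (h t s hs ht).
- exact: near2_filter.
- by exists 1 => // t' s' hs' ht' _ _ xi xi0; exact: E.
- by move=> xi xi0; exact: E.
Qed.

Lemma mwc2B T p q (B B' : R -> R -> R -> 'M[R]_(p, q)) : mwc2 T B -> mwc2 T B' ->
  mwc2 T (fun t s xi => B t s xi - B' t s xi).
Proof.
by move=> h h' t s hs ht; apply: (mwconvB (near2_filter T t s) (h t s hs ht) (h' t s hs ht)).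
Qed.

Lemma mwc2D T p q (B B' : R -> R -> R -> 'M[R]_(p, q)) : mwc2 T B -> mwc2 T B' ->
  mwc2 T (fun t s xi => B t s xi + B' t s xi).
Proof.
by move=> h h' t s hs ht; apply: (mwconvD (near2_filter T t s) (h t s hs ht) (h' t s hs ht)).
Qed.

Lemma mwc2_dtil1 T p q (f : R -> R -> 'M[R]_(p, q)) : mwc1 T f -> mwc2 T (dtil1 f).
Proof.
move=> h t s hs ht; have FF := near2_filter T t s; have /andP[s0 st] := hs.
have t0 := le_trans s0 st; have sT := le_trans st ht.
have h1 : mwconv (near2 T t s) (fun x => f x.1) (f t).
  by apply: mwconv_comp (@near2_fst T t s) _; apply: h; rewrite t0.
have h2 : mwconv (near2 T t s) (fun x => f x.2) (f s).
  by apply: mwconv_comp (@near2_snd T t s) _; apply: h; rewrite s0.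
apply: (mwconvB FF h1); apply: (mwconv_heat FF (h := fun x => x.1 - x.2)) h2.
- by rewrite subr_ge0.
- by exists 1 => // t' s' /andP[_ st'] _ _ _ /=; rewrite subr_ge0.
move=> e e0; have e20 : 0 < e / 2 by rewrite divr_gt0.
exists (e / 2) => // t' s' _ _ ht' hs' /=.
have -> : t' - s' - (t - s) = (t' - t) - (s' - s) by ring.
by apply: (le_lt_trans (ler_normB _ _)); rewrite (splitr e) ltrD.
Qed.

Lemma mwc2_trp T p q d (A : R -> R -> R -> 'M[R]_(p, q)) (c : R -> 'I_d -> 'M[R]_(q, p)) (K : R) :
  0 <= K -> (forall x j k l, `|c x j k l| <= K) ->
  (forall s j k l, 0 <= s <= T -> rconv (near1 T s) (fun x => c x j k l) (c s j k l)) -> mwc2 T A ->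
  mwc2 T (fun t s => trp (A t s) (c s)).
Proof.
move=> K0 cK hc h t s hs ht; have /andP[s0 st] := hs.
apply: (mwconv_trp (near2_filter T t s) (A := fun x => A x.1 x.2) (c := fun x => c x.2) K0) (h t s hs ht).
  by move=> x j k l; exact: cK.
move=> j k l e e0; have hsT : 0 <= s <= T by rewrite s0 (le_trans st ht).
exact: (@near2_snd T t s [set x | `|c x j k l - c s j k l| < e] (hc s j k l hsT e e0)).
Qed.

End MwConv.

(** * The rough driver *)

(** Solves a relation for its last term on a degenerate simplex, where the left side cancels with a
    term on the right. *)
Lemma addr_self_eq (V : zmodType) (a b c e : V) : a = a + b + (c + e) -> e = - (b + c).
Proof.
rewrite -addrA -{1}[a]addr0 => /addrI/esym/eqP; rewrite addrA addrC addr_eq0.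
by move=> /eqP.
Qed.

Section RoughHypothesis.
Variables (R : realType) (phi : R -> R).
Hypothesis mphi : measurable_fun (`]0, +oo[ : set R) phi.

(** A direct comparison of f_t with f_t' from the left would apply the semigroup to the moving
    function f_t'. Instead both are compared with the evolution of one f_s, s a little before t, and
    strong continuity is applied to that fixed function. *)
Lemma davie_mwc1 (T kap C K a : R) (d : nat) (B : R -> R -> R -> 'cV[R]_d) (f : R -> R -> 'cV[R]_d) :
  sewable phi T kap C B -> davie phi T B f K a -> 0 <= K -> 0 < a -> 0 < kap -> mwc1 phi T f.
Proof.
move=> Hs Hf K0 a0 k0 t /andP[t0 tT]; have C0 := sw_C Hs.
split; first exact: (dv_w Hf).
move=> e e0; have e40 : 0 < e / 4 by rewrite divr_gt0.
have [D1 [D10 hD1]] : exists dl : R, 0 < dl /\ forall h, 0 <= h -> h <= dl -> K * h `^ a + C * h `^ kap <= e / 4.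
  have e80 : 0 < e / 8 by rewrite divr_gt0.
  have [d1 d10 h1] := powR_small e80 K0 a0.
  have [d2 d20 h2] := powR_small e80 C0 k0.
  exists (Num.min d1 d2); rewrite lt_min d10 d20; split=> // h h0; rewrite le_min => /andP[hd1 hd2].
  have -> : e / 4 = e / 8 + e / 8 by field.
  by apply: lerD; [exact: h1|exact: h2].
pose D := D1 / 2; have D0 : 0 < D by rewrite divr_gt0.
(* The truncation at 0 covers t < D; when it is active, t = 0 included, s = 0 still lies below every
   admissible t'. *)
pose s := Num.max 0 (t - D).
have s0 : 0 <= s by rewrite le_max lexx.
have st : s <= t by rewrite ge_max t0 gerBl ltW.
have tD : t - D <= s by rewrite le_max lexx orbT.
have sT := le_trans st tT.
have ws := dv_w Hf s0 sT.
have e20 : 0 < e / 2 by rewrite divr_gt0.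
have [dl dl0 hdl] := heat_near mphi ws e20.
exists (Num.min D dl); first by rewrite lt_min D0.
move=> t' /andP[t'0 t'T]; rewrite lt_min => /andP[tD' tdl].
have st' : s <= t'.
  rewrite ge_max t'0 lerBlDr -lerBlDl; apply: ltW; apply: le_lt_trans tD'.
  by rewrite distrC; exact: ler_norm.
have DD : D + D = D1 by rewrite /D -splitr.
have tD1 : t - s <= D by rewrite lerBlDl -lerBlDr.
have tD2 : t - s <= D1 by apply: (le_trans tD1); rewrite -DD lerDl ltW.
have t'D2 : t' - s <= D1.
  have -> : t' - s = (t' - t) + (t - s) by ring.
  by rewrite -DD lerD // (le_trans (ler_norm _)) // ltW.
have w t1 : s <= t1 -> t1 <= T ->
    mwint phi (fun xi => f t1 xi - heat (t1 - s) (f s) xi) /\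
    mwnorm phi (fun xi => f t1 xi - heat (t1 - s) (f s) xi) <=
      K * (t1 - s) `^ a + C * (t1 - s) `^ kap.
  move=> st1 t1T; have t1s : 0 <= t1 - s by rewrite subr_ge0.
  have [wB nB] := sw_w Hs s0 st1 t1T.
  have w1 := (mwintB mphi (dv_w Hf (le_trans s0 st1) t1T) (mwint_heat mphi t1s ws).1).1.
  split=> //; have w2 := (mwintB mphi w1 wB).1.
  apply: le_trans (lerD (dv_le Hf s0 st1 t1T) nB); apply: le_trans (mwintD mphi w2 wB).2.
  by rewrite le_eqVlt; apply/orP; left; apply/eqP; apply: eq_mwnorm => xi _; rewrite subrK.
have [w1 n1] := w t st tT; have [w2 n2] := w t' st' t'T.
have ts0 : 0 <= t - s by rewrite subr_ge0.
have t's0 : 0 <= t' - s by rewrite subr_ge0.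
have w3 := (mwintB mphi (mwint_heat mphi t's0 ws).1 (mwint_heat mphi ts0 ws).1).1.
split; first exact: (dv_w Hf).
have n3 : mwnorm phi (fun xi => heat (t' - s) (f s) xi - heat (t - s) (f s) xi) < e / 2.
  apply: (le_lt_trans (heat_dist mphi t's0 ts0 ws)); apply: hdl => //=.
  rewrite sub0r normrN normr_id (_ : t' - s - (t - s) = t' - t) //; ring.
have n12 := le_trans (mwintB mphi w2 w1).2 (lerD (le_trans n2 (hD1 _ t's0 t'D2)) (le_trans n1 (hD1 _ ts0 tD2))).
have -> : e = e / 4 + e / 4 + e / 2 by field.
apply: le_lt_trans (ler_ltD n12 n3); apply: le_trans (mwintD mphi (mwintB mphi w2 w1).1 w3).2.
rewrite le_eqVlt; apply/orP; left; apply/eqP; apply: eq_mwnorm => xi _.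
by apply/matrixP => i j; rewrite !mxE; ring.
Qed.

(** The Hölder bound is assumed for s < t only; the diagonal value is the limit of values at nearby
    pairs at distance h, which are O(h^mu). *)
Lemma tC2mu_diag (T mu : R) p q (B : R -> R -> R -> 'M[R]_(p, q)) : 0 < T -> 0 < mu ->
  tC2mu phi T mu B -> forall t, 0 <= t <= T -> mwnorm phi (B t t) = 0.
Proof.
move=> T0 mu0 [/(tC2P mphi) hc [C hC]] t /andP[t0 tT].
have [|//|wt {}hc] := hc t t; first by rewrite t0 lexx.
apply/eqP; rewrite eq_le mwnorm_ge0 andbT; apply/ler_addgt0Pl => e e0; rewrite addr0.
have e20 : 0 < e / 2 by rewrite divr_gt0.
have [dl dl0 hd] := hc _ e20.
pose c := (p * q)%:R * `|C|; have c0 : 0 <= c by rewrite mulr_ge0.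
have [d1 d10 h1] := powR_small e20 c0 mu0.
(* With h <= T/2 there is room inside [0,T] to the right of t or to its left. *)
pose h := Num.min (T / 2) (Num.min (dl / 2) d1).
have h0 : 0 < h by rewrite !lt_min !divr_gt0.
have hT : h <= T / 2 by rewrite ge_min lexx.
have hdl : h < dl.
  apply: (@le_lt_trans _ _ (dl / 2)); first by rewrite !ge_min lexx orbT.
  by rewrite ltr_pdivrMr // ltr_pMr // ltr1n.
have hd1 : h <= d1 by rewrite !ge_min lexx !orbT.
have [t' [s' [s'0 s't' t'T [Et Es Eh]]]] : exists t' s', [/\ 0 <= s', s' < t', t' <= T &
    [/\ `|t' - t| < dl, `|s' - t| < dl & t' - s' = h]].
  have [th|th] := leP t (T / 2).
    exists (t + h), t; rewrite ltrDl; split=> //.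
      by rewrite (splitr T) lerD.
    split; last by rewrite addrC addKr.
      by rewrite addrC addKr ger0_norm // ltW.
    by rewrite subrr normr0.
  exists t, (t - h); rewrite gtrBl; split=> //.
    by rewrite subr_ge0 (le_trans hT) // ltW.
  split; last by rewrite opprB addrC subrK.
    by rewrite subrr normr0.
  by rewrite addrC addKr normrN ger0_norm // ltW.
have [w' n'] : mwint phi (B t' s') /\ mwnorm phi (fun xi => B t' s' xi - B t t xi) < e / 2.
  by apply: hd => //; rewrite s'0 ltW.
have n2 : mwnorm phi (B t' s') <= e / 2.
  apply: (le_trans (mwnorm_le mphi w' (hC t' s' s'0 s't' t'T))).
  apply: le_trans (h1 h (ltW h0) hd1); rewrite Eh /c -mulrA ler_wpM2l //.
  by rewrite ler_wpM2r ?powR_ge0 // ler_norm.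
rewrite (splitr e); apply: le_trans (lerD n2 (ltW n')).
apply: le_trans (mwintB mphi w' (mwintB mphi w' wt).1).2.
by rewrite le_eqVlt; apply/orP; left; apply/eqP; apply: eq_mwnorm => xi _; rewrite opprB addrC subrK.
Qed.

(** Extends the bound to the diagonal and lowers the exponent in one go. *)
Lemma tC2mu_bound (T mu nu : R) p q (B : R -> R -> R -> 'M[R]_(p, q)) : 0 < T -> 0 < nu -> nu <= mu ->
  tC2mu phi T mu B -> exists2 C, 0 <= C & forall t s, 0 <= s -> s <= t -> t <= T ->
    mwint phi (B t s) /\ mwnorm phi (B t s) <= C * (t - s) `^ nu.
Proof.
move=> T0 nu0 numu hB; have mu0 := lt_le_trans nu0 numu.
have hdiag := tC2mu_diag T0 mu0 hB.
have [/(tC2P mphi) hc [C hC]] := hB.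
exists ((p * q)%:R * `|C| * T `^ (mu - nu)); first by rewrite !mulr_ge0 ?powR_ge0.
move=> t s s0 st tT.
have w : mwint phi (B t s) by apply: (hc t s _ tT).1; rewrite s0.
split=> //; move: st; rewrite le_eqVlt => /predU1P[st|st].
  rewrite st hdiag; first by rewrite !mulr_ge0 ?powR_ge0.
  by rewrite -st s0 st.
apply: (le_trans (mwnorm_le mphi w (hC t s s0 st tT))).
have ts0 : 0 <= t - s by rewrite subr_ge0 ltW.
have tsT : t - s <= T by rewrite lerBlDr (le_trans tT) // lerDl.
rewrite -!mulrA ler_wpM2l //; apply: (@le_trans _ _ (`|C| * (t - s) `^ mu)).
  by rewrite ler_wpM2r ?powR_ge0 // ler_norm.
by rewrite ler_wpM2l //; exact: ler_powRr.
Qed.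

Lemma outer_wint n (A : R -> 'M[R]_(1, n)) (v : 'M[R]_(1, n)) : mwint phi A ->
  mwint phi (fun xi => (A xi)^T *m v) /\
  mwnorm phi (fun xi => (A xi)^T *m v) <= mwnorm phi A * l1n v.
Proof.
move=> wA; have E i j xi : v 0 j * A xi 0 i = ((A xi)^T *m v) i j.
  by rewrite mxE big_ord1 mxE mulrC.
split=> [i j|]; first by apply: eq_wint (wintZ mphi (v 0 j) (wA 0 i)).1 => xi _; rewrite E.
rewrite /mwnorm /l1n !big_ord1 mulr_suml; apply: ler_sum => i _.
rewrite mulr_sumr; apply: ler_sum => j _.
by rewrite -(eq_wnorm phi (fun xi _ => E i j xi)) (wintZ mphi (v 0 j) (wA 0 i)).2 mulrC.
Qed.

Lemma mwint_sum p q m (f : 'I_m -> R -> 'M[R]_(p, q)) : (forall i, mwint phi (f i)) ->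
  mwint phi (fun xi => \sum_i f i xi) /\ mwnorm phi (fun xi => \sum_i f i xi) <= \sum_i mwnorm phi (f i).
Proof.
move=> wf.
have [h1 h2] : mwint phi (fun xi => \sum_(i <- index_enum 'I_m) f i xi) /\
    mwnorm phi (fun xi => \sum_(i <- index_enum 'I_m) f i xi)
      <= \sum_(i <- index_enum 'I_m) mwnorm phi (f i).
  elim: (index_enum _) => [|i r [IH1 IH2]].
    have E xi : (0 : 'M[R]_(p, q)) = \sum_(i <- [::]) f i xi by rewrite big_nil.
    split; first by apply: eq_mwint (mwint0 phi p q).1 => xi _; exact: E.
    by rewrite -(eq_mwnorm phi (fun xi _ => E xi)) big_nil (mwint0 phi p q).2.
  have E xi : f i xi + \sum_(k <- r) f k xi = \sum_(k <- i :: r) f k xi by rewrite big_cons.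
  have [w1 n1] := mwintD mphi (wf i) IH1.
  split; first by apply: eq_mwint w1 => xi _; exact: E.
  rewrite -(eq_mwnorm phi (fun xi _ => E xi)) big_cons; apply: (le_trans n1).
  by rewrite lerD2l.
by [].
Qed.

(** The assumed bounds hold for strictly ordered times. On the diagonal xt1 and xt2 vanish in norm
    by continuity, and then the relation for xt2 forces xt3 to vanish on degenerate triples. For s <
    u < t each product of powers in the decomposition is at most (t-s)^(3 gamma). *)
Lemma roughH_driver (T gamma kap : R) n (xt1 : R -> R -> R -> 'M[R]_(1, n))
    (xt2 : R -> R -> R -> 'M[R]_(n, n)) (xt3 : R -> R -> R -> R -> 'M[R]_(n, n)) :
  0 < T -> 0 < kap -> kap <= gamma -> roughH phi T gamma xt1 xt2 xt3 ->
  exists C, rough_driver phi T kap xt1 xt2 xt3 C.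
Proof.
move=> T0 k0 kg [h1 h2 h3 c1 c2].
have [C1 C10 hC1] := tC2mu_bound T0 k0 kg h1.
have [C2 C20 hC2] : exists2 C, 0 <= C & forall t s, 0 <= s -> s <= t -> t <= T ->
    mwint phi (xt2 t s) /\ mwnorm phi (xt2 t s) <= C * (t - s) `^ (2 * kap).
  apply: (tC2mu_bound T0 _ _ h2); first by rewrite mulr_gt0.
  by rewrite ler_wpM2l.
have z1 t : 0 <= t <= T -> mwnorm phi (xt1 t t) = 0.
  exact: (tC2mu_diag T0 (lt_le_trans k0 kg) h1).
have z2 t : 0 <= t <= T -> mwnorm phi (xt2 t t) = 0.
  have g2 : 0 < 2 * gamma by rewrite mulr_gt0 // (lt_le_trans k0).
  exact: (tC2mu_diag T0 g2 h2).
have powE (x : R) m : (x `^ kap) ^+ m = x `^ (m%:R * kap).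
  by rewrite -powR_mulrn ?powR_ge0 // -powRrM mulrC.
have c2' t u s xi : 0 <= s -> s <= u -> u <= t -> t <= T -> 0 <= xi ->
    xt2 t s xi = xt2 t u xi + heat (t - u) (xt2 u s) xi
      + ((xt1 t u xi)^T *m x1 phi xt1 u s + xt3 t u s xi).
  move=> s0 su ut tT xi0; rewrite -c2 ?s0 ?su ?ut //.
  by rewrite /dtil2 /heat; apply/matrixP => i j; rewrite !mxE; ring.
have [[hw3 _] [m [hs [rho [C3 [hs3 E3]]]]]] := h3.
have w3 t u s : 0 <= s -> s <= u -> u <= t -> t <= T -> mwint phi (xt3 t u s).
  by move=> s0 su ut tT; apply/(inL1_mwint mphi)/hw3; rewrite ?s0 ?ut.
have z3 t u s : 0 <= s -> s <= u -> u <= t -> t <= T -> (s == u) || (u == t) ->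
    mwnorm phi (xt3 t u s) = 0.
  move=> s0 su ut tT hdeg; apply/eqP; rewrite eq_le mwnorm_ge0 andbT.
  have t0 : 0 <= t by rewrite (le_trans s0) // (le_trans su).
  have u0 := le_trans s0 su; have uT := le_trans ut tT.
  have wo := outer_wint (x1 phi xt1 u s) (hC1 t u u0 ut tT).1.
  have o0 : mwnorm phi (fun xi => (xt1 t u xi)^T *m x1 phi xt1 u s) = 0.
    apply/eqP; rewrite eq_le mwnorm_ge0 andbT; apply: (le_trans wo.2).
    case/orP: hdeg => /eqP E.
      have : l1n (x1 phi xt1 u s) <= 0.
        apply: (le_trans (l1n_phint mphi (hC1 u s s0 su uT).1)); rewrite E z1 //.
        by rewrite u0.
      by move=> h; rewrite mulr_ge0_le0 // mwnorm_ge0.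
    by rewrite E z1 ?mul0r // t0.
  case/orP: hdeg => /eqP E.
    have su0 : 0 <= t - u by rewrite subr_ge0.
    have [wh nh] := mwint_heat mphi su0 (hC2 u s s0 su uT).1.
    rewrite (@eq_mwnorm _ _ _ _ _ (fun xi => - (heat (t - u) (xt2 u s) xi
        + (xt1 t u xi)^T *m x1 phi xt1 u s))).
      rewrite (mwintN mphi (mwintD mphi wh wo.1).1).2.
      apply: (le_trans (mwintD mphi wh wo.1).2); rewrite o0 addr0; apply: (le_trans nh).
      by rewrite E z2 // u0.
    move=> xi xi0; have := c2' t u s xi s0 su ut tT xi0.
    have -> : xt2 t s xi = xt2 t u xi by rewrite E.
    exact: addr_self_eq.
  rewrite (@eq_mwnorm _ _ _ _ _ (fun xi => - (xt2 t u xi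
        + (xt1 t u xi)^T *m x1 phi xt1 u s))).
    have w2 := (hC2 t u u0 ut tT).1.
    rewrite (mwintN mphi (mwintD mphi w2 wo.1).1).2.
    apply: (le_trans (mwintD mphi w2 wo.1).2); rewrite o0 addr0.
    by rewrite E z2 // t0.
  move=> xi xi0; have := c2' t u s xi s0 su ut tT xi0.
  have -> : heat (t - u) (xt2 u s) xi = xt2 t s xi.
    by rewrite /heat E subrr mulr0 expR0 scale1r.
  by rewrite [xt2 t u xi + _]addrC; exact: addr_self_eq.
pose K3 := \sum_(i < m) (n * n)%:R * `|C3| * T `^ (3 * gamma - 3 * kap).
have K30 : 0 <= K3 by apply: sumr_ge0 => i _; rewrite !mulr_ge0 ?powR_ge0.
have n3 t u s : 0 <= s -> s <= u -> u <= t -> t <= T ->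
    mwnorm phi (xt3 t u s) <= K3 * (t - s) `^ (3 * kap).
  move=> s0 su ut tT; have [E|] := boolP ((s == u) || (u == t)).
    by rewrite z3 // mulr_ge0 ?powR_ge0.
  rewrite negb_or => /andP[su' ut'].
  have {su'}su' : s < u by rewrite lt_neqAle su'.
  have {ut'}ut' : u < t by rewrite lt_neqAle ut'.
  have hh i : mwint phi (hs i t u s) /\ mwnorm phi (hs i t u s) <=
      (n * n)%:R * `|C3| * T `^ (3 * gamma - 3 * kap) * (t - s) `^ (3 * kap).
    have [[hsw _] [/andP[r0 rg] hb]] := hs3 i.
    have w : mwint phi (hs i t u s) by apply/(inL1_mwint mphi)/hsw; rewrite ?s0 ?ut.
    split=> //; apply: (le_trans (mwnorm_le mphi w (hb t u s s0 su' ut' tT))).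
    have tu0 : 0 <= t - u by rewrite subr_ge0.
    have us0 : 0 <= u - s by rewrite subr_ge0.
    have ts0 : 0 <= t - s by rewrite subr_ge0 (le_trans su).
    have tsT : t - s <= T by rewrite lerBlDr (le_trans tT) // lerDl.
    rewrite -!mulrA ler_wpM2l //; apply: (@le_trans _ _ (`|C3| * (t - s) `^ (3 * gamma))); last first.
      rewrite ler_wpM2l //; apply: ler_powRr => //; first by rewrite mulr_gt0.
      by rewrite ler_wpM2l.
    apply: (@le_trans _ _ (`|C3| * ((t - u) `^ rho i * (u - s) `^ (3 * gamma - rho i)))).
      by rewrite ler_wpM2r ?mulr_ge0 ?powR_ge0 // ler_norm.
    rewrite ler_wpM2l //.
    have -> : (t - s) `^ (3 * gamma) = (t - s) `^ rho i * (t - s) `^ (3 * gamma - rho i).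
      rewrite -powRD; first by rewrite [rho i + _]addrC subrK.
      by rewrite (gt_eqF (_ : 0 < t - s)) ?implybT // subr_gt0 (lt_trans su').
    rewrite ler_pM ?powR_ge0 //; apply: ler_powRl => //.
    - exact: ltW.
    - by rewrite lerD2l lerN2.
    - by rewrite subr_ge0 ltW.
    - by rewrite lerD2r.
  have [ws ns] := mwint_sum (fun i => (hh i).1).
  rewrite (@eq_mwnorm _ _ _ _ _ (fun xi => \sum_i hs i t u s xi)); last first.
    by move=> xi xi0; apply: E3; rewrite ?s0 ?ut.
  apply: (le_trans ns); rewrite /K3 mulr_suml; apply: ler_sum => i _; exact: (hh i).2.
exists (C1 + C2 + K3); split.
- by rewrite !addr_ge0.
- move=> t s s0 st tT; have [w nw] := hC1 t s s0 st tT; split=> //; apply: (le_trans nw).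
  by rewrite ler_wpM2r ?powR_ge0 // -addrA lerDl addr_ge0.
- move=> t s s0 st tT; have [w nw] := hC2 t s s0 st tT; split=> //; apply: (le_trans nw).
  rewrite powE ler_wpM2r ?powR_ge0 // -addrA [C2 + K3]addrC addrA lerDr addr_ge0 //.
- move=> t u s s0 su ut tT; split; first exact: w3.
  apply: (le_trans (n3 t u s s0 su ut tT)).
  by rewrite powE ler_wpM2r ?powR_ge0 // lerDr addr_ge0.
- move=> t u s xi s0 su ut tT xi0; have := c1 t u s xi; rewrite s0 su ut tT => /(_ isT isT xi0).
  rewrite /dtil2 /heat -addrA -opprD => /eqP; rewrite subr_eq0 => /eqP //.
- exact: c2'.
Qed.

End RoughHypothesis.

(** * Controlled paths and the rough integral *)

Section ControlledPath.
Variables (R : realType) (phi : R -> R).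
Hypothesis mphi : measurable_fun (`]0, +oo[ : set R) phi.
Variables (n d : nat).
Variables (xt1 : R -> R -> R -> 'M[R]_(1, n)) (xt2 : R -> R -> R -> 'M[R]_(n, n)).
Variables (xt3 : R -> R -> R -> R -> 'M[R]_(n, n)) (sigma : 'cV[R]_d -> 'M[R]_(n, d)).
Local Notation incr := (increment xt1 xt2 sigma).
Local Notation lead := (lead phi xt1 sigma).
Local Notation pincr := (path_incr xt1 xt2 sigma).
Local Notation dfct := (defect phi xt1 xt2 xt3 sigma).

(** A controlled path in the finite-dimensional sense, with Gubinelli derivative sigma(y) and
    remainder of order 2 kap. *)
Definition controlled (T kap K : R) (y : R -> 'cV[R]_d) := forall u s, 0 <= s -> s <= u -> u <= T ->
  l1n (y u - y s - lead u s (y s)) <= K * ((u - s) `^ kap) ^+ 2.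

Lemma lead_bound (T kap C M u s : R) y : rough_driver phi T kap xt1 xt2 xt3 C ->
  regular_sigma sigma M -> 0 <= s -> s <= u -> u <= T ->
  l1n (lead u s y) <= d%:R * (M * C) * (u - s) `^ kap.
Proof.
move=> Hd hs s0 su uT; have M0 := rs_M hs; have [w h] := rd_w1 Hd s0 su uT.
apply: (le_trans (lead_le phi xt1 u s y hs)); rewrite -!mulrA ler_wpM2l // ler_wpM2l //.
exact: le_trans (l1n_phint mphi w) h.
Qed.

Lemma trp_lead_wint (T kap C M u s : R) y : rough_driver phi T kap xt1 xt2 xt3 C ->
  regular_sigma sigma M -> 0 <= s -> s <= u -> u <= T ->
  mwint phi (trp (xt1 u s) (sig_coef sigma y)) /\
  mwnorm phi (trp (xt1 u s) (sig_coef sigma y)) <= d%:R * (M * C) * (u - s) `^ kap.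
Proof.
move=> Hd hs s0 su uT; have M0 := rs_M hs; have [w h] := rd_w1 Hd s0 su uT.
have ha j a b : `|sig_coef sigma y j a b| <= M.
  by rewrite mxE; exact: (fp_bd (rs_four hs a j)).
have [w1 h1] := trp_wint mphi w ha; split=> //; apply: (le_trans h1).
by rewrite -!mulrA ler_wpM2l // ler_wpM2l.
Qed.

(** Integrating against [phi] turns the convolutional expansion into an ordinary one, up to the
    semigroup acting on f_s. That term costs (u-s) N(f_s), so a uniform bound of f is needed; it
    comes from a single step from time 0. *)
Lemma controlled_state (T kap C M K : R) (a0 : 'cV[R]_d) (f : R -> R -> 'cV[R]_d) :
  rough_driver phi T kap xt1 xt2 xt3 C -> regular_sigma sigma M -> 0 < T ->
  0 < kap -> 2 * kap <= 1 -> 0 <= K ->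
  (forall t, 0 <= t -> t <= T -> mwint phi (f t)) -> mwnorm phi (f 0) = 0 ->
  (forall u s, 0 <= s -> s <= u -> u <= T ->
    mwnorm phi (fun xi => f u xi - heat (u - s) (f s) xi
      - trp (xt1 u s) (sig_coef sigma (state phi a0 (f s))) xi) <= K * ((u - s) `^ kap) ^+ 2) ->
  exists2 K', 0 <= K' & controlled T kap K' (fun t => state phi a0 (f t)).
Proof.
move=> Hd hs T0 k0 k1 K0 wf f0 hf; have M0 := rs_M hs; have C0 := rd_C Hd.
pose P := d%:R * (M * C); have P0 : 0 <= P by rewrite !mulr_ge0.
pose A := K * (T `^ kap) ^+ 2 + P * T `^ kap.
have A0 : 0 <= A by rewrite addr_ge0 // mulr_ge0 // ?exprn_ge0 // powR_ge0.
have bd t : 0 <= t -> t <= T -> mwnorm phi (f t) <= A.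
  move=> t0 tT; have w0 := wf 0 (lexx 0) (ltW T0); have wt := wf t t0 tT.
  have t00 : 0 <= t - 0 by rewrite subr0.
  have [wh nh] := mwint_heat mphi t00 w0; rewrite f0 in nh.
  have [wl nl] := trp_lead_wint (state phi a0 (f 0)) Hd hs (lexx 0) t0 tT.
  have wd := (mwintB mphi (mwintB mphi wt wh).1 wl).1.
  have e0 : 0 <= (t - 0) `^ kap := powR_ge0 _ _.
  have eT : (t - 0) `^ kap <= T `^ kap by apply: ler_powRl; rewrite ?subr0 // ltW.
  have : mwnorm phi (f t) <= K * ((t - 0) `^ kap) ^+ 2 + P * (t - 0) `^ kap + 0.
    have h1 := lerD (lerD (hf t 0 (lexx 0) t0 tT) nl) nh.
    apply: le_trans h1; apply: le_trans (lerD (mwintD mphi wd wl).2 (lexx _)).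
    apply: le_trans (mwintD mphi (mwintD mphi wd wl).1 wh).2.
    rewrite le_eqVlt; apply/orP; left; apply/eqP; apply: eq_mwnorm => xi _.
    by rewrite subrK subrK.
  rewrite addr0 => h; apply: (le_trans h); apply: lerD; rewrite ler_wpM2l //.
  by rewrite lerXn2r ?nnegrE // powR_ge0.
exists (K + T `^ (1 - 2 * kap) * A); first by rewrite addr_ge0 // mulr_ge0 // powR_ge0.
move=> u s s0 su uT; have u0 := le_trans s0 su; have sT := le_trans su uT.
have us0 : 0 <= u - s by rewrite subr_ge0.
have wu := wf u u0 uT; have ws := wf s s0 sT.
have [wh nh] := mwint_heat mphi us0 ws.
have [wl nl] := trp_lead_wint (state phi a0 (f s)) Hd hs s0 su uT.
have wd := (mwintB mphi (mwintB mphi wu wh).1 wl).1.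
have -> : state phi a0 (f u) - state phi a0 (f s) - lead u s (state phi a0 (f s)) =
    phint phi (fun xi => f u xi - heat (u - s) (f s) xi
      - trp (xt1 u s) (sig_coef sigma (state phi a0 (f s))) xi)
    + phint phi (fun xi => heat (u - s) (f s) xi - f s xi).
  rewrite (phintB mphi (mwintB mphi wu wh).1 wl) (phintB mphi wu wh) (phintB mphi wh ws).
  have -> : phint phi (trp (xt1 u s) (sig_coef sigma (state phi a0 (f s)))) =
      lead u s (state phi a0 (f s)) := trp_phint mphi _ (rd_w1 Hd s0 su uT).1.
  move: (lead u s _) => X4; rewrite /state; move: (phint _ (heat _ _)) (phint _ (f u)) (phint _ (f s)) => X1 X2 X3.
  by apply/matrixP => i j; rewrite !mxE; ring.
apply: (le_trans (l1nD _ _)); rewrite mulrDl; apply: lerD.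
  exact: le_trans (l1n_phint mphi wd) (hf u s s0 su uT).
apply: (le_trans (l1n_phint_heat mphi us0 ws)).
have ht := rough_time k0 k1 s0 su uT.
apply: (le_trans (ler_pM us0 (mwnorm_ge0 _ _) ht (bd s s0 sT))).
by rewrite mulrAC.
Qed.

Lemma controlled_holder (T kap C M K : R) y : rough_driver phi T kap xt1 xt2 xt3 C ->
  regular_sigma sigma M -> 0 < kap -> 0 <= K -> controlled T kap K y ->
  exists2 W, 0 <= W & forall s t, 0 <= s <= T -> 0 <= t <= T ->
    l1n (y t - y s) <= W * `|t - s| `^ kap.
Proof.
move=> Hd hs k0 K0 hy; have M0 := rs_M hs; have C0 := rd_C Hd.
exists (K * T `^ kap + d%:R * (M * C)).
  by rewrite addr_ge0 // ?mulr_ge0 // ?powR_ge0 // mulr_ge0.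
suff h s t : 0 <= s -> s <= t -> t <= T -> l1n (y t - y s) <=
    (K * T `^ kap + d%:R * (M * C)) * (t - s) `^ kap.
  move=> s t /andP[s0 sT] /andP[t0 tT]; have [st|/ltW ts] := leP s t.
    by rewrite ger0_norm ?subr_ge0 //; exact: h.
  by rewrite l1nBC distrC ger0_norm ?subr_ge0 //; exact: h.
move=> s0 st tT; rewrite -(subrK (lead t s (y s)) (y t - y s)).
apply: (le_trans (l1nD _ _)); rewrite mulrDl; apply: lerD; last exact: lead_bound Hd hs s0 st tT.
apply: (le_trans (hy t s s0 st tT)); rewrite -mulrA ler_wpM2l // expr2 ler_wpM2r ?powR_ge0 //.
by apply: ler_powRl; rewrite ?subr_ge0 ?(ltW k0) // lerBlDr (le_trans tT) // lerDl.
Qed.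

Lemma pincr_defect (T kap C t u s : R) y xi : rough_driver phi T kap xt1 xt2 xt3 C ->
  0 <= s -> s <= u -> u <= t -> t <= T -> 0 <= xi ->
  pincr y t u xi + heat (t - u) (pincr y u s) xi - pincr y t s xi = dfct t u s (y s) (y u) xi.
Proof. by move=> Hd s0 su ut tT xi0; exact: (increment_defect sigma Hd (y s) (y u) s0 su ut tT xi0). Qed.

(** The same count of orders as for the one-step map, with the sizes now supplied by the controlled
    expansion of y and no growth term (S = 1). *)
Lemma controlled_sewable (T kap C M K : R) y : rough_driver phi T kap xt1 xt2 xt3 C ->
  regular_sigma sigma M -> 0 < kap -> 0 <= K -> controlled T kap K y ->
  exists C', sewable phi T kap C' (pincr y).
Proof.
move=> Hd hs k0 K0 hy; have M0 := rs_M hs; have C0 := rd_C Hd.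
pose P := d%:R * (M * C); have P0 : 0 <= P by rewrite !mulr_ge0.
pose E0 := T `^ kap; have E00 : 0 <= E0 := powR_ge0 _ _.
have eE t s : 0 <= s -> s <= t -> t <= T -> (t - s) `^ kap <= E0.
  move=> s0 st tT; apply: ler_powRl; rewrite ?(ltW k0) ?subr_ge0 //.
  by rewrite lerBlDr (le_trans tT) // lerDl.
pose W := K * E0 + P; have W0 : 0 <= W by rewrite addr_ge0 // mulr_ge0.
pose D := d%:R * (C * (M * (P ^+ 2 + K + W + 1) * 1)).
have D0 : 0 <= D.
  apply: mulr_ge0 => //; apply: mulr_ge0 => //; rewrite mulr1; apply: mulr_ge0 => //.
  have PK := addr_ge0 (exprn_ge0 2 P0) K0.
  exact: addr_ge0 (addr_ge0 PK W0) ler01.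
have PE0 : 0 <= P * (1 + E0) by rewrite mulr_ge0 // addr_ge0.
exists (P * (1 + E0) + D); split; first exact: addr_ge0.
- move=> t s s0 st tT; have [w h] := increment_wint mphi (y s) Hd hs s0 st tT.
  split; first exact: w.
  have e0 : 0 <= (t - s) `^ kap := powR_ge0 _ _.
  apply: (le_trans h); apply: (@le_trans _ _ (P * (1 + E0) * (t - s) `^ kap)); last first.
    by rewrite ler_wpM2r // lerDl.
  rewrite /P -!mulrA ler_wpM2l // ler_wpM2l // ler_wpM2l //.
  by rewrite mulrDl mul1r lerD2l expr2 ler_wpM2r // eE.
move=> t u s s0 su ut tT.
have st := le_trans su ut; have uT := le_trans ut tT.
rewrite (eq_mwnorm phi (fun xi xi0 => pincr_defect y Hd s0 su ut tT xi0)).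
have [w h] := defect_wint mphi Hd (y s) (y u) hs s0 su ut tT (ltW k0).
apply: (le_trans h).
have e0 : 0 <= (t - s) `^ kap := powR_ge0 _ _.
have eu0 : 0 <= (u - s) `^ kap := powR_ge0 _ _.
have eu : (u - s) `^ kap <= (t - s) `^ kap.
  by apply: ler_powRl; rewrite ?(ltW k0) ?subr_ge0 // lerD2r.
have b1 : l1n (lead u s (y s)) <= P * (t - s) `^ kap.
  by apply: (le_trans (lead_bound (y s) Hd hs s0 su uT)); rewrite ler_wpM2l.
have b3 : l1n (y u - y s - lead u s (y s)) <= K * ((t - s) `^ kap) ^+ 2 * 1.
  by rewrite mulr1; apply: (le_trans (hy u s s0 su uT)); rewrite ler_wpM2l // lerXn2r ?nnegrE.
have b4 : l1n (y u - y s) <= W * (t - s) `^ kap * 1.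
  rewrite mulr1 /W mulrDl -(subrK (lead u s (y s)) (y u - y s)).
  apply: (le_trans (l1nD _ _)); apply: lerD => //; rewrite mulr1 in b3.
  apply: (le_trans b3); rewrite -mulrA ler_wpM2l // expr2 ler_wpM2r //; exact: eE.
have hA := defect_arith M0 P0 K0 W0 e0 (lexx 0) (esym (addr0 1)) (l1n_ge0 _) b1 b3 b4.
apply: (le_trans (ler_wpM2l (ler0n R d) (ler_wpM2l C0 hA))).
have -> : (t - s) `^ (3 * kap) = ((t - s) `^ kap) ^+ 3.
  by rewrite -powR_mulrn ?powR_ge0 // -powRrM mulrC.
apply: (@le_trans _ _ (D * ((t - s) `^ kap) ^+ 3)).
  by rewrite /D le_eqVlt; apply/orP; left; apply/eqP; ring.
by rewrite ler_wpM2r ?exprn_ge0 // lerDr.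
Qed.

Lemma holder_rconv (T kap W s : R) (a : R -> R) : 0 <= W -> 0 < kap -> 0 <= s <= T ->
  (forall t, 0 <= t <= T -> `|a t - a s| <= W * `|t - s| `^ kap) -> rconv (near1 T s) a (a s).
Proof.
move=> W0 k0 hs ha e e0; have e20 : 0 < e / 2 by rewrite divr_gt0.
have [dl dl0 hdl] := powR_small e20 W0 k0.
exists dl => // t ht htd; apply: (le_lt_trans (ha t ht)).
apply: (le_lt_trans (hdl _ (normr_ge0 _) (ltW htd))).
by rewrite ltr_pdivrMr // ltr_pMr // ltr1n.
Qed.

Lemma pincr_mwc2 (T kap C M K : R) y : rough_driver phi T kap xt1 xt2 xt3 C ->
  regular_sigma sigma M -> 0 < kap -> 0 <= K -> controlled T kap K y ->
  mwc2 phi T xt1 -> mwc2 phi T xt2 ->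
  mwc2 phi T (fun t s => trp (xt1 t s) (sig_coef sigma (y s))) /\ mwc2 phi T (pincr y).
Proof.
move=> Hd hs k0 K0 hy c1 c2; have M0 := rs_M hs.
have [W W0 hW] := controlled_holder Hd hs k0 K0 hy.
have MW0 : 0 <= M * W by rewrite mulr_ge0.
have m1 : mwc2 phi T (fun t s => trp (xt1 t s) (sig_coef sigma (y s))).
  apply: (mwc2_trp mphi (c := fun s => sig_coef sigma (y s)) M0) => // [x j k l|s j k l hsT].
    by rewrite mxE; exact: (fp_bd (rs_four hs k j)).
  apply: (holder_rconv (kap := kap) MW0) => // t ht.
  rewrite /sig_coef !mxE -mulrA; apply: le_trans (ler_wpM2l M0 (hW s t hsT ht)).
  exact: (fp_lip (rs_four hs k j)).
split; first exact: m1.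
apply: (mwc2D mphi m1).
apply: (mwc2_trp mphi (c := fun s => sig2_coef sigma (y s)) M0) => // [x j k l|s j k l hsT].
  exact: (fp_bd (rs_prod_four hs j k l)).
apply: (holder_rconv (kap := kap) MW0) => // t ht.
rewrite -mulrA; apply: le_trans (ler_wpM2l M0 (hW s t hsT ht)).
exact: (fp_lip (rs_prod_four hs j k l)).
Qed.

End ControlledPath.

(** * The rough integral as a germ plus its sewing remainder *)

Section RoughIntegral.
Variables (R : realType) (phi : R -> R).
Hypothesis mphi : measurable_fun (`]0, +oo[ : set R) phi.
Variables (n d : nat).
Variables (xt1 : R -> R -> R -> 'M[R]_(1, n)) (xt2 : R -> R -> R -> 'M[R]_(n, n)).
Variables (xt3 : R -> R -> R -> R -> 'M[R]_(n, n)) (sigma : 'cV[R]_d -> 'M[R]_(n, d)).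
Local Notation pincr := (path_incr xt1 xt2 sigma).
Local Notation dfct := (defect phi xt1 xt2 xt3 sigma).

(** Extraction of a coordinate as a 1 by 1 matrix, the type on which [Jsig] applies [Lambda].
    Writing it as a trace pairing makes the bounds and the continuity of [trp] available. *)
Definition entry (j : 'I_d) (g : R -> 'cV[R]_d) : R -> 'M[R]_1 :=
  trp g (fun=> delta_mx 0 j).

Lemma entryE j g xi : entry j g xi 0 0 = g xi j 0.
Proof.
rewrite /entry /trp mxE mxtrace_mulC /mxtrace big_ord1 mxE (bigD1 j) //= big1.
  by rewrite mxE !eqxx mul1r addr0.
by move=> i ij; rewrite mxE (negbTE ij) andbF mul0r.
Qed.

Lemma delta_le j (k : 'I_1) (a : 'I_1) (b : 'I_d) : `|(fun=> delta_mx 0 j) k a b : R| <= 1.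
Proof. by rewrite mxE; case: (_ && _); rewrite ?normr1 ?normr0. Qed.

Lemma entry_wint j g : mwint phi g ->
  mwint phi (entry j g) /\ mwnorm phi (entry j g) <= mwnorm phi g.
Proof.
move=> wg; have [w h] := trp_wint mphi wg (delta_le j); split=> //.
by move: h; rewrite !mul1r.
Qed.

Lemma entry_mwc2 T j B : mwc2 phi T B -> mwc2 phi T (fun t s => entry j (B t s)).
Proof.
move=> hB; apply: (mwc2_trp mphi (c := fun _ => fun=> delta_mx 0 j) ler01 _ _ hB).
  by move=> _ k a b; exact: delta_le.
move=> s k a b _ e e0; exists 1 => // t' _ _.
by rewrite /= subrr normr0.
Qed.

Lemma mxaddE p q (A B : 'M[R]_(p, q)) i j : (A + B) i j = A i j + B i j.
Proof. by rewrite mxE. Qed.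

Lemma mxsubE p q (A B : 'M[R]_(p, q)) i j : (A - B) i j = A i j - B i j.
Proof. by rewrite !mxE. Qed.

Lemma trvE p q (A : 'M[R]_(p, q)) (c : 'I_d -> 'M[R]_(q, p)) j : trv A c j 0 = \tr (A *m c j).
Proof. by rewrite mxE. Qed.

Lemma scalar11 (a : R) : (a%:M : 'M[R]_1) 0 0 = a.
Proof. by rewrite mxE mulr1n. Qed.

Definition rough_h (j : 'I_d) (y : R -> 'cV[R]_d) (t u s xi : R) : 'M[R]_1 :=
  xt1 t u xi *m (col j (sigma (y u)) - col j (sigma (y s))
     - (x1 phi xt1 u s *m zetaj sigma j (fun v => sigma (y v)) y s)^T)
  + (\tr (xt2 t u xi *m (zetaj sigma j (fun v => sigma (y v)) y u
      - zetaj sigma j (fun v => sigma (y v)) y s)))%:M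
  - (\tr (xt3 t u s xi *m zetaj sigma j (fun v => sigma (y v)) y s))%:M.

Definition col_of (B : 'I_d -> R -> R -> R -> 'M[R]_1) (t s xi : R) : 'cV[R]_d :=
  \col_j B j t s xi 0 0.

Definition rough_rem T (y : R -> 'cV[R]_d) : R -> R -> R -> 'cV[R]_d :=
  col_of (fun j => Lambda phi T (rough_h j y)).

Lemma JsigE T y t s xi : Jsig phi T xt1 xt2 xt3 sigma (fun v => sigma (y v)) y t s xi =
  pincr y t s xi + rough_rem T y t s xi.
Proof.
apply/matrixP => j k; rewrite (ord1 k) mxaddE /path_incr /increment mxaddE !trvE trace_mx11.
by rewrite /Jsig /rough_rem /col_of ![LHS]mxE mxaddE scalar11 [in RHS]mxE.
Qed.

Lemma rough_h_defect j y t u s xi : rough_h j y t u s xi = entry j (dfct t u s (y s) (y u)) xi.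
Proof.
apply/matrixP => a b; rewrite (ord1 a) (ord1 b) entryE /defect /rough_h.
have -> : (x1 phi xt1 u s *m zetaj sigma j (fun v => sigma (y v)) y s)^T =
    jac_col sigma j (y s) *m lead phi xt1 sigma u s (y s).
  rewrite /zetaj mulmxA trmx_mul trmxK; congr (_ *m _).
  apply/matrixP => k l; rewrite !mxE /mxtrace big_ord1 !mxE (ord1 l).
  by apply: eq_bigr => i _; rewrite !mxE.
by rewrite !mxsubE !mxaddE !scalar11 !trvE trace_mx11.
Qed.

Lemma mxscaleE p q (a : R) (A : 'M[R]_(p, q)) i j : (a *: A) i j = a * A i j.
Proof. by rewrite mxE. Qed.

Lemma entry_eq j (g g' : R -> 'cV[R]_d) xi : g xi = g' xi -> entry j g xi = entry j g' xi.
Proof. by rewrite /entry /trp => ->. Qed.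

Lemma dtil2_entry j (B : R -> R -> R -> 'cV[R]_d) t u s xi :
  dtil2 (fun t s => entry j (B t s)) t u s xi = entry j (dtil2 B t u s) xi.
Proof.
apply/matrixP => a b; rewrite (ord1 a) (ord1 b) entryE /dtil2 !mxsubE !mxscaleE.
by rewrite !entryE.
Qed.

(** The composite of the two operators is zero, so only the germ contributes. *)
Lemma dtil2_dtil1B (f : R -> R -> 'cV[R]_d) (P : R -> R -> R -> 'cV[R]_d) t u s xi :
  dtil2 (fun t s xi => dtil1 f t s xi - P t s xi) t u s xi =
  P t u xi + heat (t - u) (P u s) xi - P t s xi.
Proof.
rewrite /dtil2 /dtil1 /heat (_ : - xi * (t - s) = - xi * (t - u) + - xi * (u - s)); last by ring.
by rewrite expRD; apply/matrixP => i j; rewrite !mxE; ring.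
Qed.

Lemma Lambda_spec (T kap C M K : R) y : rough_driver phi T kap xt1 xt2 xt3 C ->
  regular_sigma sigma M -> 0 < T -> 1 / 3 < kap -> 0 <= K -> controlled phi xt1 sigma T kap K y ->
  mwc2 phi T xt1 -> mwc2 phi T xt2 ->
  forall j, exists mu : R, [/\ 1 < mu, tC2mu phi T mu (Lambda phi T (rough_h j y)) &
    forall t u s xi, 0 <= s <= u -> u <= t <= T -> 0 <= xi ->
      dtil2 (Lambda phi T (rough_h j y)) t u s xi = rough_h j y t u s xi].
Proof.
move=> Hd hs T0 k3 K0 hy c1 c2 j.
have k0 : 0 < kap by apply: lt_trans k3; rewrite divr_gt0.
have [C' Hs] := controlled_sewable mphi Hd hs k0 K0 hy.
have [f [N [N0 f0 Hf]]] := davie_exists mphi Hs T0 k3.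
have [_ c3] := pincr_mwc2 mphi Hd hs k0 K0 hy c1 c2.
have k30 : 0 < 3 * kap by rewrite mulr_gt0.
have cf := davie_mwc1 mphi Hs Hf N0 k30 k0.
pose L t s xi := dtil1 f t s xi - pincr y t s xi.
have cL : mwc2 phi T L := mwc2B mphi (mwc2_dtil1 mphi cf) c3.
have spec : exists B, exists mu : R, 1 < mu /\ tC2mu phi T mu B /\
    forall t u s xi, 0 <= s <= u -> u <= t <= T -> 0 <= xi ->
      dtil2 B t u s xi = rough_h j y t u s xi.
  exists (fun t s => entry j (L t s)), (3 * kap); split; first by rewrite mulrC -ltr_pdivrMr.
  split.
    split; first by apply/(tC2P mphi); exact: entry_mwc2.
    exists N => t s s0 st tT; have hst : 0 <= s <= t by rewrite s0 ltW.
    have [w h] := entry_wint j (cL t s hst tT).1.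
    apply: (le_trans (NL1_le mphi w)); rewrite lee_fin; apply: (le_trans h).
    exact: (dv_le Hf s0 (ltW st) tT).
  move=> t u s xi /andP[s0 su] /andP[ut tT] xi0; rewrite rough_h_defect.
  apply: etrans (dtil2_entry j L t u s xi) (entry_eq j _).
  exact: etrans (dtil2_dtil1B f (pincr y) t u s xi) (pincr_defect sigma y Hd s0 su ut tT xi0).
have [mu [h1 [h2 h3]]] := ClassicalEpsilon.epsilon_spec (inhabits (fun _ _ _ => 0)) _ spec.
by exists mu.
Qed.

(** The defining predicate reads h only on the simplex and for xi >= 0. By extensionality the two
    predicates are equal, so the choices coincide everywhere and not merely almost everywhere. *)
Lemma Lambda_ext T p q (h h' : R -> R -> R -> R -> 'M[R]_(p, q)) :
  (forall t u s xi, 0 <= s <= u -> u <= t <= T -> 0 <= xi -> h t u s xi = h' t u s xi) ->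
  Lambda phi T h = Lambda phi T h'.
Proof.
move=> hh; congr ClassicalEpsilon.epsilon; apply/funext => B; apply/propext.
split=> -[mu [m1 [cB eB]]]; exists mu; split=> //; split=> // t u s xi a b c.
  by rewrite eB // hh.
by rewrite eB // -hh.
Qed.

Lemma Jsig_ext T y y' : (forall t, 0 <= t <= T -> y t = y' t) ->
  forall t s xi, 0 <= s <= t -> t <= T ->
  Jsig phi T xt1 xt2 xt3 sigma (fun v => sigma (y v)) y t s xi =
  Jsig phi T xt1 xt2 xt3 sigma (fun v => sigma (y' v)) y' t s xi.
Proof.
move=> yy t s xi /andP[s0 st] tT.
have E : (fun j => Lambda phi T (rough_h j y)) = (fun j => Lambda phi T (rough_h j y')).
  apply/funext => j; apply: Lambda_ext => t' u' s' xi' /andP[s'0 su'] /andP[ut' tT'] _.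
  have u'T : 0 <= u' <= T by rewrite (le_trans s'0) // (le_trans ut').
  have s'T : 0 <= s' <= T by rewrite s'0 (le_trans su') // (le_trans ut').
  apply: etrans (rough_h_defect j y t' u' s' xi') (etrans _ (esym (rough_h_defect j y' t' u' s' xi'))).
  by apply: entry_eq; rewrite (yy u' u'T) (yy s' s'T).
have ys : y s = y' s by apply: yy; rewrite s0 (le_trans st).
apply: etrans (JsigE T y t s xi) (etrans _ (esym (JsigE T y' t s xi))).
exact: (congr2 (fun v B => increment xt1 xt2 sigma t s v xi + col_of B t s xi) ys E).
Qed.

Lemma mwconv_col X (F : set_system X) (FF : Filter F) (B : 'I_d -> X -> R -> 'M[R]_1) b :
  (forall j, mwconv phi F (B j) (b j)) ->
  mwconv phi F (fun x xi => \col_j B j x xi 0 0) (fun xi => \col_j b j xi 0 0).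
Proof.
move=> hB; split.
  by move=> j k; apply: eq_wint ((hB j).1 0 0) => xi _; rewrite mxE.
move=> e e0; have e'0 : 0 < e / (d * 1).+1%:R by rewrite divr_gt0.
apply: filterS (filter_forall FF (fun j => (hB j).2 _ e'0)) => x hx; split.
  by move=> j k; apply: eq_wint ((hx j).1 0 0) => xi _; rewrite mxE.
apply: mwnorm_lt => // j k; have [_ h] := hx j; apply: le_lt_trans h.
rewrite /mwnorm !big_ord1 le_eqVlt; apply/orP; left; apply/eqP.
by apply: eq_wnorm => xi _; rewrite !mxE.
Qed.

(** Each coordinate has its own chosen remainder and exponent; finitely many exponents above 1 have
    a common lower bound above 1. *)
Lemma common_exponent (th : R) (mu : 'I_d -> R) : 1 < th -> (forall j, 1 < mu j) ->
  exists m : R, [/\ 1 < m, m <= th & forall j, m <= mu j].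
Proof.
move=> th1 mu1.
have [m [m1 mth hm]] : exists m : R, [/\ 1 < m, m <= th & {in enum 'I_d, forall j, m <= mu j}].
  elim: (enum _) => [|k r [m [m1 mth hm]]]; first by exists th.
  exists (Num.min m (mu k)); split; rewrite ?lt_min ?ge_min ?m1 ?mth ?mu1 //.
  move=> j; rewrite inE => /predU1P[->|jr]; first by rewrite ge_min lexx orbT.
  by rewrite ge_min hm.
by exists m; split=> // j; apply: hm; rewrite mem_enum.
Qed.

Lemma col_of_props T th (B : 'I_d -> R -> R -> R -> 'M[R]_1) (D : R -> R -> R -> R -> 'cV[R]_d) :
  0 < T -> 1 < th ->
  (forall j, exists mu : R, [/\ 1 < mu, tC2mu phi T mu (B j) &
    forall t u s xi, 0 <= s <= u -> u <= t <= T -> 0 <= xi ->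
      dtil2 (B j) t u s xi = entry j (D t u s) xi]) ->
  [/\ mwc2 phi T (col_of B),
      exists mu N : R, [/\ 1 < mu, mu <= th, 0 <= N & forall t s, 0 <= s -> s <= t -> t <= T ->
        mwint phi (col_of B t s) /\ mwnorm phi (col_of B t s) <= N * (t - s) `^ mu] &
      forall t u s xi, 0 <= s -> s <= u -> u <= t -> t <= T -> 0 <= xi ->
        dtil2 (col_of B) t u s xi = D t u s xi].
Proof.
move=> T0 th1 hL; have [mu hmu] := choice hL.
split.
- move=> t s hst tT.
  apply: (mwconv_col (near2_filter T t s) (B := fun j x xi => B j x.1 x.2 xi)
    (b := fun j xi => B j t s xi)) => j.
  by have [_ [/(tC2P mphi) h _] _] := hmu j; exact: h.
- have [m [m1 mth mj]] := common_exponent th1 (fun j => let: And3 h _ _ := hmu j in h).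
  have hb j : exists N, 0 <= N /\ forall t s, 0 <= s -> s <= t -> t <= T ->
      mwint phi (B j t s) /\ mwnorm phi (B j t s) <= N * (t - s) `^ m.
    have [_ h _] := hmu j.
    have [N N0 hN] := tC2mu_bound mphi T0 (lt_trans ltr01 m1) (mj j) h.
    by exists N.
  have [N hN] := choice hb.
  exists m, (\sum_j N j); split=> //; first by apply: sumr_ge0 => j _; have [] := hN j.
  move=> t s s0 st tT; split.
    move=> j k; have [w _] := (hN j).2 t s s0 st tT.
    by apply: eq_wint (w 0 0) => xi _; rewrite mxE.
  rewrite mulr_suml; apply: ler_sum => j _; rewrite big_ord1.
  have [_ h] := (hN j).2 t s s0 st tT; apply: le_trans h.
  rewrite /mwnorm !big_ord1 le_eqVlt; apply/orP; left; apply/eqP.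
  by apply: eq_wnorm => xi _; rewrite !mxE.
move=> t u s xi s0 su ut tT xi0; apply/matrixP => j k; rewrite (ord1 k).
have [_ _ h] := hmu j; have := h t u s xi.
rewrite s0 su ut tT => /(_ isT isT xi0) /(congr1 (fun A : 'M[R]_1 => A 0 0)); rewrite entryE => <-.
by rewrite /dtil2 /col_of !mxE.
Qed.

Lemma rough_rem_props (T kap C M K : R) y : rough_driver phi T kap xt1 xt2 xt3 C ->
  regular_sigma sigma M -> 0 < T -> 1 / 3 < kap -> 0 <= K -> controlled phi xt1 sigma T kap K y ->
  mwc2 phi T xt1 -> mwc2 phi T xt2 ->
  [/\ mwc2 phi T (rough_rem T y),
      exists mu N : R, [/\ 1 < mu, mu <= 3 * kap, 0 <= N & forall t s, 0 <= s -> s <= t -> t <= T ->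
        mwint phi (rough_rem T y t s) /\ mwnorm phi (rough_rem T y t s) <= N * (t - s) `^ mu] &
      forall t u s xi, 0 <= s -> s <= u -> u <= t -> t <= T -> 0 <= xi ->
        dtil2 (rough_rem T y) t u s xi = dfct t u s (y s) (y u) xi].
Proof.
move=> Hd hs T0 k3 K0 hy c1 c2.
have th1 : 1 < 3 * kap by rewrite mulrC -ltr_pdivrMr.
apply: (col_of_props (D := fun t u s => dfct t u s (y s) (y u)) T0 th1) => j.
have [mu [m1 hm e]] := Lambda_spec Hd hs T0 k3 K0 hy c1 c2 j.
by exists mu; split=> // t u s xi h1 h2 h3; rewrite -rough_h_defect; exact: e.
Qed.

(** The defect of the germ and the [dtil2] of the remainder are the same function, and they cancel
    at every xi >= 0. This pointwise relation is what allows the integral from 0 to solve the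
    equation without exceptional sets. *)
Lemma Jsig_chen (T kap C M K : R) y : rough_driver phi T kap xt1 xt2 xt3 C ->
  regular_sigma sigma M -> 0 < T -> 1 / 3 < kap -> 0 <= K -> controlled phi xt1 sigma T kap K y ->
  mwc2 phi T xt1 -> mwc2 phi T xt2 ->
  forall t u s xi, 0 <= s -> s <= u -> u <= t -> t <= T -> 0 <= xi ->
  let J := Jsig phi T xt1 xt2 xt3 sigma (fun v => sigma (y v)) y in
  J t s xi = J t u xi + heat (t - u) (J u s) xi.
Proof.
move=> Hd hs T0 k3 K0 hy c1 c2 t u s xi s0 su ut tT xi0 J.
have [_ _ h] := rough_rem_props Hd hs T0 k3 K0 hy c1 c2.
have := h t u s xi s0 su ut tT xi0.
rewrite -(pincr_defect sigma y Hd s0 su ut tT xi0) /J /heat !JsigE /dtil2.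
move: (pincr y t s xi) (pincr y t u xi) (pincr y u s xi) => P1 P2 P3.
move: (rough_rem T y t s xi) (rough_rem T y t u xi) (rough_rem T y u s xi) => L1 L2 L3 E.
apply/eqP; rewrite -subr_eq0; apply/eqP.
move: E => /eqP; rewrite -subr_eq0 => /eqP E; rewrite -[RHS]E.
by apply/matrixP => i j; rewrite !mxE; ring.
Qed.

End RoughIntegral.

(** * Existence and uniqueness *)

Section Solutions.
Variables (R : realType) (phi : R -> R).
Hypothesis mphi : measurable_fun (`]0, +oo[ : set R) phi.
Variables (n d : nat).
Variables (xt1 : R -> R -> R -> 'M[R]_(1, n)) (xt2 : R -> R -> R -> 'M[R]_(n, n)).
Variables (xt3 : R -> R -> R -> R -> 'M[R]_(n, n)) (sigma : 'cV[R]_d -> 'M[R]_(n, d)).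
Variable a0 : 'cV[R]_d.
Local Notation pincr := (path_incr xt1 xt2 sigma).
Local Notation Jy T y := (Jsig phi T xt1 xt2 xt3 sigma (fun v => sigma (y v)) y).

Lemma trv_sig_coef (A : 'M[R]_(1, n)) (y : 'cV[R]_d) : (A *m sigma y)^T = trv A (sig_coef sigma y).
Proof.
apply/matrixP => j k; rewrite !mxE /mxtrace big_ord1 !mxE (ord1 k).
by apply: eq_bigr => a _; rewrite !mxE.
Qed.

Lemma powR2 (x kap : R) : (x `^ kap) ^+ 2 = x `^ (2 * kap).
Proof. by rewrite -powR_mulrn ?powR_ge0 // -powRrM mulrC. Qed.

(** The state does not see null sets, although the functions do. *)
Lemma eq_state (f g : R -> 'cV[R]_d) : mwint phi f -> mwint phi g ->
  mwnorm phi (fun xi => f xi - g xi) = 0 -> state phi a0 f = state phi a0 g.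
Proof.
move=> wf wg fg; congr (a0 + _); apply/eqP; rewrite -subr_eq0 -(phintB mphi wf wg).
have := l1n_phint mphi (mwintB mphi wf wg).1; rewrite fg; move: (phint _ _) => A hA.
apply/eqP/matrixP => i j; rewrite [RHS]mxE; apply/eqP; rewrite -normr_le0.
exact: le_trans (l1n_entry A i j) hA.
Qed.

Lemma trp2_wint (T kap C M u s : R) y : rough_driver phi T kap xt1 xt2 xt3 C ->
  regular_sigma sigma M -> 0 <= s -> s <= u -> u <= T ->
  mwint phi (trp (xt2 u s) (sig2_coef sigma y)) /\
  mwnorm phi (trp (xt2 u s) (sig2_coef sigma y)) <= d%:R * (M * C) * ((u - s) `^ kap) ^+ 2.
Proof.
move=> Hd hs s0 su uT; have M0 := rs_M hs; have [w h] := rd_w2 Hd s0 su uT.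
have [w1 h1] := trp_wint mphi w (fun j a b => fp_bd (rs_prod_four hs j a b) y).
split=> //; apply: (le_trans h1).
by rewrite -!mulrA ler_wpM2l // ler_wpM2l.
Qed.

Lemma solution_controlled (T kap C M : R) (f : R -> R -> 'cV[R]_d) :
  rough_driver phi T kap xt1 xt2 xt3 C -> regular_sigma sigma M -> 0 < T -> 0 < kap -> 2 * kap <= 1 ->
  is_solution phi T kap xt1 xt2 xt3 sigma a0 f ->
  exists2 K, 0 <= K & controlled phi xt1 sigma T kap K (fun t => state phi a0 (f t)).
Proof.
move=> Hd hs T0 k0 k2 [c1 _ hr f0 _].
have k20 : 0 < 2 * kap by rewrite mulr_gt0.
have [K K0 hK] := tC2mu_bound mphi T0 k20 (lexx _) hr.
apply: (controlled_state mphi Hd hs T0 k0 k2 K0).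
- by move=> t t0 tT; apply/(inL1_mwint mphi)/c1.1; rewrite t0.
- by rewrite (eq_mwnorm phi f0) (mwint0 phi d 1).2.
move=> u s s0 su uT; have [_ h] := hK u s s0 su uT; rewrite powR2; apply: le_trans h.
rewrite le_eqVlt; apply/orP; left; apply/eqP; apply: eq_mwnorm => xi _.
by rewrite trv_sig_coef.
Qed.

(** Once the equation holds, the Davie error is exactly the sewing remainder, hence inherits its
    exponent. *)
Lemma Jsig_davie (T kap C M K : R) (y : R -> 'cV[R]_d) (f : R -> R -> 'cV[R]_d) :
  rough_driver phi T kap xt1 xt2 xt3 C -> regular_sigma sigma M -> 0 < T -> 1 / 3 < kap ->
  0 <= K -> controlled phi xt1 sigma T kap K y -> mwc2 phi T xt1 -> mwc2 phi T xt2 ->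
  (forall t, 0 <= t -> t <= T -> mwint phi (f t)) ->
  (forall t s xi, 0 <= s <= t -> t <= T -> 0 <= xi -> dtil1 f t s xi = Jy T y t s xi) ->
  exists mu N : R, [/\ 1 < mu, mu <= 3 * kap, 0 <= N & davie phi T (pincr y) f N mu].
Proof.
move=> Hd hs T0 k3 K0 hy c1 c2 wf ef.
have [_ [mu [N [m1 mk N0 hN]]] _] := rough_rem_props mphi Hd hs T0 k3 K0 hy c1 c2.
exists mu, N; split=> //; split; first exact: wf.
move=> t s s0 st tT; have [_ h] := hN t s s0 st tT; apply: le_trans h.
rewrite le_eqVlt; apply/orP; left; apply/eqP; apply: eq_mwnorm => xi xi0.
have hst : 0 <= s <= t by rewrite s0.
apply: etrans (congr1 (fun v => v - pincr y t s xi)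
  (etrans (ef t s xi hst tT xi0) (JsigE _ _ _ _ _ _ _ _ _ _))) _.
by rewrite addrAC subrr add0r.
Qed.

(** Almost everywhere equality already gives equal states on [0,T]. The two rough integrals are then
    the same function by [Jsig_ext], and with the initial value 0 the equation expresses each
    solution at time t by that integral. *)
Lemma solution_unique (T kap C M : R) (f g : R -> R -> 'cV[R]_d) :
  rough_driver phi T kap xt1 xt2 xt3 C -> regular_sigma sigma M -> 0 < T ->
  1 / 3 < kap -> kap < 1 / 2 -> mwc2 phi T xt1 -> mwc2 phi T xt2 ->
  is_solution phi T kap xt1 xt2 xt3 sigma a0 f -> is_solution phi T kap xt1 xt2 xt3 sigma a0 g ->
  forall t xi, 0 <= t <= T -> 0 <= xi -> g t xi = f t xi.
Proof.
move=> Hd hs T0 k3 k2 c1 c2 sf sg.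
have k0 : 0 < kap by apply: lt_trans k3; rewrite divr_gt0.
have k21 : 2 * kap <= 1 by rewrite mulrC -ler_pdivlMr // ltW.
have [Kf Kf0 cf] := solution_controlled Hd hs T0 k0 k21 sf.
have [Kg Kg0 cg] := solution_controlled Hd hs T0 k0 k21 sg.
have [tf _ _ zf ef] := sf; have [tg _ _ zg eg] := sg.
have wf t : 0 <= t -> t <= T -> mwint phi (f t).
  by move=> t0 tT; apply/(inL1_mwint mphi)/tf.1; rewrite t0.
have wg t : 0 <= t -> t <= T -> mwint phi (g t).
  by move=> t0 tT; apply/(inL1_mwint mphi)/tg.1; rewrite t0.
have [mf [Nf [mf1 mfk Nf0 df]]] := Jsig_davie Hd hs T0 k3 Kf0 cf c1 c2 wf ef.
have [mg [Ng [mg1 mgk Ng0 dg]]] := Jsig_davie Hd hs T0 k3 Kg0 cg c1 c2 wg eg.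
(* The two solutions carry remainders with unrelated exponents; the smaller one serves both. *)
pose m := Num.min mf mg.
have m1 : 1 < m by rewrite lt_min mf1.
have mk : m <= 3 * kap by rewrite ge_min mfk.
have m0 : 0 < m := lt_trans ltr01 m1.
pose N := Nf * T `^ (mf - m) + Ng * T `^ (mg - m).
have df' : davie phi T (pincr (fun s => state phi a0 (f s))) f N m.
  apply: (davieW df) => //; first by rewrite ge_min lexx.
  by rewrite lerDl mulr_ge0 // powR_ge0.
have dg' : davie phi T (pincr (fun s => state phi a0 (g s))) g N m.
  apply: (davieW dg) => //; first by rewrite ge_min lexx orbT.
  by rewrite lerDr mulr_ge0 // powR_ge0.
have fg0 : mwnorm phi (fun xi => f 0 xi - g 0 xi) = 0.
  apply: etrans (eq_mwnorm phi _) (mwint0 phi d 1).2 => xi xi0.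
  by rewrite zf // zg // subrr.
have fg := davie_flow_unique mphi Hd hs T0 k3 k2 m1 mk df' dg' fg0.
have yE t : 0 <= t <= T -> state phi a0 (f t) = state phi a0 (g t).
  move=> /andP[t0 tT]; apply: eq_state; [exact: wf|exact: wg|exact: fg].
move=> t xi /andP[t0 tT] xi0.
have t00 : (0 : R) <= 0 <= t by rewrite t0 andbT.
have d0 (h : R -> R -> 'cV[R]_d) : h 0 xi = 0 -> dtil1 h t 0 xi = h t xi.
  by move=> h0; rewrite /dtil1 h0 scaler0 subr0.
rewrite -(d0 g (zg xi xi0)) -(d0 f (zf xi xi0)).
apply: etrans (eg t 0 xi t00 tT xi0) (etrans _ (esym (ef t 0 xi t00 tT xi0))).
exact: (esym (Jsig_ext phi xt1 xt2 xt3 sigma yE xi t00 tT)).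
Qed.

(** A path g of the one-step scheme satisfies the equation only up to null sets. It serves to define
    the state y, and the solution is the integral of sigma(y) from 0, which agrees with g almost
    everywhere because both are of Davie type for the germ of y. *)
Lemma solution_exists (T kap C M : R) :
  rough_driver phi T kap xt1 xt2 xt3 C -> regular_sigma sigma M -> 0 < T ->
  1 / 3 < kap -> kap < 1 / 2 -> mwc2 phi T xt1 -> mwc2 phi T xt2 ->
  exists f, is_solution phi T kap xt1 xt2 xt3 sigma a0 f.
Proof.
move=> Hd hs T0 k3 k2 c1 c2; have M0 := rs_M hs; have C0 := rd_C Hd.
have k0 : 0 < kap by apply: lt_trans k3; rewrite divr_gt0.
have k21 : 2 * kap <= 1 by rewrite mulrC -ler_pdivlMr // ltW.
have k20 : 0 < 2 * kap by rewrite mulr_gt0.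
have k30 : 0 < 3 * kap by rewrite mulr_gt0.
have [g [Ng [Ng0 g0 dg]]] := davie_flow_exists mphi a0 Hd hs T0 k3 k2.
pose y v := state phi a0 (g v).
pose P := d%:R * (M * C); have P0 : 0 <= P by rewrite !mulr_ge0.
(* The bound of order 3 kap for g subtracts the x2 term of the germ as well; moving this term into
   the remainder leaves order 2 kap. *)
have [K K0 hy] : exists2 K, 0 <= K & controlled phi xt1 sigma T kap K y.
  have NP0 : 0 <= Ng * T `^ kap + P by rewrite addr_ge0 // mulr_ge0 // powR_ge0.
  apply: (controlled_state mphi Hd hs T0 k0 k21 NP0 (dv_w dg) g0).
  move=> u s s0 su uT; have u0 := le_trans s0 su; have sT := le_trans su uT.
  have us0 : 0 <= u - s by rewrite subr_ge0.
  have usT : u - s <= T by rewrite lerBlDr (le_trans uT) // lerDl.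
  have [w2 n2] := trp2_wint (y s) Hd hs s0 su uT.
  have [wl _] := trp_lead_wint mphi (y s) Hd hs s0 su uT.
  have w1 := (mwintB mphi (dv_w dg u0 uT) (mwint_heat mphi us0 (dv_w dg s0 sT)).1).1.
  have wd := (mwintB mphi w1 (mwintD mphi wl w2).1).1.
  have n1 : mwnorm phi (fun xi => g u xi - heat (u - s) (g s) xi
      - (trp (xt1 u s) (sig_coef sigma (y s)) xi + trp (xt2 u s) (sig2_coef sigma (y s)) xi))
      <= Ng * T `^ kap * ((u - s) `^ kap) ^+ 2.
    apply: (le_trans (dv_le dg s0 su uT)); rewrite -mulrA ler_wpM2l // powR2.
    have k23 : 2 * kap <= 3 * kap by rewrite ler_wpM2r ?ler_nat // ltW.
    have := ler_powRr us0 usT k20 k23.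
    by rewrite (_ : 3 * kap - 2 * kap = kap) //; ring.
  rewrite mulrDl; apply: le_trans (lerD n1 n2); apply: le_trans (mwintD mphi wd w2).2.
  rewrite le_eqVlt; apply/orP; left; apply/eqP; apply: eq_mwnorm => xi _.
  rewrite -/(y s); move: (trp _ _ xi) (trp _ _ xi) => A B.
  by rewrite opprD addrA subrK.
have [Cs Hs] := controlled_sewable mphi Hd hs k0 K0 hy.
have [crem [mu [N [m1 mk N0 hN]]] _] := rough_rem_props mphi Hd hs T0 k3 K0 hy c1 c2.
have chen := Jsig_chen mphi Hd hs T0 k3 K0 hy c1 c2.
pose f t := Jy T y t 0.
(* At t = u = s = 0 the additivity relation reads J = J + J. *)
have f0 xi : 0 <= xi -> f 0 xi = 0.
  move=> xi0; have := chen 0 0 0 xi (lexx 0) (lexx 0) (lexx 0) (ltW T0) xi0.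
  rewrite /heat subrr mulr0 expR0 scale1r /f; move: (Jsig _ _ _ _ _ _ _ _ _ _ _) => A.
  by move=> /eqP; rewrite -{1}[A]addr0 => /eqP /addrI.
have wf t : 0 <= t -> t <= T -> mwint phi (f t).
  move=> t0 tT; have [w _] := hN t 0 (lexx 0) t0 tT.
  have wp := (sw_w Hs (lexx 0) t0 tT).1.
  by apply: eq_mwint (mwintD mphi wp w).1 => xi _; exact: (esym (JsigE _ _ _ _ _ _ _ _ _ _)).
have ef t s xi : 0 <= s <= t -> t <= T -> 0 <= xi -> dtil1 f t s xi = Jy T y t s xi.
  move=> /andP[s0 st] tT xi0; have := chen t s 0 xi (lexx 0) s0 st tT xi0.
  rewrite /dtil1 /f => ->; rewrite /heat; exact: addrK.
have [mf [Nf [mf1 mfk Nf0 df]]] := Jsig_davie Hd hs T0 k3 K0 hy c1 c2 wf ef.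
have fg t : 0 <= t -> t <= T -> mwnorm phi (fun xi => f t xi - g t xi) = 0.
  pose L := Nf + Ng * T `^ (3 * kap - mf).
  have df' : davie phi T (pincr y) f L mf.
    apply: (davieW df) => //; first exact: lt_trans mf1.
    by rewrite subrr powRr0 mulr1 lerDl mulr_ge0 // powR_ge0.
  have dg' : davie phi T (pincr y) g L mf.
    by apply: (davieW dg) => //; [exact: lt_trans mf1|rewrite lerDr].
  apply: (davie_unique mphi Hs T0 k3 mf1 mfk df' dg').
  apply: etrans (eq_mwnorm phi _)
    (etrans (mwintN mphi (dv_w dg (lexx 0) (ltW T0))).2 g0) => xi xi0.
  by rewrite f0 // sub0r.
(* f and g have the same state on [0,T], so y may be replaced by the state of f inside the
   integral. *)
have yE t : 0 <= t <= T -> y t = state phi a0 (f t).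
  move=> /andP[t0 tT]; apply: esym; apply: eq_state; [exact: wf|exact: (dv_w dg)|exact: fg].
pose z v := state phi a0 (f v).
have hz : controlled phi xt1 sigma T kap K z.
  move=> u s s0 su uT; rewrite /z -!yE ?s0 ?(le_trans s0 su) ?(le_trans su uT) //.
  exact: hy.
have mf0 : 0 < mf := lt_trans ltr01 mf1.
have cf := davie_mwc1 mphi Hs df Nf0 mf0 k0.
have efz t s xi : 0 <= s <= t -> t <= T -> 0 <= xi -> dtil1 f t s xi = Jy T z t s xi.
  move=> hst tT xi0; apply: etrans (ef t s xi hst tT xi0) _.
  exact: (Jsig_ext phi xt1 xt2 xt3 sigma yE xi hst tT).
exists f; split.
- exact/(tC1P mphi).
- have [W W0 hW] := controlled_holder mphi Hd hs k0 K0 hz.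
  exists (n%:R * d%:R * (M * W)) => s t hsT htT; apply: (le_trans (frob_le_l1n _)).
  apply: (@le_trans _ _ (\sum_(i < n) \sum_(j < d) M * W * `|t - s| `^ kap)).
    apply: ler_sum => i _; apply: ler_sum => j _; rewrite mxsubE -mulrA.
    apply: le_trans (ler_wpM2l M0 (hW s t hsT htT)).
    exact: (fp_lip (rs_four hs i j)).
  by rewrite !sumr_const !card_ord -[leLHS]mulr_natl -[X in _ * X]mulr_natl !mulrA.
- have [m3 _] := pincr_mwc2 mphi Hd hs k0 K0 hz c1 c2.
  split.
    apply/(tC2P mphi); apply: eq_mwc2 (mwc2B mphi (mwc2_dtil1 mphi cf) m3).
    by move=> t s xi _ _ _; rewrite -/(z s) trv_sig_coef.
  have [_ [mu' [N' [m1' mk' N0' hN']]] _] := rough_rem_props mphi Hd hs T0 k3 K0 hz c1 c2.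
  (* The remainder of the controlled decomposition is the x2 term, of order 2 kap, plus the sewing
     remainder, whose exponent exceeds 1 >= 2 kap. *)
  exists (P + N' * T `^ (mu' - 2 * kap)) => t s s0 st tT.
  have [w2 n2] := trp2_wint (z s) Hd hs s0 (ltW st) tT.
  have [w1 n1] := hN' t s s0 (ltW st) tT.
  have [w12 n12] := mwintD mphi w2 w1.
  have E xi : 0 <= xi -> trp (xt2 t s) (sig2_coef sigma (z s)) xi
      + rough_rem phi xt1 xt2 xt3 sigma T z t s xi
      = dtil1 f t s xi - (xt1 t s xi *m sigma (a0 + phint phi (f s)))^T.
    move=> xi0; have hst : 0 <= s <= t by rewrite s0 ltW.
    rewrite -/(z s) trv_sig_coef.
    apply: etrans (esym (congr1 (fun v => v - trv (xt1 t s xi) (sig_coef sigma (z s)))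
      (etrans (efz t s xi hst tT xi0) (JsigE _ _ _ _ _ _ _ _ _ _)))).
    rewrite /path_incr /increment /trp -/(trv _ _).
    move: (rough_rem _ _ _ _ _ _ _ _ _ _) => A.
    by apply/matrixP => i j; rewrite !mxE; ring.
  have wE := eq_mwint E w12.
  apply: (le_trans (NL1_le mphi wE)); rewrite lee_fin -(eq_mwnorm phi E).
  have ts0 : 0 <= t - s by rewrite subr_ge0 ltW.
  have tsT : t - s <= T by rewrite lerBlDr (le_trans tT) // lerDl.
  have k2m : 2 * kap <= mu' by apply: (le_trans k21); exact: ltW.
  apply: (le_trans n12); rewrite mulrDl; apply: lerD; first by rewrite -powR2.
  by apply: (le_trans n1); rewrite -mulrA ler_wpM2l //; exact: ler_powRr.
- exact: f0.
- exact: efz.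
Qed.

End Solutions.

Theorem theorem4p16 (R : realType) (T : R) (phi : R -> R) (n d : nat)
    (gamma kappa : R)
    (xt1 : R -> R -> R -> 'M[R]_(1, n)) (xt2 : R -> R -> R -> 'M[R]_(n, n))
    (xt3 : R -> R -> R -> R -> 'M[R]_(n, n))
    (a0 : 'cV[R]_d) (sigma : 'cV[R]_d -> 'M[R]_(n, d)) :
  0 < T ->
  measurable_fun (`]0%R, +oo[%classic : set R) phi ->
  1 / 3 < gamma < 1 / 2 ->
  1 / 3 < kappa < gamma ->
  roughH phi T gamma xt1 xt2 xt3 ->
  (forall (i : 'I_n) (j : 'I_d), C3b (fun z => sigma z i j)) ->
  exists ytil : R -> R -> 'cV[R]_d,
    is_solution phi T kappa xt1 xt2 xt3 sigma a0 ytil /\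
    forall ytil' : R -> R -> 'cV[R]_d,
      is_solution phi T kappa xt1 xt2 xt3 sigma a0 ytil' ->
      forall t xi, 0 <= t <= T -> 0 <= xi -> ytil' t xi = ytil t xi.
Proof.
move=> T0 mphi /andP[_ g2] /andP[k3 kg] hH hs.
have k0 : 0 < kappa by apply: lt_trans k3; rewrite divr_gt0.
have k2 : kappa < 1 / 2 := lt_trans kg g2.
have [C Hd] := roughH_driver mphi T0 k0 (ltW kg) hH.
have [M hM] := C3b_regular_sigma hs.
have [[/(tC2P mphi) c1 _] [/(tC2P mphi) c2 _] _ _ _] := hH.
have [f sf] := solution_exists mphi a0 Hd hM T0 k3 k2 c1 c2.
exists f; split=> // g sg; exact: (solution_unique mphi Hd hM T0 k3 k2 c1 c2 sf sg).
Qed.
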